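(* Under the arithmetic pointer machine model, given a set $P$ of $n$ colored points on the plane and an integer parameter $X\in[1,n]$, there is a data structure occupying $O\big((\frac{n}{X})^2 \lg^4 n + n\lg^3 n\big)$ words of space that answers 2D orthogonal colored range counting queries over $P$ in $O(\lg^5 n + X\lg^3 n)$ time. In particular, setting $X=\sqrt{n\lg n}$ yields an $O(n\lg^3 n)$-word data structure with $O(\sqrt{n}\,\lg^{7/2} n)$ query time.
   Context: Model of computation: arithmetic pointer machine, i.e. memory consists of constant-size records accessible only by following pointers (no address arithmetic / random access to arrays), while standard arithmetic operations and comparisons on stored data values take constant time. Space is measured in words. $\lg$ denotes the base-2 logarithm. Points are assumed to be in general position. Constants hidden in $O(\cdot)$ do not depend on $n$, $X$ or the point set; when a parameter is set to a non-integer expression, rounding to an integer is understood. 2D orthogonal colored range counting: a set $P$ of $n$ points in the plane is given, each point assigned one of $C$ colors, identified by integers in $[1,C]$. The set is preprocessed into a data structure. A query is an axis-aligned rectangle $Q=[a,b]\times[c,d]$, and the answer is the number of distinct colors among the points of $P\cap Q$. *)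

(* Defs.v *)
From HB Require Import structures.
From mathcomp Require Import all_boot all_order all_algebra.
From mathcomp Require Import reals exp.

Set Implicit Arguments.
Unset Strict Implicit.
Unset Printing Implicit Defensive.

Import Order.TTheory GRing.Theory Num.Theory.
Local Open Scope ring_scope.

(** * Arithmetic pointer machine

    Memory is a growing collection of records with [K] one-word fields each;
    [K] does not depend on the input.  A word is empty, a pointer, an integer,
    or a coordinate.  The address carried by a pointer is only a name: no
    instruction converts between pointers and numbers, or computes with
    pointers beyond following them and testing them for equality.

    Integer words are bounded by a parameter [W] (polynomial in the input size
    where the machine is used, i.e. O(lg n) bits): with unbounded integers at
    unit cost, a single word could hold a whole table.  Coordinates are
    arbitrary real numbers. *)

Inductive value (R : Type) : Type :=
  | Nil
  | Ptr of nat
  | Int of int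
  | Coord of R.
Arguments Nil {R}.
Arguments Ptr {R} _.
Arguments Int {R} _.

Definition block (R : Type) (K : nat) := {ffun 'I_K -> value R}.

Record state (R : Type) (K : nat) := State {
  regs : nat -> value R;      (* a program mentions only finitely many *)
  heap : seq (block R K)      (* the record with address [a] is the [a]-th *)
}.

Inductive arith_op := OpAdd | OpSub | OpMul | OpDiv.

(* Registers are named by [nat]; the first argument is the destination. *)
Inductive instr (K : nat) : Type :=
  | Move of nat & nat
  | SetNil of nat
  | SetInt of nat & int
  | Arith of arith_op & nat & nat & nat
  | New of nat
  | ReadField of nat & nat & 'I_K    (* ReadField d p f: d := p.f *)
  | WriteField of nat & 'I_K & nat.  (* WriteField p f s: p.f := s *)
Arguments Move {K} _ _.
Arguments SetNil {K} _.
Arguments SetInt {K} _ _.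
Arguments Arith {K} _ _ _ _.
Arguments New {K} _.

Inductive test : Type :=
  | TEq of nat & nat
  | TLt of nat & nat
  | TNot of test.

Inductive cmd (K : nat) : Type :=
  | Op of instr K
  | Seq of cmd K & cmd K
  | If of test & cmd K & cmd K
  | While of test & cmd K.

Section Semantics.
Variables (R : realType) (K W : nat).
Implicit Types (s : state R K) (v : value R).

Definition in_word (z : int) : bool := (`|z| <= W)%N.

Definition mk_int (z : int) : option (value R) :=
  if in_word z then Some (Int z) else None.

(* [None] means that the machine is stuck; integer division rounds down for a
   positive divisor. *)
Definition eval_arith (o : arith_op) (v1 v2 : value R) : option (value R) :=
  match v1, v2 with
  | Int x, Int y =>
      match o with
      | OpAdd => mk_int (x + y)
      | OpSub => mk_int (x - y)
      | OpMul => mk_int (x * y)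
      | OpDiv => if y == 0 then None else mk_int (x %/ y)%Z
      end
  | Coord x, Coord y =>
      match o with
      | OpAdd => Some (Coord (x + y))
      | OpSub => Some (Coord (x - y))
      | OpMul => Some (Coord (x * y))
      | OpDiv => if y == 0 then None else Some (Coord (x / y))
      end
  | _, _ => None
  end.

Definition value_eq (v1 v2 : value R) : bool :=
  match v1, v2 with
  | Nil, Nil => true
  | Ptr a, Ptr b => a == b
  | Int x, Int y => x == y
  | Coord x, Coord y => x == y
  | _, _ => false
  end.

Definition value_lt (v1 v2 : value R) : option bool :=
  match v1, v2 with
  | Int x, Int y => Some (x < y)
  | Coord x, Coord y => Some (x < y)
  | _, _ => None
  end.

Fixpoint eval_test (b : test) s : option bool :=
  match b with
  | TEq r1 r2 => Some (value_eq (regs s r1) (regs s r2))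
  | TLt r1 r2 => value_lt (regs s r1) (regs s r2)
  | TNot b' => omap negb (eval_test b' s)
  end.

Definition empty_block : block R K := [ffun=> Nil].

Definition set_reg s (d : nat) v : state R K :=
  State (fun r => if r == d then v else regs s r) (heap s).

Definition deref s (p : nat) : option (nat * block R K) :=
  if regs s p is Ptr a then omap (pair a) (onth (heap s) a) else None.

Definition set_field (b : block R K) (f : 'I_K) v : block R K :=
  [ffun g => if g == f then v else b g].

Definition step (i : instr K) s : option (state R K) :=
  match i with
  | Move d r => Some (set_reg s d (regs s r))
  | SetNil d => Some (set_reg s d Nil)
  | SetInt d z => omap (set_reg s d) (mk_int z)
  | Arith o d r1 r2 =>
      omap (set_reg s d) (eval_arith o (regs s r1) (regs s r2))
  | New d =>
      Some (set_reg (State (regs s) (rcons (heap s) empty_block))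
                    d (Ptr (size (heap s))))
  | ReadField d p f =>
      if deref s p is Some (_, b) then Some (set_reg s d (b f)) else None
  | WriteField p f r =>
      if deref s p is Some (a, b) then
        Some (State (regs s)
                (set_nth empty_block (heap s) a (set_field b f (regs s r))))
      else None
  end.

(* [exec q s t s']: started in [s], [q] halts in [s'] after exactly [t] unit
   time steps (one per instruction and one per evaluation of a guard). *)
Inductive exec : cmd K -> state R K -> nat -> state R K -> Prop :=
  | ExecOp i s s' :
      step i s = Some s' -> exec (Op i) s 1 s'
  | ExecSeq q1 q2 s s1 s2 t1 t2 :
      exec q1 s t1 s1 -> exec q2 s1 t2 s2 -> exec (Seq q1 q2) s (t1 + t2) s2
  | ExecIf b q1 q2 s s' t (v : bool) :
      eval_test b s = Some v -> exec (if v then q1 else q2) s t s' ->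
      exec (If b q1 q2) s t.+1 s'
  | ExecWhileEnd b q s :
      eval_test b s = Some false -> exec (While b q) s 1 s
  | ExecWhileLoop b q s s1 s2 t1 t2 :
      eval_test b s = Some true ->
      exec q s t1 s1 -> exec (While b q) s1 t2 s2 ->
      exec (While b q) s (t1 + t2).+1 s2.

End Semantics.

(** * Colored range counting *)

(* For problems that only involve the two axis-parallel orders, general
   position means that no two points share an x- or a y-coordinate. *)
Definition general_position (R : realType) (n : nat) (p : 'I_n -> R * R) :
    Prop :=
  injective (fun i => (p i).1) /\ injective (fun i => (p i).2).

Definition in_rect (R : realType) (a b c d : R) (z : R * R) : bool :=
  (a <= z.1 <= b) && (c <= z.2 <= d).

Definition colored_count (R : realType) (n : nat) (p : 'I_n -> R * R)
    (col : 'I_n -> nat) (a b c d : R) : nat :=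
  size (undup [seq col i | i <- enum 'I_n & in_rect a b c d (p i)]).

Record structure (R : Type) (K : nat) := Structure {
  records : seq (block R K);
  root : value R
}.

Definition space (R : Type) (K : nat) (D : structure R K) : nat :=
  (K * size (records D)).+1.

(* The only coordinates stored by preprocessing are those of input points, so
   that no precomputed information can be packed into a real number. *)
Definition valid_value (R : realType) (K W n : nat) (p : 'I_n -> R * R)
    (D : structure R K) (v : value R) : Prop :=
  match v with
  | Nil => True
  | Ptr a => (a < size (records D))%N
  | Int z => in_word W z
  | Coord x => exists i, x = (p i).1 \/ x = (p i).2
  end.

Definition valid_structure (R : realType) (K W n : nat) (p : 'I_n -> R * R)
    (D : structure R K) : Prop :=
  valid_value W p D (root D) /\
  forall a b, onth (records D) a = Some b ->
    forall f, valid_value W p D (b f).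

Definition query_state (R : realType) (K : nat) (D : structure R K)
    (a b c d : R) : state R K :=
  State (nth Nil [:: root D; Coord a; Coord b; Coord c; Coord d]) (records D).

(* The program may use fresh records as working memory, but must leave the
   structure itself as it found it, so that it can serve any number of
   queries.  The answer is returned in register 0. *)
Definition answers_query (R : realType) (K W : nat) (q : cmd K)
    (D : structure R K) (a b c d : R) (ans : nat) (T : R) : Prop :=
  exists t s',
    [/\ exec W q (query_state D a b c d) t s',
        t%:R <= T,
        regs s' 0 = Int ans%:Z &
        take (size (records D)) (heap s') = records D].

(* [D], queried by program [q] on a machine with word bound [W], solves 2D
   orthogonal colored range counting in [S] words and query time [T]. *)
Definition counts_colors (R : realType) (K W : nat) (q : cmd K) (n : nat)
    (p : 'I_n -> R * R) (col : 'I_n -> nat) (D : structure R K) (S T : R) :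
    Prop :=
  [/\ valid_structure W p D,
      (space D)%:R <= S &
      forall a b c d : R, a <= b -> c <= d ->
        answers_query W q D a b c d (colored_count p col a b c d) T].

Definition lg (R : realType) (x : R) : R := ln x / ln 2.

(* The parameter [X] is the real number [x] rounded down or up. *)
Definition rounds (R : realType) (X : nat) (x : R) : Prop :=
  X%:Z = Num.floor x \/ X%:Z = Num.ceil x.

(* Main.v *)
(* A point of a set is the highest (or lowest) of its color in the slab [a, b]
   exactly when (a, b) lies in a product of two intervals, so a two-level
   segment tree reports the colors met by a three-sided query as O(lg^2 n)
   prefixes of lists sorted by ordinate, without repetition.  A balanced tree
   over the ordinates reduces a query to one upper and one lower three-sided
   query, and it remains to count the colors common to both.  Lists are cut
   into blocks of X points.  The number of colors common to a prefix of whole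
   blocks of an upper list and a prefix of whole blocks of a lower list is
   tabulated: summed over all the pairs of blocks, this takes
   O((n / X)^2 lg^4 n) space.  The fewer than X remaining points of each list
   are tested one by one, in O(lg n) time each, against the opposite query;
   marks on the colors avoid counting twice those that remain on both sides.

   All these searches are walks in decision trees with shared subtrees, so the
   query program is essentially one loop that walks such a tree with an
   explicit stack. *)

Require Import Defs.
From mathcomp Require Import all_boot all_order all_algebra.
From mathcomp Require Import reals exp.
From mathcomp Require Import boolp zify ring lra.

Import Order.TTheory GRing.Theory Num.Theory.
Local Open Scope ring_scope.

Set Implicit Arguments.
Unset Strict Implicit.
Unset Printing Implicit Defensive.

(** Colors common to an upper and a lower query fall into three classes: both representatives in
    whole blocks, the upper one left over, only the lower one left over. The answer is the sum of
    the prefix lengths minus three counts, so a walk only adds signed constants. The third class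
    depends on the set of leftover upper colors; hence two walks with the marks set in between, and
    one guard record per color, since a color cannot index an array.

    Nor can a pair of block numbers. Each nonempty prefix of whole upper blocks points to its own
    copy of the two-level tree over the lower points, pruned where fewer than [X] points remain and
    searched only among the last points of blocks. For m lower points a copy has O((m/X) lg^2 n)
    records and is walked in O(lg^3 n) time; O(lg^2 n) upper lists make it lg^5 n.

    The tables of a node are quadratic in its size and shrink geometrically with depth; the linear
    part, m lg^2 n per node, recurs on O(lg n) levels and gives n lg^3 n. Correctness is argued on
    ranks, which the machine never sees: it only compares coordinates. *)

Inductive side := SA | SB | SC | SD.

(** * Walk trees: the trace and the cost of a walk *)

Section WalkTree.
Variable I : Type.

(* A walk sums the integers of the [Add]s and collects the addresses of the
   [Out]s that it meets.  [Guard a t] is skipped when the record with address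
   [a], which is the guard itself, is marked. *)
Inductive wtree : Type :=
  | Stop
  | Add of int
  | Out of nat
  | Br of side & I & wtree & wtree
  | Both of wtree & wtree
  | Guard of nat & wtree.

Variables (viol : side -> I -> bool) (S : pred nat).

Fixpoint events (t : wtree) : seq (int + nat) :=
  match t with
  | Stop => [::]
  | Add z => [:: inl z]
  | Out a => [:: inr a]
  | Br z i t1 t2 => if viol z i then events t1 else events t2
  | Both t1 t2 => events t1 ++ events t2
  | Guard a t => if S a then [::] else events t
  end.

Fixpoint cost (t : wtree) : nat :=
  match t with
  | Stop | Add _ | Out _ => 1
  | Br z i t1 t2 => (if viol z i then cost t1 else cost t2).+1
  | Both t1 t2 => ((cost t1 + cost t2).+1)%N
  | Guard a t => (if S a then 0%N else cost t).+1
  end.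

End WalkTree.
Arguments Stop {I}.
Arguments Add {I} _.
Arguments Out {I} _.

Definition gain (es : seq (int + nat)) : int :=
  \sum_(e <- es) (if e is inl z then z else 0).
Definition outs (es : seq (int + nat)) : seq nat :=
  pmap (fun e => if e is inr a then Some a else None) es.

Lemma gain_cat es1 es2 : gain (es1 ++ es2) = gain es1 + gain es2.
Proof. by rewrite /gain big_cat. Qed.

Lemma outs_cat es1 es2 : outs (es1 ++ es2) = outs es1 ++ outs es2.
Proof. exact: pmap_cat. Qed.

Lemma cost_gt0 (I : Type) viol S (t : wtree I) : (0 < cost viol S t)%N.
Proof. by case: t. Qed.

(** * The query program *)

(* Mark, kind, payload, left and right subtree.  The cells of the working lists
   use only [fp] (head) and [fl] (tail). *)
Definition fm : 'I_5 := @Ordinal 5 0 isT.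
Definition fk : 'I_5 := @Ordinal 5 1 isT.
Definition fp : 'I_5 := @Ordinal 5 2 isT.
Definition fl : 'I_5 := @Ordinal 5 3 isT.
Definition fr : 'I_5 := @Ordinal 5 4 isT.

(* [rA], ..., [rD]: the query; [rS]: stack of the walk; [rT]: running total;
   [rO]: list of the collected addresses; [rN] is never assigned and stays
   [Nil]; register 0 holds the root. *)
Local Notation rA := 1%N (only parsing).
Local Notation rB := 2%N (only parsing).
Local Notation rC := 3%N (only parsing).
Local Notation rD := 4%N (only parsing).
Local Notation rX := 5%N (only parsing).
Local Notation rS := 6%N (only parsing).
Local Notation rT := 7%N (only parsing).
Local Notation rO := 8%N (only parsing).
Local Notation rK := 9%N (only parsing).
Local Notation rP := 10%N (only parsing).
Local Notation rL := 11%N (only parsing).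
Local Notation rR := 12%N (only parsing).
Local Notation rU := 13%N (only parsing).
Local Notation rN := 14%N (only parsing).
Local Notation rQ := 15%N (only parsing).

Local Notation "q1 ;; q2" := (Seq q1 q2) (at level 60, right associativity).

Definition cons_to (d r : nat) : cmd 5 :=
  Op (New rU) ;; Op (WriteField rU fp r) ;; Op (WriteField rU fl d) ;;
  Op (Move d rU).

Definition on_kind (k : nat) (q1 q2 : cmd 5) : cmd 5 :=
  Op (SetInt rU k%:Z) ;; If (TEq rK rU) q1 q2.

Definition skip : cmd 5 := Op (Move rX rX).

(** Kinds 0 to 3 compare the stored coordinate with one end of the query; 4, 5 and 6 are [Both],
    [Add] and [Out]; the default case is [Guard]. [Both] pushes its right subtree before the left
    one, so that the left one is walked first, as in [events]. *)
Definition dispatch : cmd 5 :=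
  on_kind 0 (If (TLt rP rA) (cons_to rS rL) (cons_to rS rR)) (
  on_kind 1 (If (TLt rB rP) (cons_to rS rL) (cons_to rS rR)) (
  on_kind 2 (If (TLt rP rC) (cons_to rS rL) (cons_to rS rR)) (
  on_kind 3 (If (TLt rD rP) (cons_to rS rL) (cons_to rS rR)) (
  on_kind 4 (cons_to rS rR ;; cons_to rS rL) (
  on_kind 5 (Op (Arith OpAdd rT rT rP)) (
  on_kind 6 (cons_to rO rP) (
  Op (ReadField rU rX fm) ;; If (TEq rU rN) (cons_to rS rL) skip))))))).

Definition visit_node : cmd 5 :=
  Op (ReadField rK rX fk) ;; Op (ReadField rP rX fp) ;;
  Op (ReadField rL rX fl) ;; Op (ReadField rR rX fr) ;; dispatch.

Definition walk_body : cmd 5 :=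
  Op (ReadField rX rS fp) ;; Op (ReadField rS rS fl) ;;
  If (TEq rX rN) skip visit_node.

Definition walk : cmd 5 := While (TNot (TEq rS rN)) walk_body.

(** One loop sets and clears: called with [rU] it writes the 1 that is reloaded at each round,
    called with [rN] it writes [Nil]. *)
Definition mark_loop (r : nat) : cmd 5 :=
  While (TNot (TEq rQ rN))
    (Op (SetInt rU 1) ;; Op (ReadField rX rQ fp) ;; Op (WriteField rX fm r) ;;
     Op (ReadField rQ rQ fl)).

Definition set_marks (r : nat) : cmd 5 := Op (Move rQ rO) ;; mark_loop r.

(** The left and right fields of the root hold the trees of the two walks. The list in [rO] is not
    emptied between them, so the last [set_marks] erases every mark that the first one made. *)
Definition query_cmd : cmd 5 :=
  Op (SetInt rT 0) ;; Op (ReadField rX 0 fl) ;; cons_to rS rX ;; walk ;;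
  set_marks rU ;;
  Op (ReadField rX 0 fr) ;; cons_to rS rX ;; walk ;;
  set_marks rN ;;
  Op (Move 0 rT).

(** * Correctness and running time of the query program *)

Section Run.
Variables (R : realType) (n W : nat) (key : side -> 'I_n -> R).
Variables (qa qb qc qd : R).
Notation block := (Defs.block R 5).
Notation state := (Defs.state R 5).
Notation wtree := (wtree 'I_n).
Implicit Types (s : state) (h : seq block) (t : wtree) (v : value R).

Definition side_code (z : side) : nat :=
  match z with SA => 0 | SB => 1 | SC => 2 | SD => 3 end.

Definition violates (z : side) (i : 'I_n) : bool :=
  match z with
  | SA => key SA i < qa
  | SB => qb < key SB i
  | SC => key SC i < qc
  | SD => qd < key SD i
  end.

Definition node h v (k : nat) (pay l r : value R) : Prop :=
  exists a b, [/\ v = Ptr a, onth h a = Some b &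
    [/\ b fk = Int k%:Z, b fp = pay, b fl = l & b fr = r]].

(** [Stop] is the empty word and takes no record. A [Guard] must sit at the very address that it
    tests, which makes its mark field the mark of a color. The bound on the constant of [Add] is
    what keeps running totals within a word. *)
Fixpoint rep h t v : Prop :=
  match t with
  | Stop => v = Defs.Nil
  | Add z => (`|z| <= n)%N /\ exists l r, node h v 5 (Int z) l r
  | Out a => (a < size h)%N /\ exists l r, node h v 6 (Ptr a) l r
  | Br z i t1 t2 => exists l r,
      [/\ node h v (side_code z) (Coord (key z i)) l r, rep h t1 l & rep h t2 r]
  | Both t1 t2 => exists pay l r,
      [/\ node h v 4 pay l r, rep h t1 l & rep h t2 r]
  | Guard a t1 => exists pay l r,
      [/\ v = Ptr a, node h v 7 pay l r & rep h t1 l]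
  end.

(* The addresses of the cells are bounded below by [m] to separate them from
   the records of the structure. *)
Fixpoint list_rep (m : nat) h v (l : seq (value R)) : Prop :=
  if l is x :: l' then
    exists a b, [/\ v = Ptr a, (m <= a)%N, onth h a = Some b,
      b fp = x & list_rep m h (b fl) l']
  else v = Defs.Nil.

Definition marked_copy (S : pred nat) h0 h : Prop :=
  (size h0 <= size h)%N /\
  forall a b, onth h0 a = Some b ->
  exists b', [/\ onth h a = Some b', forall f, f != fm -> b' f = b f &
               b' fm = if S a then Int 1 else Defs.Nil].

Record inv h0 (S : pred nat) v0 s (l : seq (value R)) (tot : int)
    (o : seq nat) : Prop := Inv {
  inv_heap : marked_copy S h0 (heap s);
  inv_stack : list_rep (size h0) (heap s) (regs s rS) l;
  inv_out : list_rep (size h0) (heap s) (regs s rO) (map (@Ptr R) o);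
  inv_tot : regs s rT = Int tot;
  inv_reg : [/\ regs s rA = Coord qa, regs s rB = Coord qb,
                regs s rC = Coord qc & regs s rD = Coord qd];
  inv_nil : regs s rN = Defs.Nil;
  inv_root : regs s 0 = v0 }.

(** A total-correctness triple with a time budget in place of the exact time of [exec]. What a
    command leaves of the budget is passed on to the next one, so the rules compose without naming
    the actual number of steps. *)
Definition wp (q : cmd 5) s (N : nat) (Q : state -> Prop) : Prop :=
  exists (t : nat) s', [/\ exec W q s t s', (t <= N)%N & Q s'].

Lemma wp_op i s s' N (Q : state -> Prop) :
  step W i s = Some s' -> (0 < N)%N -> Q s' -> wp (Op i) s N Q.
Proof. by move=> e N0 q; exists 1%N, s'; split=> //; apply: ExecOp. Qed.

Lemma wp_seq N1 q1 q2 s N (Q : state -> Prop) :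
  (N1 <= N)%N -> wp q1 s N1 (fun s1 => wp q2 s1 (N - N1) Q) ->
  wp (q1 ;; q2) s N Q.
Proof.
move=> le [t1 [s1 [e1 l1 [t2 [s2 [e2 l2 q]]]]]].
exists (t1 + t2)%N, s2; split=> //; first exact: ExecSeq e1 e2.
by rewrite -(subnKC le) leq_add.
Qed.

Lemma wp_seq_op i q s s' N (Q : state -> Prop) :
  step W i s = Some s' -> (0 < N)%N -> wp q s' N.-1 Q -> wp (Op i ;; q) s N Q.
Proof.
by move=> e N0 q'; apply: (@wp_seq 1)=> //; apply: wp_op e _ _ => //; rewrite subn1.
Qed.

Lemma wp_if b q1 q2 s N (v : bool) (Q : state -> Prop) :
  eval_test b s = Some v -> (0 < N)%N -> wp (if v then q1 else q2) s N.-1 Q ->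
  wp (If b q1 q2) s N Q.
Proof.
move=> e N0 [t [s' [e1 l1 q]]]; exists t.+1, s'; split=> //.
  exact: ExecIf e e1.
by rewrite -(prednK N0).
Qed.

Lemma wp_mono q s N N' (Q Q' : state -> Prop) :
  (N <= N')%N -> (forall s', Q s' -> Q' s') -> wp q s N Q -> wp q s N' Q'.
Proof.
move=> le QQ [t [s' [e l1 q']]]; exists t, s'; split=> //; last exact: QQ.
exact: leq_trans le.
Qed.

Lemma wp_while_end b q s (Q : state -> Prop) :
  eval_test b s = Some false -> Q s -> wp (While b q) s 1 Q.
Proof. by move=> e q'; exists 1%N, s; split=> //; apply: ExecWhileEnd. Qed.

Lemma wp_while_step N1 b q s N (Q : state -> Prop) :
  eval_test b s = Some true -> (N1 < N)%N ->
  wp q s N1 (fun s1 => wp (While b q) s1 (N - N1.+1) Q) ->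
  wp (While b q) s N Q.
Proof.
move=> e le [t1 [s1 [e1 l1 [t2 [s2 [e2 l2 q']]]]]].
exists (t1 + t2).+1, s2; split=> //; first exact: ExecWhileLoop e e1 e2.
by rewrite -(subnKC le) -addSn leq_add.
Qed.

Lemma onth_lt (T : Type) (l : seq T) a b : onth l a = Some b -> (a < size l)%N.
Proof. by move=> e; rewrite -onthTE e. Qed.

Lemma onth_cat_left (T : Type) (l l' : seq T) a b :
  onth l a = Some b -> onth (l ++ l') a = Some b.
Proof. by move=> e; rewrite onth_cat (onth_lt e). Qed.

Lemma onth_rcons_size (T : Type) (l : seq T) b :
  onth (rcons l b) (size l) = Some b.
Proof. by rewrite -cats1 onth_cat ltnn subnn. Qed.

Lemma wp_read a b d p f q s N (Q : state -> Prop) :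
  regs s p = Ptr a -> onth (heap s) a = Some b -> (0 < N)%N ->
  wp q (set_reg s d (b f)) N.-1 Q -> wp (Op (ReadField d p f) ;; q) s N Q.
Proof. by move=> ep eb N0; apply: wp_seq_op => //=; rewrite /deref ep eb. Qed.

Lemma set_nth_size_rcons (T : Type) x0 (l : seq T) x y :
  set_nth x0 (rcons l x) (size l) y = rcons l y.
Proof. by elim: l => //= z l ->. Qed.

Lemma wp_cons_to d r s N (Q : state -> Prop) :
  d != rU -> r != rU -> (4 <= N)%N ->
  (forall s' b, heap s' = rcons (heap s) b -> b fp = regs s r ->
     b fl = regs s d -> regs s' d = Ptr (size (heap s)) ->
     (forall x, x != d -> x != rU -> regs s' x = regs s x) -> Q s') ->
  wp (cons_to d r) s N Q.
Proof.
move=> dU rU' + q; case: N => [|[|[|[|N]]]] // _.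
apply: wp_seq_op => //.
apply: wp_seq_op => //; first by rewrite /= /deref /= onth_rcons_size.
apply: wp_seq_op => //.
  by rewrite /= /deref /= set_nth_size_rcons onth_rcons_size.
apply: wp_op => //.
apply: q; rewrite /= ?(negPf dU) ?(negPf rU') ?set_nth_size_rcons.
- by [].
- by rewrite /set_field !ffunE /=.
- by rewrite /set_field !ffunE /=.
- by rewrite eqxx.
- by move=> x /negPf -> /negPf ->.
Qed.

Lemma list_rep_cat m h h' v l : list_rep m h v l -> list_rep m (h ++ h') v l.
Proof.
elim: l v => //= x l IH v [a [b [-> am /(onth_cat_left h') ab bx /IH lr]]].
by exists a, b.
Qed.

Lemma marked_copy_cat S h0 h h' : marked_copy S h0 h -> marked_copy S h0 (h ++ h').
Proof.
move=> [le c]; split; first by rewrite size_cat (leq_trans le) ?leq_addr.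
move=> a b /c [b' [/(onth_cat_left h') ab' e m]].
by exists b'.
Qed.

Lemma inv_regs h0 S v0 s s' l tot o :
  heap s' = heap s ->
  (forall x, x \in [:: 0; 1; 2; 3; 4; 6; 7; 8; 14]%N -> regs s' x = regs s x) ->
  inv h0 S v0 s l tot o -> inv h0 S v0 s' l tot o.
Proof. by move=> eh er []; split; rewrite ?eh ?er. Qed.

Lemma inv_push h0 S v0 s s' v b l tot o :
  heap s' = rcons (heap s) b -> b fp = v -> b fl = regs s rS ->
  regs s' rS = Ptr (size (heap s)) ->
  (forall x, x != rS -> x != rU -> regs s' x = regs s x) ->
  inv h0 S v0 s l tot o -> inv h0 S v0 s' (v :: l) tot o.
Proof.
move=> eh bv bl es er [] [le c] st out *; split; rewrite ?eh ?es ?er //.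
- by rewrite -cats1; apply: marked_copy_cat.
- exists (size (heap s)), b; split=> //; first exact: onth_rcons_size.
  by rewrite bl -cats1; apply: list_rep_cat.
- by rewrite -cats1; apply: list_rep_cat.
Qed.

Lemma inv_out_push h0 S v0 s s' a b l tot o :
  heap s' = rcons (heap s) b -> b fp = Ptr a -> b fl = regs s rO ->
  regs s' rO = Ptr (size (heap s)) ->
  (forall x, x != rO -> x != rU -> regs s' x = regs s x) ->
  inv h0 S v0 s l tot o -> inv h0 S v0 s' l tot (a :: o).
Proof.
move=> eh bv bl es er [] [le c] st out *; split; rewrite ?eh ?es ?er //.
- by rewrite -cats1; apply: marked_copy_cat.
- by rewrite -cats1; apply: list_rep_cat.
- exists (size (heap s)), b; split=> //; first exact: onth_rcons_size.
  by rewrite bl -cats1; apply: list_rep_cat.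
Qed.

(** With [own], this separates one visit from the rest of a walk: [own] is what the visit itself
    emits, [kids] what it pushes on the stack. *)
Definition kids (S : pred nat) t : seq wtree :=
  match t with
  | Stop | Add _ | Out _ => [::]
  | Br z i t1 t2 => [:: if violates z i then t1 else t2]
  | Both t1 t2 => [:: t1; t2]
  | Guard a t => if S a then [::] else [:: t]
  end.

Definition own t : seq (int + nat) :=
  match t with Add z => [:: inl z] | Out a => [:: inr a] | _ => [::] end.

Lemma events_kids S t :
  events violates S t = own t ++ flatten (map (events violates S) (kids S t)).
Proof.
case: t => //= [z i t1 t2|t1 t2|a t].
- by rewrite cats0; case: ifP.
- by rewrite cats0.
- by case: ifP => //=; rewrite cats0.
Qed.

Lemma cost_kids S t :
  cost violates S t = (sumn (map (cost violates S) (kids S t))).+1.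
Proof.
case: t => //= [z i t1 t2|t1 t2|a t].
- by rewrite addn0; case: ifP.
- by rewrite addn0.
- by case: ifP => //=; rewrite addn0.
Qed.

Fixpoint reps h (ts : seq wtree) (l : seq (value R)) : Prop :=
  match ts, l with
  | [::], [::] => True
  | t :: ts, v :: l => rep h t v /\ reps h ts l
  | _, _ => False
  end.

Lemma wp_on_kind_ne kd k q1 q2 s N (Q : state -> Prop) :
  regs s rK = Int kd -> kd != k%:Z -> (k <= W)%N -> (2 <= N)%N ->
  wp q2 (set_reg s rU (Int k)) N.-2 Q -> wp (on_kind k q1 q2) s N Q.
Proof.
move=> ek ne kW N2 w; apply: wp_seq_op => /=.
- by rewrite /mk_int /in_word absz_nat kW.
- exact: leq_trans N2.
- apply: (@wp_if _ _ _ _ _ false); rewrite /= ?ek /= ?(negPf ne) //.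
  by case: N N2 w => [|[|]].
Qed.

Lemma wp_on_kind_eq k q1 q2 s N (Q : state -> Prop) :
  regs s rK = Int k%:Z -> (k <= W)%N -> (2 <= N)%N ->
  wp q1 (set_reg s rU (Int k)) N.-2 Q -> wp (on_kind k q1 q2) s N Q.
Proof.
move=> ek kW N2 w; apply: wp_seq_op => /=.
- by rewrite /mk_int /in_word absz_nat kW.
- exact: leq_trans N2.
- apply: (@wp_if _ _ _ _ _ true); rewrite /= ?ek /= ?eqxx //.
  by case: N N2 w => [|[|]].
Qed.

Hypothesis W7 : (7 <= W)%N.

(** The first list holds the scratch registers, the second one those that [inv] speaks of. *)
Let stay : (forall s x v, x \in [:: 5; 9; 10; 11; 12; 13; 15]%N ->
  forall y, y \in [:: 0; 1; 2; 3; 4; 6; 7; 8; 14]%N ->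
  regs (set_reg s x v) y = regs s y).
Proof.
move=> s x v xi y yi /=; case: eqP => // e; move: xi yi; rewrite e.
by rewrite !inE; lia.
Qed.

Lemma inv_set h0 S v0 s l tot o x v :
  x \in [:: 5; 9; 10; 11; 12; 13; 15]%N ->
  inv h0 S v0 s l tot o -> inv h0 S v0 (set_reg s x v) l tot o.
Proof. by move=> xi; apply: inv_regs => // y; apply: stay. Qed.

Lemma wp_push h0 S v0 s l tot o r N :
  r != rU -> (4 <= N)%N -> inv h0 S v0 s l tot o ->
  wp (cons_to rS r) s N (fun s' => inv h0 S v0 s' (regs s r :: l) tot o /\
    forall x, x != rS -> x != rU -> regs s' x = regs s x).
Proof.
move=> rU' N4 i; apply: wp_cons_to => // s' b eh ep el er ex; split=> //.
exact: inv_push eh ep el er ex i.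
Qed.

(** The budget of 40 is four field reads plus 36 for [dispatch], a generous bound on its longest
    branch. *)
Lemma wp_visit_node h0 S v0 s l tot o v k pay vl vr (Q : state -> Prop) :
  inv h0 S v0 s l tot o -> regs s rX = v -> node h0 v k pay vl vr ->
  (forall s', inv h0 S v0 s' l tot o -> regs s' rX = v ->
     regs s' rK = Int k%:Z -> regs s' rP = pay -> regs s' rL = vl ->
     regs s' rR = vr ->
     (exists a b, [/\ v = Ptr a, onth (heap s') a = Some b &
        b fm = if S a then Int 1 else Defs.Nil]) ->
     wp dispatch s' 36 Q) ->
  wp visit_node s 40 Q.
Proof.
move=> i ex [a [b [va ab [bk bp bl br]]]] next.
have [_ /(_ a b ab) [b' [ab' e m]]] := inv_heap i.
rewrite va in ex next.
apply: (wp_read (a := a) (b := b')) => //.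
apply: (wp_read (a := a) (b := b')) => //.
apply: (wp_read (a := a) (b := b')) => //.
apply: (wp_read (a := a) (b := b')) => //.
apply: next; rewrite /= ?e //; first by do 4!apply: inv_set => //.
by exists a, b'.
Qed.

Lemma wp_dispatch_br h0 S v0 s l tot o z i t1 t2 vl vr :
  inv h0 S v0 s l tot o -> regs s rK = Int (side_code z)%:Z ->
  regs s rP = Coord (key z i) -> regs s rL = vl -> regs s rR = vr ->
  rep h0 t1 vl -> rep h0 t2 vr ->
  wp dispatch s 36 (fun s' => exists ls,
    reps h0 [:: if violates z i then t1 else t2] ls /\
    inv h0 S v0 s' (ls ++ l) tot o).
Proof.
move=> iv ek ep el er r1 r2.
have fin : forall s' N, (5 <= N)%N -> inv h0 S v0 s' l tot o -> regs s' rL = vl ->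
  regs s' rR = vr -> wp (if violates z i then cons_to rS rL else cons_to rS rR) s' N
    (fun s' => exists ls, reps h0 [:: if violates z i then t1 else t2] ls /\
    inv h0 S v0 s' (ls ++ l) tot o).
  move=> s' N N5 iv' el' er'; case: ifP => _.
    apply: (wp_mono (leqnn _) _ (wp_push _ (ltnW N5) iv')) => // s2 [i2 _].
    by exists [:: vl]; split=> //=; rewrite -el'.
  apply: (wp_mono (leqnn _) _ (wp_push _ (ltnW N5) iv')) => // s2 [i2 _].
  by exists [:: vr]; split=> //=; rewrite -er'.
have [ea eb ec ed] := inv_reg iv.
have W0 m : (m <= 7)%N -> (m <= W)%N by move/leq_trans; apply.
case: z ek ep fin => ek ep fin; rewrite /dispatch.
- apply: wp_on_kind_eq; rewrite ?W0 //.
  apply: (@wp_if _ _ _ _ _ (key SA i < qa)); rewrite /= ?ep ?ea //.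
  by apply: fin; rewrite //; apply: inv_set.
- apply: (@wp_on_kind_ne 1); rewrite ?W0 //.
  apply: wp_on_kind_eq; rewrite ?W0 //.
  apply: (@wp_if _ _ _ _ _ (qb < key SB i)); rewrite /= ?ep ?eb //.
  by apply: fin; rewrite //; do 2!apply: inv_set => //.
- do 2!(apply: (@wp_on_kind_ne 2); rewrite ?W0 //).
  apply: wp_on_kind_eq; rewrite ?W0 //.
  apply: (@wp_if _ _ _ _ _ (key SC i < qc)); rewrite /= ?ep ?ec //.
  by apply: fin; rewrite //; do 3!apply: inv_set => //.
- do 3!(apply: (@wp_on_kind_ne 3); rewrite ?W0 //).
  apply: wp_on_kind_eq; rewrite ?W0 //.
  apply: (@wp_if _ _ _ _ _ (qd < key SD i)); rewrite /= ?ep ?ed //.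
  by apply: fin; rewrite //; do 4!apply: inv_set => //.
Qed.

Lemma wp_visit h0 S v0 s l tot o t v :
  inv h0 S v0 s l tot o -> regs s rX = v -> v <> Defs.Nil -> rep h0 t v ->
  (`|tot| + n * cost violates S t <= W)%N ->
  wp visit_node s 40 (fun s' => exists ls,
    reps h0 (kids S t) ls /\
    inv h0 S v0 s' (ls ++ l) (tot + gain (own t)) (rev (outs (own t)) ++ o)).
Proof.
have W0 m : (m <= 7)%N -> (m <= W)%N by move/leq_trans; apply.
move=> iv ex nz; case: t => [|z|a|z j t1 t2|t1 t2|a t] r bt.
- by case: nz.
- case: r => zn [vl [vr nd]].
  apply: (wp_visit_node iv ex nd) => s' iv' ex' ek ep el er _.
  rewrite /dispatch; do 5!(apply: (@wp_on_kind_ne 5); rewrite ?W0 //).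
  apply: wp_on_kind_eq; rewrite ?W0 //.
  have wz : in_word W (tot + z) by move: bt zn; rewrite /in_word /= muln1; lia.
  apply: wp_op => //.
    by rewrite /= ep (inv_tot iv') /= /mk_int wz /=.
  exists [::]; split=> //=.
  have -> : gain [:: inl z] = z by rewrite /gain big_seq1.
  by case: iv' => *; split.
- case: r => az [vl [vr nd]].
  apply: (wp_visit_node iv ex nd) => s' iv' ex' ek ep el er _.
  rewrite /dispatch; do 6!(apply: (@wp_on_kind_ne 6); rewrite ?W0 //).
  apply: wp_on_kind_eq; rewrite ?W0 //.
  apply: wp_cons_to => //= s2 b eh bp bl es er2.
  exists [::]; split=> //=.
  have -> : gain [:: inr a] = 0 by rewrite /gain big_seq1.
  rewrite addr0; apply: (inv_out_push eh) => //; first by rewrite bp ep.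
  by move=> x x8 x13; rewrite er2 // !(negPf x13).
- case: r => vl [vr [nd r1 r2]].
  apply: (wp_visit_node iv ex nd) => s' iv' ex' ek ep el er _ /=.
  rewrite /gain big_nil addr0.
  exact: (wp_dispatch_br iv' ek ep el er).
- case: r => pay [vl [vr [nd r1 r2]]].
  apply: (wp_visit_node iv ex nd) => s' iv' ex' ek ep el er _ /=.
  rewrite /gain big_nil addr0 /dispatch.
  do 4!(apply: (@wp_on_kind_ne 4); rewrite ?W0 //).
  apply: wp_on_kind_eq; rewrite ?W0 //.
  apply: (@wp_seq 4) => //.
  apply: (wp_mono (leqnn 4) _ (wp_push (r := rR) isT (leqnn 4) _)); last first.
    by do 5!apply: inv_set => //; exact: iv'.
  move=> s2 [iv2 es2].
  apply: (wp_mono (leqnn _) _ (wp_push (r := rL) isT _ iv2)) => // s3 [iv3 _].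
  by exists [:: vl; vr]; move: iv3; rewrite es2 //= el er.
- case: r => pay [vl [vr [va nd r1]]].
  apply: (wp_visit_node iv ex nd) => s' iv' ex' ek ep el er [a' [b []]].
  rewrite va => -[<-] ab bm /=.
  rewrite /gain big_nil addr0 /dispatch.
  do 7!(apply: (@wp_on_kind_ne 7); rewrite ?W0 //).
  apply: (wp_read (a := a) (b := b)) => //; first by rewrite /= ex' va.
  rewrite bm; set s2 := set_reg _ _ _.
  have iv2 : inv h0 S v0 s2 l tot o by do 8!apply: inv_set => //.
  apply: (@wp_if _ _ _ _ _ (~~ S a)) => //.
    by rewrite /= (inv_nil iv'); case: (S a).
  case: (S a) => /=.
    by apply: wp_op => //; exists [::]; split=> //; apply: inv_set.
  apply: (wp_mono (leqnn _) _ (wp_push (r := rL) isT _ iv2)) => // s3 [iv3 _].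
  by exists [:: vl]; split=> //=; move: iv3; rewrite /= el.
Qed.

Lemma rep_nil h t v : rep h t v -> v = Defs.Nil -> t = Stop.
Proof.
have nz k pay l r : node h v k pay l r -> v = Defs.Nil -> False.
  by move=> [a [b [->]]].
case: t => //= [z|a|z i t1 t2|t1 t2|a t].
- by case=> _ [l [r /nz]].
- by case=> _ [l [r /nz]].
- by case=> l [r [/nz]].
- by case=> pay [l [r [/nz]]].
- by case=> pay [l [r [_ /nz]]].
Qed.

Lemma gain_own h t v : rep h t v -> (`|gain (own t)| <= n)%N.
Proof.
case: t => [|z|a|z i t1 t2|t1 t2|a t] /=; rewrite /gain ?big_nil ?big_seq1 ?absz0 //.
by case.
Qed.

Lemma reps_cat h ts ts' l l' : reps h ts l -> reps h ts' l' -> reps h (ts ++ ts') (l ++ l').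
Proof. by elim: ts l => [|t ts IH] [|v l] //= [? /IH H] /H. Qed.

(** The stack is a list of pending trees. Popping one puts its [kids] in its place and lowers the
    total cost by exactly one, hence the induction on a bound [M] of that total. A round takes 44
    steps: loop test, two reads, test for [Nil], and 40 for the visit. A visit changes the running
    total by at most [n] and frees [n] in the hypothesis on [W], so no intermediate sum overflows,
    whatever the signs. *)
Lemma wp_walk M h0 S v0 s ts ls tot o :
  let c := sumn (map (cost violates S) ts) in
  let es := flatten (map (events violates S) ts) in
  (c <= M)%N -> reps h0 ts ls -> inv h0 S v0 s ls tot o ->
  (`|tot| + n * c <= W)%N ->
  wp walk s ((44 * c).+1)%N (fun s' =>
    inv h0 S v0 s' [::] (tot + gain es) (rev (outs es) ++ o)).
Proof.
elim: M s ts ls tot o => [|M IH] s [|t ts] ls tot o; rewrite /=.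
- move=> _; case: ls => // _ iv _; apply: wp_while_end.
    by rewrite /= (inv_stack iv) (inv_nil iv).
  by rewrite /gain big_nil addr0.
- by have := cost_gt0 violates S t; case: cost.
- move=> _; case: ls => // _ iv _; apply: wp_while_end.
    by rewrite /= (inv_stack iv) (inv_nil iv).
  by rewrite /gain big_nil addr0.
case: ls => // v ls leM [r rs] iv bt.
have [a [b [sa ma ab bp sr]]] := inv_stack iv.
apply: (@wp_while_step 43).
- by rewrite /= sa (inv_nil iv).
- by have := cost_gt0 violates S t; lia.
apply: (wp_read (a := a) (b := b)) => //.
apply: (wp_read (a := a) (b := b)) => //.
set s1 := set_reg _ _ _.
have iv1 : inv h0 S v0 s1 ls tot o by case: iv => *; split.
have ev : regs s1 rX = v by rewrite /= bp.
have vE : value_eq v Defs.Nil = true -> v = Defs.Nil by case: v {r iv bp ev}.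
rewrite [walk_body]lock.
have -> : ((44 * (cost violates S t + sumn [seq cost violates S i | i <- ts])).+1
   = 44 + (44 * (sumn [seq cost violates S i | i <- kids S t ++ ts])).+1)%N.
  by rewrite cost_kids map_cat sumn_cat addSn mulnS addnS.
rewrite addKn.
have lec : (sumn [seq cost violates S i | i <- kids S t ++ ts] <= M)%N.
  by move: leM; rewrite cost_kids map_cat sumn_cat addSn ltnS.
case en: (value_eq v Defs.Nil).
  have tS := rep_nil r (vE en).
  apply: (@wp_if _ _ _ _ _ true) => //; first by rewrite /= bp (inv_nil iv) en.
  subst t; apply: wp_op => //; unlock.
  apply: (IH _ _ ls) => //=; first exact: inv_set iv1.
  by move: bt; rewrite /= mulnDr; lia.
apply: (@wp_if _ _ _ _ _ false) => //; first by rewrite /= bp (inv_nil iv) en.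
have nv : v <> Defs.Nil by move=> e; rewrite e in en.
have bt1 : (`|tot| + n * cost violates S t <= W)%N by move: bt; rewrite mulnDr; lia.
apply: (wp_mono (leqnn _) _ (wp_visit iv1 ev nv r bt1)) => s2 [l2 [r2 iv2]].
unlock.
have := IH _ _ _ _ _ lec (reps_cat r2 rs) iv2.
cbv zeta; rewrite !map_cat flatten_cat sumn_cat.
have -> : tot + gain (own t) + gain (flatten [seq events violates S i | i <- kids S t] ++
     flatten [seq events violates S i | i <- ts]) =
   tot + gain (events violates S t ++ flatten [seq events violates S i | i <- ts]).
  by rewrite [events _ _ t]events_kids !gain_cat !addrA.
rewrite catA -rev_cat -outs_cat catA -events_kids.
apply; move: bt (gain_own r); rewrite cost_kids addSn mulnS.
by move: (n * _)%N => c; lia.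
Qed.

Lemma onth_set_nth (T : Type) x0 (l : seq T) a y c : (a < size l)%N ->
  onth (set_nth x0 l a y) c = if c == a then Some y else onth l c.
Proof. by elim: l a c => // x l IH [|a] [|c] //= /IH ->. Qed.

Lemma marked_copy_write S h0 h a b (m : bool) v :
  marked_copy S h0 h -> (a < size h0)%N -> onth h a = Some b ->
  v = (if m then Int 1 else Defs.Nil) ->
  marked_copy (fun x => if x == a then m else S x) h0
    (set_nth (empty_block R 5) h a (set_field b fm v)).
Proof.
move=> [le c] ah0 hb ev; split.
  by rewrite size_set_nth (leq_trans le) // leq_max leqnn orbT.
move=> a' b0 /[dup] /c [b' [hb' e em]] h0b.
rewrite onth_set_nth; last exact: onth_lt hb.
case: eqP hb' => [->|_] hb'; last by exists b'.
exists (set_field b fm v); split=> //.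
- move=> f fm'; rewrite ffunE (negPf fm') -e //.
  by move: hb'; rewrite hb => -[->].
- by rewrite ffunE eqxx ev.
Qed.

Lemma list_rep_write m h v l a y : (a < m)%N -> (a < size h)%N ->
  list_rep m h v l -> list_rep m (set_nth (empty_block R 5) h a y) v l.
Proof.
move=> am ah; elim: l v => //= x l IH v [c [b [-> mc hc bx /IH lr]]].
exists c, b; split=> //; rewrite onth_set_nth //.
by case: eqP => // e; move: am; rewrite -e ltnNge mc.
Qed.

Lemma wp_mark_loop h0 (m : bool) v0 tot o o2 S s :
  inv h0 S v0 s [::] tot o ->
  list_rep (size h0) (heap s) (regs s rQ) (map (@Ptr R) o2) ->
  all (fun a => a < size h0)%N o2 ->
  wp (mark_loop (if m then rU else rN)) s (5 * size o2).+1
    (fun s' => inv h0 (fun x => if x \in o2 then m else S x) v0 s' [::] tot o).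
Proof.
elim: o2 S s => [|a o2 IH] S s iv /=.
  by move=> eq _; apply: wp_while_end; rewrite //= eq (inv_nil iv).
move=> [c [b [eq mc hc bx lr]]] /andP[ah0 ao2].
apply: (@wp_while_step 4); rewrite ?mulnS //.
  by rewrite /= eq (inv_nil iv).
apply: wp_seq_op => //=.
  by rewrite /mk_int /in_word /= (leq_trans _ W7).
apply: (wp_read (a := c) (b := b)) => //.
rewrite bx.
have [lh hm] := inv_heap iv.
have ah : (a < size (heap s))%N by exact: leq_trans lh.
case ha: (onth (heap s) a) => [ba|]; last by move: ah; rewrite -onthTE ha.
set s0 := set_reg _ _ _.
have rv : regs s0 (if m then rU else rN) = if m then Int 1 else Defs.Nil.
  by rewrite /s0; case: (m) => //=; exact: inv_nil iv.
have ha0 : onth (heap s0) a = Some ba by [].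
have rx : regs s0 rX = Ptr a by [].
apply: wp_seq_op => //; first by rewrite /step /deref rx ha0 [omap _ _]/= rv.
set s1 := State _ _.
have iv1 : inv h0 (fun x => if x == a then m else S x) v0 s1 [::] tot o.
  case: iv => ih ist io *; split=> //.
  - exact: marked_copy_write.
  - by rewrite /=; apply: list_rep_write.
have ca : c == a = false by apply/eqP => e; move: mc; rewrite e leqNgt ah0.
have hc1 : onth (heap s1) c = Some b by rewrite /= onth_set_nth // ca; exact: hc.
have eq1 : regs s1 rQ = Ptr c by exact: eq.
apply: wp_op => //; first by rewrite /step /deref eq1 hc1.
set s2 := set_reg _ _ _.
have iv2 : inv h0 (fun x => if x == a then m else S x) v0 s2 [::] tot o.
  exact: inv_set.
have lr2 : list_rep (size h0) (heap s2) (regs s2 rQ) (map (@Ptr R) o2).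
  by rewrite /=; apply: list_rep_write.
have := IH _ _ iv2 lr2 ao2.
apply: wp_mono.
  by rewrite mulnE; lia.
move=> s' [] [le hm'] *; split=> //; split=> // d bd /hm' [b' [e1 e em]].
exists b'; split=> //; rewrite em inE; case: (d == a) => //=.
by rewrite if_same.
Qed.

Lemma wp_set_marks h0 (m : bool) S v0 s tot o :
  inv h0 S v0 s [::] tot o -> all (fun a => a < size h0)%N o ->
  wp (set_marks (if m then rU else rN)) s (5 * size o + 2)
    (fun s' => inv h0 (fun x => if x \in o then m else S x) v0 s' [::] tot o).
Proof.
move=> iv ao; apply: wp_seq_op; [by []|by rewrite addn2|].
have iv1 : inv h0 S v0 (set_reg s rQ (regs s rO)) [::] tot o by apply: inv_set.
apply: wp_mono (wp_mark_loop m iv1 (inv_out iv1) ao) => //.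
by rewrite addn2.
Qed.

Lemma outs_rep h S t v : rep h t v ->
  all (fun a => a < size h)%N (outs (events violates S t)).
Proof.
elim: t v => //= [a|z i t1 IH1 t2 IH2|t1 IH1 t2 IH2|a t IH] v.
- by rewrite andbT; case.
- by case=> l [r [_ /IH1 h1 /IH2 h2]]; case: ifP.
- by case=> p [l [r [_ /IH1 h1 /IH2 h2]]]; rewrite outs_cat all_cat h1.
- by case=> p [l [r [_ _ /IH]]]; case: (S a).
Qed.

Lemma size_outs S t : (size (outs (events violates S t)) <= cost violates S t)%N.
Proof.
elim: t => //= [z i t1 IH1 t2 IH2|t1 IH1 t2 IH2|a t IH].
- by case: ifP => _; apply: leqW.
- by rewrite outs_cat size_cat leqW // leq_add.
- by case: (S a) => //; apply: leqW.
Qed.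

Lemma gain_cost h S t v : rep h t v ->
  (`|gain (events violates S t)| <= n * cost violates S t)%N.
Proof.
elim: t v => [|z|a|z i t1 IH1 t2 IH2|t1 IH1 t2 IH2|a t IH] v /=;
  rewrite ?gain_cat /gain ?big_nil ?big_seq1 //.
- by case; rewrite muln1.
- by case=> l [r [_ /IH1 h1 /IH2 h2]]; move: h1 h2; rewrite /gain; case: ifP => _; rewrite mulnS; lia.
- by case=> p [l [r [_ /IH1 h1 /IH2 h2]]]; move: h1 h2; rewrite /gain mulnS mulnDr; lia.
- case=> p [l [r [_ _ /IH]]]; case: (S a); first by rewrite big_nil.
  by rewrite /gain mulnS; lia.
Qed.

(** The factor 70 covers 44 per unit of cost for the walks, at most 10 for setting and clearing the
    mark of each collected address, and the constant overhead, which can be charged to [c] because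
    both costs are positive. *)
Lemma query_correct h0 ra b0 t1 t2 :
  (forall a b, onth h0 a = Some b -> b fm = Defs.Nil) ->
  onth h0 ra = Some b0 -> rep h0 t1 (b0 fl) -> rep h0 t2 (b0 fr) ->
  let es1 := events violates pred0 t1 in
  let S := fun a => a \in outs es1 in
  let es2 := events violates S t2 in
  let c := (cost violates pred0 t1 + cost violates S t2)%N in
  (n * c <= W)%N ->
  wp query_cmd (query_state (Structure h0 (Ptr ra)) qa qb qc qd) (70 * c)
    (fun s' => regs s' 0 = Int (gain es1 + gain es2) /\
               take (size h0) (heap s') = h0).
Proof.
move=> unm hra r1 r2 es1 S es2 c cW; rewrite /query_cmd.
set s0 := query_state _ _ _ _ _.
have c1 := cost_gt0 violates pred0 t1; have c2 := cost_gt0 violates S t2.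
have iv0 : inv h0 pred0 (Ptr ra) (set_reg s0 rT (Int 0)) [::] 0 [::].
  split=> //; split=> // a b hb; exists b; split=> //=.
  exact: unm hb.
apply: wp_seq_op => //; first by rewrite muln_gt0; lia.
apply: wp_read; [by []|exact: hra|by lia|].
set s1 := set_reg _ _ _.
have iv1 : inv h0 pred0 (Ptr ra) s1 [::] 0 [::] by exact: inv_set.
apply: (@wp_seq 4); first by lia.
apply: (wp_mono (leqnn _) _ (wp_push (r := rX) isT (leqnn 4) iv1)) => s2 [iv2 _].
have rp1 : reps h0 [:: t1] [:: regs s1 rX] by split.
apply: (@wp_seq (44 * cost violates pred0 t1).+1); first by lia.
have b1 : (`|0%Z| + n * sumn [seq cost violates pred0 i | i <- [:: t1]] <= W)%N.
  by move: cW; rewrite /= addn0 /c mulnDr; lia.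
have := wp_walk (leqnn _) rp1 iv2 b1.
rewrite /= addn0; apply: wp_mono => // s3; rewrite cats0 add0r cats0 -/es1 => iv3.
have oe : all (fun a => a < size h0)%N (rev (outs es1)).
  by rewrite all_rev; exact: outs_rep r1.
have := size_outs pred0 t1; rewrite -/es1 => so1.
have cE : c = (cost violates pred0 t1 + cost violates S t2)%N by [].
apply: (@wp_seq (5 * size (rev (outs es1)) + 2)); first by rewrite size_rev; lia.
apply: (wp_mono (leqnn _) _ (wp_set_marks true iv3 oe)) => s4 iv4.
have [_ /(_ _ _ hra) [b1' [hb1 eb1 _]]] := inv_heap iv4.
apply: wp_read; [exact: inv_root iv4|exact: hb1|by rewrite size_rev; lia|].
set s5 := set_reg _ _ _; rewrite eb1 // in s5 *.
have iv5 : inv h0 (fun x => if x \in rev (outs es1) then true else pred0 x) (Ptr ra) s5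
  [::] (gain es1) (rev (outs es1)) by exact: inv_set.
apply: (@wp_seq 4); first by rewrite size_rev; lia.
apply: (wp_mono (leqnn _) _ (wp_push (r := rX) isT (leqnn 4) iv5)) => s6 [iv6 _].
have rp2 : reps h0 [:: t2] [:: regs s5 rX] by split.
set S' := fun x => _ in iv6.
have SE : S' =1 S by move=> x; rewrite /S' /S mem_rev; case: ifP.
have evE t : events violates S' t = events violates S t.
  by elim: t => //= [z i u -> w ->|u -> w ->|a u ->] //; rewrite SE.
have coE t : cost violates S' t = cost violates S t.
  by elim: t => //= [z i u -> w ->|u -> w ->|a u ->] //; rewrite SE.
have g1 := gain_cost pred0 r1; rewrite -/es1 in g1.
have b2 : (`|gain es1| + n * sumn [seq cost violates S' i | i <- [:: t2]] <= W)%N.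
  by move: cW; rewrite /= addn0 coE /c mulnDr; lia.
apply: (@wp_seq (44 * cost violates S t2).+1); first by rewrite size_rev; lia.
have := wp_walk (leqnn _) rp2 iv6 b2.
rewrite /= addn0 cats0 evE coE -/es2; apply: wp_mono => // s7 iv7.
have oe2 : all (fun a => a < size h0)%N (rev (outs es2) ++ rev (outs es1)).
  by rewrite all_cat oe andbT all_rev; exact: outs_rep r2.
have := size_outs S t2; rewrite -/es2 => so2.
apply: (@wp_seq (5 * size (rev (outs es2) ++ rev (outs es1)) + 2)).
  by rewrite size_cat !size_rev; lia.
apply: (wp_mono (leqnn _) _ (wp_set_marks false iv7 oe2)) => s8 iv8.
apply: wp_op => //; first by rewrite size_cat !size_rev; lia.
split; first by rewrite /= (inv_tot iv8).
have [le hm] := inv_heap iv8.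
(* Records of the structure can differ from their originals in the mark field only, and every
   address marked after the first walk belongs to the list cleared after the second. *)
apply: eq_from_onth => a /=.
case ha: (onth h0 a) => [b|]; last first.
  by apply: onth_default; rewrite size_takel // leqNgt -onthTE ha.
have [b' [hb' e em]] := hm _ _ ha.
have al := onth_lt ha.
rewrite -(cat_take_drop (size h0) (heap s8)) onth_cat in hb'.
rewrite size_takel // al in hb'; rewrite hb'; congr Some.
apply/ffunP => f; case: (eqVneq f fm) => [->|/e //].
by rewrite em (unm _ _ ha) mem_cat /S'; do 2!case: (a \in rev _).
Qed.

End Run.

(** * Storing walk trees in memory *)

Section Alloc.
Variables (R : realType) (n W : nat) (p : 'I_n -> R * R).
Hypotheses (W7 : (7 <= W)%N) (nW : (n <= W)%N).
Notation block := (Defs.block R 5).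
Notation wtree := (wtree 'I_n).
Implicit Types (h e : seq block) (t u : wtree) (E F G : wtree -> Prop).

Definition point_key (z : side) (i : 'I_n) : R :=
  match z with SA | SB => (p i).1 | SC | SD => (p i).2 end.

Notation rep := (rep point_key).

Definition wf_heap h : Prop :=
  forall a b, onth h a = Some b -> b fm = Defs.Nil /\
    forall f, valid_value W p (Structure h Defs.Nil) (b f).

Definition avail h t : Prop := exists v, rep h t v.

(* Trees in [E] may be shared at no cost. *)
Definition buildable E F (k : nat) : Prop :=
  forall h, wf_heap h -> (forall t, E t -> avail h t) ->
  exists e, [/\ (size e <= k)%N, wf_heap (h ++ e) &
                forall t, F t -> avail (h ++ e) t].

Lemma node_cat h e v k pay l r : node h v k pay l r -> node (h ++ e) v k pay l r.
Proof.
by move=> [a [b [-> ab H]]]; exists a, b; split=> //; apply: onth_cat_left.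
Qed.

Lemma rep_cat h e t v : rep h t v -> rep (h ++ e) t v.
Proof.
elim: t v => //= [z|a|z i t1 IH1 t2 IH2|t1 IH1 t2 IH2|a t IH] v.
- by case=> zn [l [r nd]]; split=> //; exists l, r; apply: node_cat.
- case=> zn [l [r nd]]; split; last by exists l, r; apply: node_cat.
  by rewrite size_cat ltn_addr.
- by case=> l [r [nd /IH1 ? /IH2 ?]]; exists l, r; split=> //; apply: node_cat.
- case=> pay [l [r [nd /IH1 ? /IH2 ?]]]; exists pay, l, r; split=> //.
  exact: node_cat.
- case=> pay [l [r [va nd /IH ?]]]; exists pay, l, r; split=> //.
  exact: node_cat.
Qed.

Lemma avail_cat h e t : avail h t -> avail (h ++ e) t.
Proof. by case=> v /rep_cat r; exists v. Qed.

Lemma avail_stop h : avail h Stop.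
Proof. by exists Defs.Nil. Qed.

Lemma valid_value_mono h h' v : (size h <= size h')%N ->
  valid_value W p (Structure h Defs.Nil) v ->
  valid_value W p (Structure h' Defs.Nil) v.
Proof. by move=> le; case: v => //= a /leq_trans; apply. Qed.

Lemma rep_valid h t v : rep h t v -> valid_value W p (Structure h Defs.Nil) v.
Proof.
have nv k pay l r : node h v k pay l r ->
    valid_value W p (Structure h Defs.Nil) v.
  by move=> [a [b [-> ab _]]]; exact: onth_lt ab.
case: t => //= [->|z|a|z i t1 t2|t1 t2|a t] //.
- by case=> _ [l [r /nv]].
- by case=> _ [l [r /nv]].
- by case=> l [r [/nv]].
- by case=> pay [l [r [/nv]]].
- by case=> pay [l [r [_ /nv]]].
Qed.

Definition record_of (k : nat) (pay l r : value R) : block :=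
  [ffun f : 'I_5 => nth Defs.Nil [:: Defs.Nil; Int k%:Z; pay; l; r] f].

Lemma alloc h k pay l r :
  wf_heap h -> (k <= 7)%N ->
  valid_value W p (Structure h Defs.Nil) pay ->
  valid_value W p (Structure h Defs.Nil) l ->
  valid_value W p (Structure h Defs.Nil) r ->
  wf_heap (h ++ [:: record_of k pay l r]) /\
  node (h ++ [:: record_of k pay l r]) (Ptr (size h)) k pay l r.
Proof.
move=> wf k7 okp okl okr; split; last first.
  exists (size h), (record_of k pay l r); split=> //.
    by rewrite onth_cat ltnn subnn.
  by rewrite !ffunE.
have le : (size h <= size (h ++ [:: record_of k pay l r]))%N.
  by rewrite size_cat leq_addr.
move=> a b; rewrite onth_cat; case: ltnP => ah.
  move=> /wf [m v]; split=> // f; exact: valid_value_mono le (v f).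
case: (a - size h)%N => //= [[<-]|m]; last by rewrite onth0n.
split; first by rewrite ffunE.
move=> f; apply: (valid_value_mono le); rewrite ffunE.
case: f => [[|[|[|[|[|f]]]]]] //= fi.
- by rewrite /in_word absz_nat (leq_trans k7).
Qed.

Lemma buildable_trans E F G k1 k2 :
  buildable E F k1 -> buildable (fun t => E t \/ F t) G k2 ->
  buildable E (fun t => F t \/ G t) (k1 + k2).
Proof.
move=> bF bG h wf aE; have [e1 [s1 wf1 a1]] := bF h wf aE.
have [|e2 [s2 wf2 a2]] := bG _ wf1.
  by move=> t [/aE/avail_cat|/a1].
exists (e1 ++ e2); rewrite size_cat leq_add // !catA; split=> // t [/a1|/a2] //.
exact: avail_cat.
Qed.

Lemma buildable_sub E E' F F' k k' :
  (forall t, E t -> E' t) -> (forall t, F' t -> F t) -> (k <= k')%N ->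
  buildable E F k -> buildable E' F' k'.
Proof.
move=> sE sF le b h wf aE; have [|e [se wfe ae]] := b h wf.
  by move=> t /sE; apply: aE.
by exists e; split=> [||t /sF/ae] //; apply: leq_trans le.
Qed.

Lemma buildable_avail E t : E t \/ t = Stop -> buildable E (eq t) 0.
Proof.
move=> Et h wf aE; exists [::]; rewrite cats0; split=> // u <-.
by case: Et => [/aE|->] //; exact: avail_stop.
Qed.

Lemma buildable_two E t1 t2 k1 k2 :
  buildable E (eq t1) k1 -> buildable E (eq t2) k2 ->
  buildable E (fun t => t1 = t \/ t2 = t) (k1 + k2).
Proof.
move=> b1 b2; apply: buildable_trans b1 _.
by apply: buildable_sub b2 => // t; left.
Qed.

Lemma buildable_add E z : (`|z| <= n)%N -> buildable E (eq (Add z)) 1.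
Proof.
move=> zn h wf _.
have [|wf' nd] := alloc (k := 5) (pay := Int z) (l := Defs.Nil) (r := Defs.Nil) wf isT _ I I.
  exact: leq_trans nW.
exists [:: record_of 5 (Int z) Defs.Nil Defs.Nil]; split=> // t <-.
by exists (Ptr (size h)); split=> //; exists Defs.Nil, Defs.Nil.
Qed.

(** A stored pointer must be in range; the availability of a guard at [a] is what certifies it. *)
Lemma buildable_out E a t : E (Guard a t) -> buildable E (eq (Out a)) 1.
Proof.
move=> Eg h wf /(_ _ Eg) [v /= [pay [l [r [-> [a' [b [[ea] hb _]]] _]]]]].
have ah := onth_lt hb; rewrite -ea in ah.
have [|wf' nd] := alloc (k := 6) (pay := Ptr a) (l := Defs.Nil) (r := Defs.Nil) wf isT _ I I.
  exact: ah.
exists [:: record_of 6 (Ptr a) Defs.Nil Defs.Nil]; split=> // u <-.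
exists (Ptr (size h)); split; first by rewrite size_cat ltn_addr.
by exists Defs.Nil, Defs.Nil.
Qed.

Lemma buildable_br E z i t1 t2 k :
  buildable E (fun t => t1 = t \/ t2 = t) k ->
  buildable E (eq (Br z i t1 t2)) k.+1.
Proof.
move=> b h wf aE; have [e [se wfe ae]] := b h wf aE.
have [v1 r1] := ae t1 (or_introl erefl); have [v2 r2] := ae t2 (or_intror erefl).
have [||||wf' nd] := @alloc (h ++ e) (side_code z) (Coord (point_key z i)) v1 v2 wfe.
- by case: (z).
- by exists i; case: (z); [left|left|right|right].
- exact: rep_valid r1.
- exact: rep_valid r2.
exists (e ++ [:: record_of (side_code z) (Coord (point_key z i)) v1 v2]).
rewrite size_cat addn1 catA; split=> // t <-.
by exists (Ptr (size (h ++ e))), v1, v2; split=> //; apply: rep_cat.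
Qed.

Lemma buildable_both E t1 t2 k :
  buildable E (fun t => t1 = t \/ t2 = t) k ->
  buildable E (eq (Both t1 t2)) k.+1.
Proof.
move=> b h wf aE; have [e [se wfe ae]] := b h wf aE.
have [v1 r1] := ae t1 (or_introl erefl); have [v2 r2] := ae t2 (or_intror erefl).
have [|||wf' nd] := @alloc (h ++ e) 4 Defs.Nil v1 v2 wfe isT.
- by [].
- exact: rep_valid r1.
- exact: rep_valid r2.
exists (e ++ [:: record_of 4 Defs.Nil v1 v2]).
rewrite size_cat addn1 catA; split=> // t <-.
by exists (Ptr (size (h ++ e))), Defs.Nil, v1, v2; split=> //; apply: rep_cat.
Qed.

Lemma buildable_seq (T : eqType) E (f : T -> wtree) (k : T -> nat) (s : seq T) :
  {in s, forall x, buildable E (eq (f x)) (k x)} ->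
  buildable E (fun t => exists2 x, x \in s & f x = t) (\sum_(x <- s) k x).
Proof.
elim: s => [|x s IH] b.
  rewrite big_nil => h wf _; exists [::]; rewrite cats0; split=> // t [x].
  by rewrite in_nil.
rewrite big_cons.
have bs : {in s, forall x, buildable E (eq (f x)) (k x)}.
  by move=> y ys; apply: b; rewrite inE ys orbT.
have b2 : buildable (fun t => E t \/ f x = t)
    (fun t => exists2 x, x \in s & f x = t) (\sum_(x <- s) k x).
  by apply: (buildable_sub _ _ (leqnn _) (IH bs)) => // t; left.
have b3 := buildable_trans (b x (mem_head _ _)) b2.
apply: (buildable_sub _ _ (leqnn _) b3) => //.
move=> t [y]; rewrite inE => /predU1P[->|ys] e; first by left.
by right; exists y.
Qed.

(** Addresses are known only once the records are allocated, so [addr] is produced here and the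
    trees that mention it are built afterwards. A new address exceeds all earlier ones; the
    resulting injectivity lets a marked record stand for a marked color. *)
Lemma guards (K : eqType) (ks : seq K) (f : K -> wtree) (k : K -> nat) h :
  uniq ks -> wf_heap h ->
  {in ks, forall c, buildable (fun _ => False) (eq (f c)) (k c)} ->
  exists (addr : K -> nat) e,
    [/\ (size e <= \sum_(c <- ks) (k c).+1)%N, wf_heap (h ++ e),
         {in ks &, injective addr} &
         {in ks, forall c, avail (h ++ e) (Guard (addr c) (f c))}].
Proof.
elim: ks => [|c ks IH] /=.
  by move=> _ wf _; exists (fun=> 0%N), [::]; rewrite cats0; split.
move=> /andP[cks uks] wf b.
have [|addr [e [se wfe inj av]]] := IH uks wf.
  by move=> y ys; apply: b; rewrite inE ys orbT.
have [//|e2 [se2 wfe2 /(_ _ erefl)[v rv]]] := b c (mem_head _ _) _ wfe.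
have [|||wf' nd] := @alloc _ 7 Defs.Nil v Defs.Nil wfe2 isT.
- by [].
- exact: rep_valid rv.
- by [].
set a := size ((h ++ e) ++ e2) in nd *.
exists (fun d => if d == c then a else addr d).
exists (e ++ e2 ++ [:: record_of 7 Defs.Nil v Defs.Nil]).
have alt d : d \in ks -> (addr d < a)%N.
  move=> /av [w /= [pay [l [r [-> [a' [b0 [[<-] hb _]]] _]]]]].
  by rewrite (leq_trans (onth_lt hb)) // /a [size (_ ++ e2)]size_cat leq_addr.
have nc d : d \in ks -> (d == c) = false.
  by move=> dk; apply: contraNF cks => /eqP <-.
rewrite !catA; split=> //.
- by rewrite big_cons !size_cat addn1; lia.
- move=> d1 d2; rewrite !inE; case: eqP => [->|_] /=; case: eqP => [->|_] //=.
  + by move=> _ /alt lt e1; rewrite e1 ltnn in lt.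
  + by move=> /alt lt _ e1; rewrite e1 ltnn in lt.
  + exact: inj.
- move=> d; rewrite inE; case: eqP => [-> _|_ /=].
    by exists (Ptr a), Defs.Nil, v, Defs.Nil; split=> //; apply: rep_cat.
  by move=> /av /avail_cat/avail_cat; apply.
Qed.

End Alloc.

(** * Segment trees *)

Local Open Scope nat_scope.

Section SegmentTree.
Variables (n : nat) (rk : side -> 'I_n -> nat).
Hypothesis rk_lt : forall z i, rk z i < n.
Hypothesis rk_inj : forall z, injective (rk z).
Notation wtree := (wtree 'I_n).
Notation items := (seq 'I_n).

(** An injective map from [n] points into the ranks below [n] is onto. *)
Lemma rk_pick z r : r < n -> exists2 i, [pick i | rk z i == r] = Some i & rk z i = r.
Proof.
move=> rn; case: pickP => [i /eqP e|no]; first by exists i.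
pose f i := Ordinal (rk_lt z i).
have finj : injective f by move=> i j [] /rk_inj.
have [g fg gf] := injF_bij finj.
by have := no (g (Ordinal rn)); rewrite -[rk _ _]/(val (f _)) gf eqxx.
Qed.

(** The machine does not know the rank of the query, so [r < q z] is decided by comparison with the
    coordinate of the point of rank [r]. For [r >= n] there is no such point, but thresholds are at
    most [n] and the test would fail: [t2] is right. *)
Definition rank_br (z : side) (r : nat) (t1 t2 : wtree) : wtree :=
  if [pick i | rk z i == r] is Some i then Br z i t1 t2 else t2.

Section Level.
Variables (z : side) (lo : 'I_n -> nat) (thr : nat).

Definition covers h base (i : 'I_n) : bool :=
  (lo i <= base) && (base + 2 ^ h <= (rk z i).+1).

Definition full h base (s : items) := [seq i <- s | covers h base i].
Definition right_part h base (s : items) :=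
  [seq i <- s | ~~ covers h.+1 base i & base + 2 ^ h <= rk z i].
Definition left_part h base (s : items) :=
  [seq i <- s | ~~ covers h.+1 base i & lo i < base + 2 ^ h].

(* The cells of the node are [base], ..., [base + 2 ^ h - 1]; item [i] is
   active in the cells [lo i], ..., [rk z i]. *)
Fixpoint seg h base (s : items) (cont : items -> wtree) : wtree :=
  if size s < thr then Stop else
  if h is h'.+1 then
    Both (cont (full h base s))
      (rank_br z (base + 2 ^ h').-1
        (seg h' (base + 2 ^ h') (right_part h' base s) cont)
        (seg h' base (left_part h' base s) cont))
  else cont (full h base s).

(** [seg_path] collects what a single query hands to [cont] and governs correctness and time;
    [seg_lists] collects what the whole tree stores and governs space. *)
Fixpoint seg_path (q : nat) h base (s : items) : seq items :=
  if size s < thr then [::] else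
  full h base s :: if h is h'.+1 then
    if base + 2 ^ h' <= q then seg_path q h' (base + 2 ^ h') (right_part h' base s)
    else seg_path q h' base (left_part h' base s)
  else [::].

Fixpoint seg_lists h base (s : items) : seq items :=
  if size s < thr then [::] else
  full h base s :: if h is h'.+1 then
    seg_lists h' (base + 2 ^ h') (right_part h' base s) ++
    seg_lists h' base (left_part h' base s)
  else [::].

End Level.

Section Query.
Variables (q : side -> nat) (S : pred nat).
Hypothesis q_le : forall z, q z <= n.

Definition viol (z : side) (i : 'I_n) : bool := rk z i < q z.
Notation events := (events viol S).
Notation cost := (cost viol S).

Lemma events_rank_br z r t1 t2 :
  events (rank_br z r t1 t2) = if r < q z then events t1 else events t2.
Proof.
rewrite /rank_br; case: (ltnP r n) => [/(rk_pick z) [i -> /= <-]//|nr].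
by case: pickP => [i /eqP /= <-//|_]; rewrite ltnNge (leq_trans (q_le z) nr).
Qed.

Lemma cost_rank_br z r t1 t2 :
  cost (rank_br z r t1 t2) <= (if r < q z then cost t1 else cost t2).+1.
Proof.
rewrite /rank_br; case: (ltnP r n) => [/(rk_pick z) [i -> /= <-]//|nr].
by case: pickP => [i /eqP /= <-//|_]; rewrite ltnNge (leq_trans (q_le z) nr) /=.
Qed.

Lemma pred_add_exp b h m : ((b + 2 ^ h).-1 < m) = (b + 2 ^ h <= m).
Proof. by have := expn_gt0 2 h; case: (2 ^ h) => //= k _; rewrite addnS. Qed.

Lemma events_seg z lo thr h base s cont :
  events (seg z lo thr h base s cont) =
  flatten [seq events (cont l) | l <- seg_path z lo thr (q z) h base s].
Proof.
elim: h base s => [|h IH] base s /=; case: ifP => //= _; first by rewrite cats0.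
by rewrite events_rank_br pred_add_exp; case: ifP => _; rewrite IH.
Qed.

Lemma cost_seg z lo thr h base s cont :
  cost (seg z lo thr h base s cont) <=
  (\sum_(l <- seg_path z lo thr (q z) h base s) (cost (cont l)).+2).+1.
Proof.
elim: h base s => [|h IH] base s /=; case: ifP => //= _; rewrite ?big_nil //.
  by rewrite big_seq1 !leqW.
rewrite big_cons ltnS !addSn -!addnS leq_add2l.
apply: leq_trans (cost_rank_br _ _ _ _) _; rewrite pred_add_exp ltnS.
by case: ifP => _; apply: IH.
Qed.

End Query.

Section Path.
Variables (z : side) (lo : 'I_n -> nat) (q : nat).
Hypothesis lo_hi : forall i, lo i <= rk z i.

Lemma size_seg_path thr h base s : size (seg_path z lo thr q h base s) <= h.+1.
Proof.
elim: h base s => [|h IH] base s /=; case: ifP => //= _.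
by rewrite ltnS; case: ifP.
Qed.

Lemma seg_path_sub thr h base s l :
  l \in seg_path z lo thr q h base s -> subseq l s.
Proof.
elim: h base s => [|h IH] base s /=; case: ifP => //= _; rewrite inE.
  by move/eqP => ->; apply: filter_subseq.
case/predU1P => [->|]; first exact: filter_subseq.
by case: ifP => _ /IH /subseq_trans; apply; apply: filter_subseq.
Qed.

Definition active (i : 'I_n) : bool := lo i <= q <= rk z i.

(** An item active at [q] either covers the cells of the node and is reported there, or it meets the
    child containing [q] and is passed on. Covering items are not passed on, so nothing is reported
    twice. *)
Lemma seg_path_perm h base s : base <= q < base + 2 ^ h ->
  all (fun i => (lo i < base + 2 ^ h) && (base <= rk z i)) s ->
  perm_eq (flatten (seg_path z lo 1 q h base s)) [seq i <- s | active i].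
Proof.
elim: h base s => [|h IH] base s bq als /=; case: ifP => //= [|].
- by rewrite ltnS leqn0 size_eq0 => /eqP ->.
- move=> _; rewrite cats0 /full; apply/permP => a; rewrite !count_filter.
  apply: eq_in_count => i /(allP als) /=; rewrite /covers /active expn0 => li.
  by congr (_ && _); move: bq li; rewrite expn0; lia.
- by rewrite ltnS leqn0 size_eq0 => /eqP ->.
move=> _; have e2 : 2 ^ h.+1 = 2 ^ h + 2 ^ h by rewrite expnS mul2n addnn.
rewrite e2 in bq als.
have cact i : covers z lo h.+1 base i -> active i.
  by rewrite /covers /active e2 => /andP[]; move: bq; lia.
rewrite perm_sym -(perm_filterC (covers z lo h.+1 base)) perm_sym.
have -> : [seq i <- [seq i <- s | active i] | covers z lo h.+1 base i] =
    full z lo h.+1 base s.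
  rewrite -filter_predI; apply: eq_filter => i /=.
  by rewrite andbC; case: (boolP (covers _ _ _ _ _)) => [/cact ->|]; rewrite ?andbF.
rewrite perm_cat2l; case: ifP => bq'.
  rewrite (permPl (IH _ _ _ _)).
  - apply/permP => a; rewrite !count_filter; apply: eq_in_count => i /(allP als) li /=.
    by move: li; rewrite /active; case: (a i); case: covers; rewrite /= ?andbF //; lia.
  - by lia.
  - by apply/allP => i; rewrite mem_filter => /andP[/andP[_ ?] /(allP als)] /=; lia.
rewrite (permPl (IH _ _ _ _)).
- apply/permP => a; rewrite !count_filter; apply: eq_in_count => i /(allP als) li /=.
  by move: li; rewrite /active; case: (a i); case: covers; rewrite /= ?andbF //; lia.
- by lia.
- by apply/allP => i; rewrite mem_filter => /andP[/andP[_ ?] /(allP als)] /=; lia.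
Qed.

(** Lists only shrink on the way down: below a pruned node all of them are shorter than [thr] and
    contribute nothing. Pruning is therefore invisible to such sums. *)
Lemma seg_path_big thr h base s (g : seq 'I_n -> nat) : 0 < thr ->
  (forall l, size l < thr -> g l = 0) ->
  \sum_(l <- seg_path z lo thr q h base s) g l =
  \sum_(l <- seg_path z lo 1 q h base s) g l.
Proof.
move=> thr0 g0; have [st|st] := ltnP (size s) thr.
  have -> : seg_path z lo thr q h base s = [::] by case: h => /= [|h]; rewrite st.
  rewrite big_nil big1_seq // => l /andP[_ /seg_path_sub/size_subseq le].
  by apply: g0; apply: leq_ltn_trans st.
elim: h base s st => [|h IH] base s st /=;
  have e1 : (size s < thr) = false by apply/negbTE; rewrite -leqNgt.
  have e2 : (size s < 1) = false by apply/negbTE; rewrite -leqNgt (leq_trans thr0).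
  by rewrite e1 e2.
have e2 : (size s < 1) = false by apply/negbTE; rewrite -leqNgt (leq_trans thr0).
rewrite e1 e2 !big_cons; congr addn.
have gen b' s' : \sum_(l <- seg_path z lo thr q h b' s') g l =
    \sum_(l <- seg_path z lo 1 q h b' s') g l.
  have [st'|] := ltnP (size s') thr; last exact: IH.
  have -> : seg_path z lo thr q h b' s' = [::] by case: (h) => /= [|k]; rewrite st'.
  rewrite big_nil big1_seq // => l /andP[_ /seg_path_sub/size_subseq le].
  by apply: g0; apply: leq_ltn_trans st'.
by case: ifP.
Qed.

End Path.

(** * Number and total length of the lists of a segment tree *)

Section Size.

(** The number of nodes that an item active from [l] to [u] reaches: those that its range meets and
    that are not below a node it covers. *)
Fixpoint visits h base (l u : nat) : nat :=
  if (l < base + 2 ^ h) && (base <= u) then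
    if h is h'.+1 then
      if (l <= base) && (base + 2 ^ h <= u.+1) then 1
      else (visits h' (base + 2 ^ h') l u + visits h' base l u).+1
    else 1
  else 0.

Lemma visits_cover h base l u :
  (l <= base) && (base + 2 ^ h <= u.+1) -> visits h base l u <= 1.
Proof. by case: h => [|h] c; rewrite /= ?c; case: ifP. Qed.

Lemma visits_miss h base l u :
  ~~ ((l < base + 2 ^ h) && (base <= u)) -> visits h base l u = 0.
Proof. by case: h => [|h] /= /negPf ->. Qed.

(** When the range enters from the left, either the left child is covered or the right one is
    missed, so a single branch continues. The suffix case is symmetric. *)
Lemma visits_prefix h base l u : l <= base -> visits h base l u <= h.*2.+1.
Proof.
elim: h base => [|h IH] base lb /=; case: ifP => // _; case: ifP => // _.
have [c|c] := leqP (base + 2 ^ h) u.+1.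
  have := @visits_cover h base l u; rewrite lb c => /(_ isT).
  by have := IH (base + 2 ^ h); rewrite (leq_trans lb) ?leq_addr //; lia.
rewrite (@visits_miss _ (base + 2 ^ h)); last by lia.
by have := IH base lb; lia.
Qed.

Lemma visits_suffix h base l u : base + 2 ^ h <= u.+1 -> visits h base l u <= h.*2.+1.
Proof.
elim: h base => [|h IH] base bu /=; case: ifP => // _; case: ifP => // _.
have e2 : 2 ^ h.+1 = 2 ^ h + 2 ^ h by rewrite expnS mul2n addnn.
rewrite e2 in bu.
have [c|c] := leqP l (base + 2 ^ h).
  have := @visits_cover h (base + 2 ^ h) l u; rewrite c -addnA bu => /(_ isT).
  by have := IH base; lia.
rewrite (@visits_miss h base); last by lia.
by have := IH (base + 2 ^ h); lia.
Qed.

(** As long as one child is missed, only one branch is followed. At the node where the range splits,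
    a suffix of the left child and a prefix of the right one remain, each with at most [2 * h + 1]
    nodes. *)
Lemma visits_le h base l u : visits h base l u <= 4 * h + 1.
Proof.
elim: h base => [|h IH] base /=; case: ifP => //= _.
case: ifP => _; first by rewrite addn1.
have [c|c] := leqP (base + 2 ^ h) l.
  by rewrite (@visits_miss h base); [have := IH (base + 2 ^ h); lia | lia].
have [d|d] := leqP (base + 2 ^ h) u.
  have := @visits_prefix h (base + 2 ^ h) l u (ltnW c).
  have := @visits_suffix h base l u (leqW d); lia.
by rewrite (@visits_miss h (base + 2 ^ h)); [have := IH base; lia | lia].
Qed.

Variables (z : side) (lo : 'I_n -> nat).
Hypothesis lo_hi : forall i, lo i <= rk z i.

Definition meets h base (s : items) : bool :=
  all (fun i => (lo i < base + 2 ^ h) && (base <= rk z i)) s.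

Notation vis h base := (fun i => visits h base (lo i) (rk z i)).

Lemma meets_right h base s : meets h.+1 base s ->
  meets h (base + 2 ^ h) (right_part z lo h base s).
Proof.
move=> ms; apply/allP => i; rewrite mem_filter => /andP[/andP[_ r] /(allP ms)] /=.
by rewrite r expnS; lia.
Qed.

Lemma meets_left h base s : meets h.+1 base s ->
  meets h base (left_part z lo h base s).
Proof.
move=> ms; apply/allP => i; rewrite mem_filter => /andP[/andP[_ r] /(allP ms)] /=.
by rewrite r => /andP[].
Qed.

Lemma sum_visits h base s : meets h.+1 base s ->
  size s + \sum_(i <- right_part z lo h base s) vis h (base + 2 ^ h) i +
    \sum_(i <- left_part z lo h base s) vis h base i <=
  \sum_(i <- s) vis h.+1 base i.
Proof.
move=> ms; rewrite !big_filter -sum1_size.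
rewrite [X in _ + X + _]big_mkcond [X in _ + _ + X]big_mkcond -!big_split /=.
rewrite big_seq [leqRHS]big_seq; apply: leq_sum => i /(allP ms) /= ->.
rewrite /covers; case: ((lo i <= base) && _) => //=.
by case: ifP => _; case: ifP => _; lia.
Qed.

(** An unpruned node is charged to the items that reach it, of which there are at least [thr]. This
    is where pruning divides the number of nodes by [thr]. *)
Lemma seg_lists_count thr h base s : meets h base s ->
  size (seg_lists z lo thr h base s) * thr <= \sum_(i <- s) vis h base i.
Proof.
elim: h base s => [|h IH] base s ms /=; case: ltnP => //= st.
  rewrite mul1n (leq_trans st) // -sum1_size big_seq [leqRHS]big_seq.
  by apply: leq_sum => i /(allP ms) /= ->.
apply: leq_trans (sum_visits ms).
rewrite size_cat mulSn mulnDl -addnA leq_add // leq_add //.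
  by apply: IH; apply: meets_right.
by apply: IH; apply: meets_left.
Qed.

Lemma seg_lists_size thr h base s : meets h base s ->
  \sum_(l <- seg_lists z lo thr h base s) size l <= \sum_(i <- s) vis h base i.
Proof.
have sf k b : size (full z lo k b s) <= size s by rewrite size_filter count_size.
elim: h base s sf => [|h IH] base s sf ms /=; case: ltnP => //= st; rewrite ?big_nil //.
  rewrite big_seq1 (leq_trans (sf _ _)) // -sum1_size big_seq [leqRHS]big_seq.
  by apply: leq_sum => i /(allP ms) /= ->.
apply: leq_trans (sum_visits ms).
rewrite big_cons big_cat -addnA leq_add // leq_add //.
  by apply: IH; [move=> *; rewrite size_filter count_size|apply: meets_right].
by apply: IH; [move=> *; rewrite size_filter count_size|apply: meets_left].
Qed.

Lemma sum_visits_le h base s :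
  \sum_(i <- s) vis h base i <= (4 * h + 1) * size s.
Proof.
rewrite mulnC -sum1_size big_distrl /=; apply: leq_sum => i _.
by rewrite mul1n; apply: visits_le.
Qed.

Lemma seg_lists_sub thr h base s l :
  l \in seg_lists z lo thr h base s -> subseq l s.
Proof.
elim: h base s => [|h IH] base s /=; case: ifP => //= _; rewrite inE.
  by move/eqP => ->; apply: filter_subseq.
case/predU1P => [->|]; first exact: filter_subseq.
by rewrite mem_cat => /orP[] /IH /subseq_trans; apply; apply: filter_subseq.
Qed.

End Size.

Section Build.
Variables (R : realType) (W : nat) (p : 'I_n -> R * R).
Hypotheses (W7 : 7 <= W) (nW : n <= W).
Notation buildable := (buildable W p).

Lemma buildable_rank_br E z r t1 t2 k :
  buildable E (fun t => t1 = t \/ t2 = t) k ->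
  buildable E (eq (rank_br z r t1 t2)) k.+1.
Proof.
move=> b; rewrite /rank_br; case: pickP => [i _|_]; first exact: buildable_br.
by apply: buildable_sub b => // t <-; right.
Qed.

Lemma buildable_seg E z lo thr h base s cont (k : items -> nat) :
  {in seg_lists z lo thr h base s, forall l, buildable E (eq (cont l)) (k l)} ->
  buildable E (eq (seg z lo thr h base s cont))
    (\sum_(l <- seg_lists z lo thr h base s) (k l).+2).
Proof.
elim: h base s => [|h IH] base s /=; case: ifP => _ b.
- by rewrite big_nil; apply: buildable_avail; right.
- apply: buildable_sub (b _ (mem_head _ _)) => //.
  by rewrite big_seq1 !leqW.
- by rewrite big_nil; apply: buildable_avail; right.
have b1 := b _ (mem_head _ _).
have br := IH (base + 2 ^ h) (right_part z lo h base s).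
have bl := IH base (left_part z lo h base s).
have b2 := buildable_rank_br z (base + 2 ^ h).-1 (buildable_two (br _) (bl _)).
apply: buildable_sub (buildable_both W7 (buildable_two b1 (b2 _ _))) => //.
- by rewrite big_cons big_cat /= !addSn -!addnS.
- by move=> l hl; apply: b; rewrite inE mem_cat hl orbT.
- by move=> l hl; apply: b; rewrite inE mem_cat hl !orbT.
Qed.

End Build.

(** * Two nested segment trees, on the ranks of a and of b *)

Section TwoLevel.
Variables (lo : side -> 'I_n -> nat) (H : nat).
Hypothesis lo_hi : forall z i, lo z i <= rk z i.
Hypothesis nH : n < 2 ^ H.

Definition seg2 thr (s : items) (cont : items -> wtree) : wtree :=
  seg SA (lo SA) thr H 0 s (fun l => seg SB (lo SB) thr H 0 l cont).

Definition lists2 thr (s : items) : seq items :=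
  flatten [seq seg_lists SB (lo SB) thr H 0 l | l <- seg_lists SA (lo SA) thr H 0 s].

Definition path2 (q : side -> nat) thr (s : items) : seq items :=
  flatten [seq seg_path SB (lo SB) thr (q SB) H 0 l |
           l <- seg_path SA (lo SA) thr (q SA) H 0 s].

Lemma meets_root z s : meets z (lo z) H 0 s.
Proof.
apply/allP => i _; rewrite leq0n andbT add0n.
by apply: leq_ltn_trans (lo_hi z i) _; apply: ltn_trans nH.
Qed.

Lemma seg_lists_count_root z thr s :
  size (seg_lists z (lo z) thr H 0 s) * thr <= (4 * H + 1) * size s.
Proof.
apply: leq_trans (seg_lists_count _ _) (sum_visits_le _ _ _ _ _) => //.
exact: meets_root.
Qed.

Lemma seg_lists_size_root z thr s :
  \sum_(l <- seg_lists z (lo z) thr H 0 s) size l <= (4 * H + 1) * size s.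
Proof.
apply: leq_trans (seg_lists_size _ _) (sum_visits_le _ _ _ _ _) => //.
exact: meets_root.
Qed.

Lemma lists2_size thr s :
  \sum_(l <- lists2 thr s) size l <= (4 * H + 1) ^ 2 * size s.
Proof.
rewrite big_flatten big_map /=.
apply: (@leq_trans (\sum_(l <- seg_lists SA (lo SA) thr H 0 s) (4 * H + 1) * size l)).
  by apply: leq_sum => l _; apply: seg_lists_size_root.
by rewrite -big_distrr -mulnn -mulnA leq_mul2l seg_lists_size_root orbT.
Qed.

Lemma lists2_count thr s : size (lists2 thr s) * thr <= (4 * H + 1) ^ 2 * size s.
Proof.
rewrite size_flatten sumnE !big_map big_distrl /=.
apply: (@leq_trans (\sum_(l <- seg_lists SA (lo SA) thr H 0 s) (4 * H + 1) * size l)).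
  by apply: leq_sum => l _; apply: seg_lists_count_root.
by rewrite -big_distrr -mulnn -mulnA leq_mul2l seg_lists_size_root orbT.
Qed.

Lemma lists2_sub thr s l : l \in lists2 thr s -> subseq l s.
Proof.
move=> /flattenP [ls /mapP [l1 /seg_lists_sub s1 ->] /seg_lists_sub s2].
exact: subseq_trans s2 s1.
Qed.

(** The factor [c] clears denominators: it will be [X] or [X ^ 2], so that bounds with fractions
    stay in [nat]. [N] bounds the total length of the lists and [N %/ thr] the number of nodes on
    either level; two records per node on both levels make the term [4 * c]. *)
Lemma buildable_seg2 (R : realType) (W : nat) (p : 'I_n -> R * R) E thr s cont
    (k : items -> nat) (a b c : nat) :
  7 <= W -> 0 < thr ->
  {in lists2 thr s, forall l, buildable W p E (eq (cont l)) (k l)} ->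
  {in lists2 thr s, forall l, c * k l <= a * size l + b} ->
  let N := (4 * H + 1) ^ 2 * size s in
  exists2 K, c * K <= a * N + (b + 4 * c) * (N %/ thr) &
    buildable W p E (eq (seg2 thr s cont)) K.
Proof.
move=> W7 thr0 bk ck N.
pose K := \sum_(l <- seg_lists SA (lo SA) thr H 0 s)
  (\sum_(l' <- seg_lists SB (lo SB) thr H 0 l) (k l').+2).+2.
exists K; last first.
  apply: buildable_seg => // l hl; apply: buildable_seg => // l' hl'.
  by apply: bk; apply/flattenP; exists (seg_lists SB (lo SB) thr H 0 l) => //; apply: map_f.
have -> : K = \sum_(l <- lists2 thr s) (k l + 2) +
    size (seg_lists SA (lo SA) thr H 0 s) * 2.
  rewrite /K /lists2 big_flatten big_map /= -sum1_size big_distrl -big_split /=.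
  apply: eq_bigr => l _; rewrite mul1n addn2; congr _.+2.
  by apply: eq_bigr => l' _; rewrite addn2.
have s1 : c * (\sum_(l <- lists2 thr s) (k l + 2)) <=
    a * N + (b + 2 * c) * size (lists2 thr s).
  apply: (@leq_trans (a * (\sum_(l <- lists2 thr s) size l) +
      (b + 2 * c) * size (lists2 thr s))).
    rewrite -sum1_size !big_distrr -big_split /= big_seq [leqRHS]big_seq.
    by apply: leq_sum => l /ck; lia.
  by rewrite leq_add2r leq_mul2l lists2_size orbT.
have n1 : size (lists2 thr s) <= N %/ thr by rewrite leq_divRL // lists2_count.
have n2 : size (seg_lists SA (lo SA) thr H 0 s) <= N %/ thr.
  rewrite leq_divRL // (leq_trans (seg_lists_count_root _ _ _)) //.
  by rewrite leq_mul2r -mulnn leq_pmulr ?orbT // addn1.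
by move: s1 n1 n2; move: (size _) (size _) => x y; nia.
Qed.

Section TwoLevelQuery.
Variables (q : side -> nat) (S : pred nat).
Hypothesis q_le : forall z, q z <= n.
Notation events := (events (viol q) S).
Notation cost := (cost (viol q) S).

Lemma events_seg2 thr s cont : events (seg2 thr s cont) =
  flatten [seq events (cont l) | l <- path2 q thr s].
Proof.
rewrite events_seg // /path2; elim: (seg_path SA _ _ _ _ _ _) => //= l ls IH.
by rewrite map_cat flatten_cat events_seg // IH.
Qed.

Lemma path2_sub thr s l : l \in path2 q thr s -> subseq l s.
Proof.
move=> /flattenP [ls /mapP [l1 /seg_path_sub s1 ->] /seg_path_sub s2].
exact: subseq_trans s2 s1.
Qed.

Lemma cost_seg2 thr s cont b :
  {in path2 q thr s, forall l, cost (cont l) <= b} ->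
  cost (seg2 thr s cont) <= H.+1 ^ 2 * (b + 6).
Proof.
move=> cb; have cs z lo' h base s' cont' b' :
    {in seg_path z lo' thr (q z) h base s', forall l, cost (cont' l) <= b'} ->
    cost (seg z lo' thr h base s' cont') <= (h.+1 * b'.+2).+1.
  move=> cb'; apply: leq_trans (cost_seg _ _ _ _ _ _ _ _ _) _ => //; rewrite ltnS.
  apply: (@leq_trans (\sum_(l <- seg_path z lo' thr (q z) h base s') b'.+2)).
    by rewrite big_seq [leqRHS]big_seq; apply: leq_sum => l /cb'; rewrite !ltnS.
  by rewrite big_const_seq count_predT iter_addn_0 mulnC leq_mul2r size_seg_path orbT.
apply: (@leq_trans (H.+1 * ((H.+1 * b.+2).+1).+2).+1); last by nia.
apply: (cs) => l hl; apply: (cs) => l' hl'; apply: cb.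
by apply/flattenP; exists (seg_path SB (lo SB) thr (q SB) H 0 l) => //; apply: map_f.
Qed.

Lemma path2_perm s : perm_eq (flatten (path2 q 1 s))
  [seq i <- s | active SA (lo SA) (q SA) i && active SB (lo SB) (q SB) i].
Proof.
have root z : 0 <= q z < 0 + 2 ^ H by rewrite add0n (leq_ltn_trans (q_le z)).
have pB (ls : seq items) : perm_eq
    (flatten (flatten [seq seg_path SB (lo SB) 1 (q SB) H 0 l | l <- ls]))
    [seq i <- flatten ls | active SB (lo SB) (q SB) i].
  elim: ls => //= l ls IH; rewrite flatten_cat filter_cat perm_cat //.
  exact: seg_path_perm (root SB) (meets_root SB l).
apply: perm_trans (pB _) _.
have := perm_filter (active SB (lo SB) (q SB))
  (seg_path_perm (root SA) (meets_root SA s)).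
rewrite -filter_predI; congr perm_eq; apply: eq_filter => i /=; exact: andbC.
Qed.

Lemma path2_big thr s (g : items -> nat) : 0 < thr ->
  (forall l, size l < thr -> g l = 0) ->
  \sum_(l <- path2 q thr s) g l = \sum_(l <- path2 q 1 s) g l.
Proof.
move=> thr0 g0; rewrite /path2 !big_flatten !big_map /=.
rewrite (eq_bigr (fun l => \sum_(l' <- seg_path SB (lo SB) 1 (q SB) H 0 l) g l')).
  apply: seg_path_big => // l sl; rewrite -(@seg_path_big SB (lo SB) (q SB) thr H 0 l g thr0 g0).
  by case: (H) => [|h] /=; rewrite sl big_nil.
by move=> l _; apply: seg_path_big.
Qed.

End TwoLevelQuery.

End TwoLevel.
End SegmentTree.

(** * Searching in sorted lists *)

Section Decision.
Variables (n : nat) (rk : side -> 'I_n -> nat).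
Hypothesis rk_inj : forall z, injective (rk z).
Hypothesis rkAB : forall i j, (rk SA j < rk SA i) = (rk SB i < rk SB j).
Notation wtree := (wtree 'I_n).
Notation items := (seq 'I_n).

(** The order is decreasing, so that the points respecting bound [z] form a prefix. *)
Definition srt (z : side) (s : items) : items :=
  sort (fun i j => rk z j <= rk z i) s.

Definition ok (q : side -> nat) (z : side) (i : 'I_n) : bool := q z <= rk z i.

Lemma viol_ok q z i : viol rk q z i = ~~ ok q z i.
Proof. by rewrite /viol /ok -ltnNge. Qed.

Lemma perm_srt z s : perm_eq (srt z s) s.
Proof. by rewrite perm_sort. Qed.

Lemma size_srt z s : size (srt z s) = size s.
Proof. exact: size_sort. Qed.

Lemma mem_srt z s : srt z s =i s.
Proof. exact: mem_sort. Qed.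

Lemma srt_pairwise z s : pairwise (fun i j => rk z j <= rk z i) (srt z s).
Proof.
rewrite -sorted_pairwise; last by move=> i j k /= h1 h2; apply: leq_trans h1.
by apply: sort_sorted => i j; apply: leq_total.
Qed.

Lemma ok_prefix q z s : pairwise (fun i j => rk z j <= rk z i) s ->
  [seq i <- s | ok q z i] = take (count (ok q z) s) s.
Proof.
elim: s => //= i s IH /andP[le /IH e]; case: ifP => oi /=; first by rewrite e.
have n0 : count (ok q z) s = 0.
  apply/eqP; rewrite -leqn0 leqNgt -has_count; apply/hasPn => j /(allP le) ji.
  by apply: contraFN oi => /leq_trans; apply.
by rewrite e n0 take0.
Qed.

(** Binary search for the length of the prefix of good points, which is handed to [leaf]; [off]
    counts the points already known to be good. The fuel [f] makes the recursion structural, and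
    [size s < 2 ^ f] suffices. *)
Fixpoint bst (f : nat) (z : side) (s : items) (off : nat) (leaf : nat -> wtree)
    : wtree :=
  if f is f'.+1 then
    if drop (size s)./2 s is x :: s' then
      Br z x (bst f' z (take (size s)./2 s) off leaf)
        (bst f' z s' (off + (size s)./2.+1) leaf)
    else leaf off
  else leaf off.

Lemma halve (s : items) x s' : drop (size s)./2 s = x :: s' ->
  [/\ s = take (size s)./2 s ++ x :: s', size (take (size s)./2 s) = (size s)./2 &
      size s' = (size s - (size s)./2).-1].
Proof.
move=> e; have le : (size s)./2 <= size s by lia.
split; first by rewrite -e cat_take_drop.
- exact: size_takel.
- by have := size_drop (size s)./2 s; rewrite e /= => <-.
Qed.

Lemma halve_nil (s : items) : drop (size s)./2 s = [::] -> s = [::].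
Proof.
move=> e; have := size_drop (size s)./2 s; rewrite e /= => h.
by apply: size0nil; lia.
Qed.

Section BstQuery.
Variables (q : side -> nat) (S : pred nat).
Notation events := (events (viol rk q) S).
Notation cost := (cost (viol rk q) S).

Lemma bst_query f z s off leaf : size s < 2 ^ f ->
  pairwise (fun i j => rk z j <= rk z i) s ->
  let k := off + count (ok q z) s in
  events (bst f z s off leaf) = events (leaf k) /\
  cost (bst f z s off leaf) <= f + cost (leaf k).
Proof.
elim: f s off => [|f IH] s off /= sf pw.
  by move: sf; rewrite expn0 ltnS leqn0 size_eq0 => /eqP ->; rewrite /= addn0.
case e: drop => [|x s'].
  by rewrite (halve_nil e) /= addn0; split=> //; rewrite leq_addl.
have [es s1 s2] := halve e.
have sf2 : size s < (2 ^ f).*2 by move: sf; rewrite expnS mul2n.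
move: pw; rewrite {1}es pairwise_cat => /and3P[/allrelP al pw1 /= /andP[al2 pw2]].
have xin : x \in x :: s' by rewrite mem_head.
rewrite viol_ok /=; case: (boolP (ok q z x)) => ox /=.
  have -> : off + count (ok q z) s =
      off + (size s)./2.+1 + count (ok q z) s'.
    rewrite {1}es count_cat /= ox (@eq_in_count _ _ predT (take _ _)); last first.
      by move=> i hi; apply: leq_trans ox (al _ _ hi xin).
    by rewrite count_predT s1; lia.
  have [|-> c] := IH s' (off + (size s)./2.+1) _ pw2; first by lia.
  by split=> //; rewrite addSn ltnS.
have -> : count (ok q z) s = count (ok q z) (take (size s)./2 s).
  rewrite {1}es count_cat /= (negPf ox) add0n.
  rewrite (@eq_in_count _ _ pred0 s') ?count_pred0 ?addn0 // => i /(allP al2) le.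
  by apply: contraNF ox => /leq_trans; apply.
have [|-> c] := IH (take (size s)./2 s) off _ pw1; first by lia.
by split=> //; rewrite addSn ltnS.
Qed.

(** The head of the sorted list has the largest rank, so this one comparison decides whether any
    point of [s] respects bound [z]. *)
Definition if_ok (z : side) (s : items) (yes no : wtree) : wtree :=
  if srt z s is i :: _ then Br z i no yes else no.

Lemma if_ok_query z s yes no :
  let t := if has (ok q z) s then yes else no in
  events (if_ok z s yes no) = events t /\
  cost (if_ok z s yes no) <= (cost t).+1.
Proof.
rewrite /if_ok -(perm_has _ (perm_srt z s)).
have := srt_pairwise z s; case: srt => [|i r] //= /andP[al _].
rewrite viol_ok; case: (boolP (ok q z i)) => //= oi.
suff -> : has (ok q z) r = false by [].
apply/hasPn => j /(allP al) ji; apply: contra oi => /leq_trans; exact.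
Qed.

End BstQuery.

Section BstBuild.
Variables (R : realType) (W : nat) (p : 'I_n -> R * R).
Hypotheses (W7 : 7 <= W) (nW : n <= W).
Notation buildable := (buildable W p).

Lemma buildable_bst E f z s off leaf k :
  (forall j, j <= off + size s -> buildable E (eq (leaf j)) k) ->
  buildable E (eq (bst f z s off leaf)) (size s + (size s).+1 * k).
Proof.
have base j m : buildable E (eq (leaf j)) k ->
    buildable E (eq (leaf j)) (m + m.+1 * k).
  by apply: buildable_sub => //; rewrite mulSn; lia.
elim: f s off => [|f IH] s off b /=; first by apply: base; apply: b; rewrite leq_addr.
case e: drop => [|x s']; first by apply: base; apply: b; rewrite leq_addr.
have [es s1 s2] := halve e.
have sz : size s = (size s)./2 + (size s').+1.
  by rewrite {1}es size_cat s1.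
have b1 := IH (take (size s)./2 s) off; have b2 := IH s' (off + (size s)./2.+1).
apply: buildable_sub (buildable_br W7 z x (buildable_two (b1 _) (b2 _))) => //.
- by rewrite s1 {3 4}sz; nia.
- by move=> j; rewrite s1 => hj; apply: b; lia.
- by move=> j hj; apply: b; lia.
Qed.

Lemma buildable_if_ok E z s yes no k1 k2 :
  buildable E (eq yes) k1 -> buildable E (eq no) k2 ->
  buildable E (eq (if_ok z s yes no)) (k2 + k1).+1.
Proof.
move=> b1 b2; rewrite /if_ok; case: srt => [|i r].
  by apply: buildable_sub b2 => //; lia.
exact: buildable_br (buildable_two b2 b1).
Qed.

End BstBuild.

(** * Deciding whether a color occurs in a three-sided range *)

Section Exists.
Variables (H : nat) (e : side).

(** As [x] is inside the slab, a point to its left only has to respect a and a point to its right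
    only b. A success adds -1 because it means that a color has been counted on both sides. *)
Definition nearest_leaf (x : 'I_n) (s : items) : wtree :=
  if_ok SA [seq i <- s | rk SA i <= rk SA x] (Add (-1)%R)
    (if_ok SB [seq i <- s | rk SA x < rk SA i] (Add (-1)%R) Stop).

(* [s] is sorted by abscissa.  At the first middle point [x] inside [a, b] the
   side [e] is resolved first: among the points on the good side of [e], only
   the nearest ones to the left and to the right of [x] matter. *)
Fixpoint ex_tree (f : nat) (s : items) : wtree :=
  if f is f'.+1 then
    if drop (size s)./2 s is x :: s' then
      Br SA x (ex_tree f' s')
        (Br SB x (ex_tree f' (take (size s)./2 s))
           (bst H e (srt e s) 0 (fun j => nearest_leaf x (take j (srt e s)))))
    else Stop
  else Stop.

Definition ok3 (q : side -> nat) (i : 'I_n) : bool :=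
  [&& ok q SA i, ok q SB i & ok q e i].

(** The descent makes at most two comparisons per level and is followed by one binary search. The
    searches do not nest, so the test takes logarithmic time. *)
Lemma ex_tree_query q S f s : size s < 2 ^ f -> size s < 2 ^ H ->
  pairwise (fun i j => rk SA i < rk SA j) s ->
  events (viol rk q) S (ex_tree f s) = (if has (ok3 q) s then [:: inl (-1)%R] else [::]) /\
  cost (viol rk q) S (ex_tree f s) <= f.*2 + H + 4.
Proof.
elim: f s => [|f IH] s /= sf sH pw.
  by move: sf; rewrite expn0 ltnS leqn0 size_eq0 => /eqP ->; split=> //; clear; lia.
case ed: drop => [|x s'].
  by rewrite (halve_nil ed) /=; split=> //; clear; lia.
have [es s1 s2] := halve ed.
have [h1 h2 h3 h4] : [/\ size s' < 2 ^ f, size (take (size s)./2 s) < 2 ^ f,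
    size s' < 2 ^ H & size (take (size s)./2 s) < 2 ^ H].
  rewrite s1 s2; move: sf sH; rewrite expnS; clear; set a := size s.
  by move: (2 ^ f) (2 ^ H) => ? ?; split; lia.
move: (pw); rewrite {1}es pairwise_cat => /and3P[/allrelP al pw1 /= /andP[al2 pw2]].
have xin : x \in x :: s' by rewrite mem_head.
have hs : has (ok3 q) s = [|| has (ok3 q) (take (size s)./2 s), ok3 q x | has (ok3 q) s'].
  by rewrite {1}es has_cat.
rewrite !viol_ok; case: (boolP (ok q SA x)) => oa /=; last first.
  have -> : has (ok3 q) s = has (ok3 q) s'.
    rewrite hs /ok3 (negPf oa) /= (_ : has _ (take _ _) = false) //.
    apply/hasPn => i hi; apply: contra oa => /and3P[oi _ _].
    by apply: leq_trans oi _; apply: ltnW; apply: al.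
  have [-> c] := IH s' h1 h3 pw2.
  by split=> //; move: c; clear; lia.
case: (boolP (ok q SB x)) => ob /=; last first.
  have -> : has (ok3 q) s = has (ok3 q) (take (size s)./2 s).
    rewrite hs /ok3 (negPf ob) andbF /= (_ : has _ s' = false) ?orbF //.
    apply/hasPn => i /(allP al2) xi; apply: contra ob => /and3P[_ oi _].
    by apply: leq_trans oi _; apply: ltnW; rewrite -rkAB.
  have [-> c] := IH _ h2 h4 pw1.
  by split=> //; move: c; clear; lia.
have [|-> cb] := bst_query q S 0 (fun j => nearest_leaf x (take j (srt e s))) _
   (srt_pairwise e s) (f := H); first by rewrite size_srt.
rewrite add0n in cb *.
rewrite -(ok_prefix q (srt_pairwise e s)) in cb *.
set t := [seq i <- srt e s | ok q e i] in cb *.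
have [eA cA] := if_ok_query q S SA [seq i <- t | rk SA i <= rk SA x] (Add (-1)%R)
  (if_ok SB [seq i <- t | rk SA x < rk SA i] (Add (-1)%R) Stop).
have [eB cB] := if_ok_query q S SB [seq i <- t | rk SA x < rk SA i] (Add (-1)%R) Stop.
have hE : has (ok3 q) s = has (ok q SA) [seq i <- t | rk SA i <= rk SA x] ||
    has (ok q SB) [seq i <- t | rk SA x < rk SA i].
  apply/hasP/orP => [[i si /and3P[ia ib ie]]|].
    have it : i \in t by rewrite mem_filter mem_srt ie.
    have [xi|xi] := leqP (rk SA i) (rk SA x); [left|right]; apply/hasP; exists i => //.
      by rewrite mem_filter xi.
    by rewrite mem_filter xi.
  case=> /hasP [i]; rewrite !mem_filter mem_srt => /and3P[xi ie si] oi; exists i => //.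
    rewrite /ok3 oi ie andbT; move: xi; rewrite leq_eqVlt => /predU1P[/rk_inj ->//|].
    by rewrite rkAB => /ltnW; apply: leq_trans ob.
  rewrite /ok3 oi ie /= andbT; apply: leq_trans oa _; exact: ltnW.
split.
  by rewrite /nearest_leaf eA hE; case: has => //=; rewrite eB; case: has.
have : cost (viol rk q) S (nearest_leaf x t) <= 3; last first.
  by move: cb; clear; lia.
apply: leq_trans cA _; case: has => //; rewrite ltnS.
by apply: leq_trans cB _; case: has.
Qed.

(** A node with [s] has two branches and a search tree whose leaves take 4 records each, hence
    [5 * size s + 6] records, at most [11 * size s] since [s] is not empty. *)
Lemma buildable_ex_tree (R : realType) (W : nat) (p : 'I_n -> R * R) E f s :
  7 <= W -> 0 < n <= W -> buildable W p E (eq (ex_tree f s)) (11 * f * size s).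
Proof.
move=> W7 /andP[n0 nW].
have b0 : buildable W p E (eq Stop) 0 by apply: buildable_avail; right.
have bstop k : buildable W p E (eq Stop) k by apply: buildable_sub b0.
have badd : buildable W p E (eq (Add (-1)%R)) 1 by apply: buildable_add.
have bleaf x t : buildable W p E (eq (nearest_leaf x t)) 4.
  exact: (buildable_if_ok W7 nW _ _ badd (buildable_if_ok W7 nW _ _ badd b0)).
elim: f s => [|f IH] s //=.
case ed: drop => [|x s'] //.
have [es s1 s2] := halve ed.
have sz : size s = (size s)./2 + (size s').+1 by rewrite {1}es size_cat s1.
have b3 := @buildable_bst R W p W7 nW E H e (srt e s) 0
  (fun j => nearest_leaf x (take j (srt e s))) 4 (fun j _ => bleaf x _).
apply: buildable_sub (buildable_br W7 SA x (buildable_two (IH s')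
  (buildable_br W7 SB x (buildable_two (IH (take (size s)./2 s)) b3)))) => //.
move: sz; rewrite s1 size_srt; move: (size s) (size s') (size s)./2 => v w u ->; rewrite [11 * f.+1]mulnS mulnDl; move: (11 * f) => k; rewrite !mulnDr !mulnS; move: (k * u) (k * w); clear; lia.
Qed.

End Exists.
End Decision.

(** * Three-sided queries *)

(** Inclusion and exclusion, for [a], [b] the colors in whole blocks and [r], [s] the leftover ones.
    The common colors are partitioned into those of [a] and [b] (tabulated), those of [r] (tested
    against everything below), and those of [s] and [a]. Having no repetitions, the last are the
    members of [s] outside [r] that the upper query sees: the marks exclude [r]. *)
Lemma union_count (a r b s : seq nat) : uniq (a ++ r) -> uniq (b ++ s) ->
  size (undup ((a ++ r) ++ (b ++ s))) + count [in b] a + count [in b ++ s] r +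
    count (fun x => (x \notin r) && (x \in a ++ r)) s =
  size (a ++ r) + size (b ++ s).
Proof.
move=> u1 u2; rewrite undup_cat size_cat (undup_id u2).
have -> : [seq x <- undup (a ++ r) | x \notin b ++ s] =
    [seq x <- a ++ r | x \notin b ++ s] by rewrite undup_id.
have e1 : count [in b ++ s] (a ++ r) + count (predC [in b ++ s]) (a ++ r) = size (a ++ r).
  exact: count_predC.
have e2 : count [in b ++ s] (a ++ r) = count [in b] a + count [in s] a + count [in b ++ s] r.
  rewrite count_cat; congr (_ + _).
  rewrite -count_predUI [X in _ + X](@eq_in_count _ _ pred0) ?count_pred0 ?addn0.
    by apply: eq_count => x /=; rewrite mem_cat.
  move=> x _ /=; apply/negbTE/andP => -[xb xs]; move: u2.
  by rewrite cat_uniq => /and3P[_ /hasPn /(_ _ xs)]; rewrite /= xb.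
have e3 : count [in s] a = count (fun x => (x \notin r) && (x \in a ++ r)) s.
  move: u1 u2; rewrite !cat_uniq => /and3P[ua ar _] /and3P[_ _ us].
  rewrite -!size_filter; apply/perm_size/uniq_perm; rewrite ?filter_uniq // => x.
  rewrite !mem_filter mem_cat andbC; case: (x \in s); rewrite ?andbF // !andbT.
  case xa: (x \in a) => /=; last by case: (x \in r).
  by rewrite andbT; apply/esym/negP => xr; move/hasPn: ar => /(_ _ xr) /=; rewrite xa.
rewrite size_filter -[size (a ++ r)]e1 e2 e3.
have -> : count (predC [in b ++ s]) (a ++ r) = count (fun x => x \notin b ++ s) (a ++ r).
  exact: eq_count.
move: (count _ s) (count _ _) (count _ r) (count _ a) (size _); clear; lia.
Qed.

Section SideTree.
Variables (n : nat) (rk : side -> 'I_n -> nat) (col : 'I_n -> nat).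
Hypothesis rk_lt : forall z i, rk z i < n.
Hypothesis rk_inj : forall z, injective (rk z).
Hypothesis rkAB : forall i j, (rk SA j < rk SA i) = (rk SB i < rk SB j).
Variables (X H : nat).
Hypotheses (X0 : 0 < X) (nH : n < 2 ^ H).
Notation wtree := (wtree 'I_n).
Notation items := (seq 'I_n).
Notation srt := (srt rk).
Notation ok := (ok rk).

Section OneSide.
Variables (e : side) (P : items).

(* The octant of [i] minus the octants of the better points of its color is
   the box [lo SA i, rk SA i] x [lo SB i, rk SB i] in the ranks of a and b. *)
Definition lo (z : side) (i : 'I_n) : nat :=
  \max_(j <- P | [&& col j == col i, rk e i < rk e j & rk z j < rk z i]) (rk z j).+1.

Lemma lo_rk z i : lo z i <= rk z i.
Proof. by rewrite /lo; elim/big_rec: _ => // j m /and3P[_ _ h] hm; rewrite geq_max h. Qed.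

Definition best (q : side -> nat) (i : 'I_n) : bool :=
  active rk SA (lo SA) (q SA) i && active rk SB (lo SB) (q SB) i.

Lemma best_ok q i : best q i -> ok q SA i && ok q SB i.
Proof. by rewrite /best /active /ok => /andP[/andP[_ ->] /andP[_ ->]]. Qed.

Lemma lo_gt z i j : j \in P -> col j = col i -> rk e i < rk e j ->
  rk z j < rk z i -> rk z j < lo z i.
Proof.
move=> jP c re rz; rewrite /lo (big_rem j) //= c eqxx re rz /=.
by rewrite leq_max leqnn.
Qed.

(** If [j] beats [i] and both lie in the slab, then [j] is to the left or to the right of [i], which
    pushes one of the two bounds [lo] of [i] beyond the threshold of the query. *)
Lemma best_inj q i j : i \in P -> j \in P -> best q i -> best q j ->
  col i = col j -> i = j.
Proof.
wlog le : i j / rk e i <= rk e j.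
  move=> wl iP jP bi bj c; case: (leqP (rk e i) (rk e j)) => le; first exact: wl.
  by apply/esym; apply: wl => //; apply: ltnW.
move=> iP jP /andP[/andP[la _] /andP[lb _]] bj c.
have /andP[oa ob] := best_ok bj.
move: le; rewrite leq_eqVlt => /predU1P[/rk_inj //|lt].
have [ltA|ltA|/rk_inj //] := ltngtP (rk SA i) (rk SA j).
- have := @lo_gt SB i j jP (esym c) lt; rewrite -rkAB ltA => /(_ isT).
  by move: lb ob; rewrite /ok; lia.
- have := @lo_gt SA i j jP (esym c) lt ltA.
  by move: la oa; rewrite /ok; lia.
Qed.

Lemma best_exists q i : i \in P -> ok q SA i -> ok q SB i ->
  exists j, [/\ j \in P, best q j, col j = col i & rk e i <= rk e j].
Proof.
move=> iP oa ob.
pose Q j := [&& j \in P, ok q SA j, ok q SB j & col j == col i].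
have Qi : Q i by rewrite /Q iP oa ob eqxx.
case: (@arg_maxnP _ i Q (rk e) Qi) => j /and4P[jP ja jb /eqP cj] mx.
exists j; split=> //; last exact: mx.
(* A point [k] that beats [j] and has smaller rank on side [z] has larger rank on the opposite side,
   so it respects the opposite bound. If it also respected bound [z] it would belong to [Q], against
   the choice of [j]; hence [lo] does not exceed the threshold. *)
have dom z : (forall k, k \in P -> rk z k < rk z j -> ok q z k -> Q k \/ col k <> col j) ->
    ok q z j -> active rk z (lo z) (q z) j.
  move=> dz oz; rewrite /active -/(ok q z j) oz andbT /lo big_seq_cond.
  elim/big_rec: _ => // k m /and4P[kP /eqP ck re rz] hm; rewrite geq_max hm andbT ltnNge.
  apply/negP => okk; by case: (dz k kP rz okk) => // /mx; rewrite /= leqNgt re.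
apply/andP; split; apply: dom => // k kP rz okk;
  case: (col k =P col j) => [ck|]; try (by right); left; rewrite /Q kP okk ck cj eqxx /=.
  by rewrite andbT; apply: leq_trans jb _; apply: ltnW; rewrite -rkAB.
by rewrite andbT; apply: leq_trans ja _; apply: ltnW; rewrite rkAB.
Qed.

(** Walks the points left over from a prefix, given in reverse, and halts where a whole number of
    blocks remains. The stopping rule depends only on the remaining length, so the chain of a prefix
    is either [Stop] or one record on top of the chain of the prefix shorter by one: all the
    prefixes of a list share their chains. *)
Fixpoint chain (elem : 'I_n -> wtree) (r : items) : wtree :=
  if r is i :: r' then
    if X %| size r then Stop else Both (elem i) (chain elem r')
  else Stop.

Lemma events_chain v S elem r : events v S (chain elem r) =
  flatten [seq events v S (elem i) | i <- take (size r %% X) r].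
Proof.
elim: r => [|i r IH] //=.
case: ifP => [/eqP -> //|nd]; rewrite modnS nd /=.
by rewrite IH.
Qed.

Lemma cost_chain v S elem r b : (forall i, i \in r -> cost v S (elem i) <= b) ->
  cost v S (chain elem r) <= (size r %% X) * b.+1 + 1.
Proof.
elim: r => [|i r IH] h /=; first by rewrite addn1.
case: ifP => [_|nd]; first by rewrite addn1.
have h1 := h i (mem_head _ _).
have h2 : cost v S (chain elem r) <= (size r %% X) * b.+1 + 1.
  by apply: IH => j jr; apply: h; rewrite inE jr orbT.
by rewrite modnS nd mulSn -addnA addSn ltnS; apply: leq_add.
Qed.

Definition cut (elem : 'I_n -> wtree) (base : items -> nat -> wtree) (l : items) :
    wtree :=
  bst H e (srt e l) 0
    (fun j => Both (base (srt e l) j) (chain elem (rev (take j (srt e l))))).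

Definition side_tree elem base : wtree := seg2 rk lo H 1 P (cut elem base).

Definition good q (l : items) : nat := count (ok q e) l.
Definition blocks q (l : items) : items := take (X * (good q l %/ X)) (srt e l).
Definition rest q (l : items) : items :=
  take (good q l %% X) (rev (take (good q l) (srt e l))).

Lemma good_srt q l : count (ok q e) (srt e l) = good q l.
Proof. exact/permP/perm_srt. Qed.

Lemma good_le q l : good q l <= size l. Proof. exact: count_size. Qed.

Lemma take_good q l : take (good q l) (srt e l) = [seq i <- srt e l | ok q e i].
Proof. by rewrite (ok_prefix q (srt_pairwise rk e l)) good_srt. Qed.

Lemma blocks_rest q l : perm_eq (blocks q l ++ rest q l) [seq i <- l | ok q e i].
Proof.
apply: (@perm_trans _ [seq i <- srt e l | ok q e i]); last exact/perm_filter/perm_srt.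
rewrite -take_good /rest take_rev perm_sym; set k := good q l.
have sk : size (take k (srt e l)) = k by rewrite size_takel // size_srt good_le.
rewrite sk (_ : k - k %% X = X * (k %/ X)); last first.
  by rewrite {1}(divn_eq k X) addnK mulnC.
rewrite -{1}(cat_take_drop (X * (k %/ X)) (take k (srt e l))) /blocks.
rewrite take_takel; last by rewrite mulnC leq_divM.
by rewrite perm_cat2l perm_sym perm_rev.
Qed.

Section SideTreeQuery.
Variables (q : side -> nat) (S : pred nat).
Hypothesis q_le : forall z, q z <= n.
Notation events := (events (viol rk q) S).
Notation cost := (cost (viol rk q) S).
Hypothesis uP : uniq P.

Lemma sub_size l : subseq l P -> size l < 2 ^ H.
Proof.
move=> sub; apply: leq_ltn_trans nH; have := max_card [in l].
by rewrite card_ord (card_uniqP (subseq_uniq sub uP)).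
Qed.

Definition paths := path2 rk lo H q 1 P.

Lemma cut_query elem base l : subseq l P ->
  events (cut elem base l) = events (base (srt e l) (good q l)) ++
    flatten [seq events (elem i) | i <- rest q l].
Proof.
move=> sub; rewrite /cut.
have [||-> _] := bst_query (rk := rk) q S 0 (fun j => Both (base (srt e l) j)
  (chain elem (rev (take j (srt e l))))) (f := H) (z := e) (s := srt e l).
- by rewrite size_srt sub_size.
- exact: srt_pairwise.
rewrite add0n good_srt /= events_chain size_rev size_takel ?size_srt ?good_le //.
Qed.

Lemma events_side_tree elem base : events (side_tree elem base) =
  flatten [seq events (base (srt e l) (good q l)) ++
    flatten [seq events (elem i) | i <- rest q l] | l <- paths].
Proof.
rewrite /side_tree events_seg2 //; congr flatten; apply/eq_in_map => l /path2_sub sub.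
exact: cut_query.
Qed.

Lemma cost_side_tree elem base b1 b2 :
  (forall l, subseq l P -> cost (base (srt e l) (good q l)) <= b1) ->
  (forall i, cost (elem i) <= b2) ->
  cost (side_tree elem base) <= H.+1 ^ 2 * (H + b1 + X * b2.+1 + 8).
Proof.
move=> h1 h2; apply: (@leq_trans (H.+1 ^ 2 * (H + b1 + X * b2.+1 + 2 + 6))); last first.
  by rewrite -!addnA.
apply: cost_seg2 => // l /path2_sub sub; rewrite /cut.
have [||_ c] := bst_query (rk := rk) q S 0 (fun j => Both (base (srt e l) j)
  (chain elem (rev (take j (srt e l))))) (f := H) (z := e) (s := srt e l).
- by rewrite size_srt sub_size.
- exact: srt_pairwise.
apply: leq_trans c _; rewrite add0n good_srt /=.
have := h1 l sub; have := @cost_chain (viol rk q) S elem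
  (rev (take (good q l) (srt e l))) b2 (fun i _ => h2 i).
rewrite size_rev size_takel ?size_srt ?good_le //.
have := ltn_pmod (good q l) X0; nia.
Qed.

Lemma paths_good : perm_eq
  (flatten [seq [seq i <- l | ok q e i] | l <- paths])
  [seq i <- P | best q i && ok q e i].
Proof.
have -> : flatten [seq [seq i <- l | ok q e i] | l <- paths] =
    [seq i <- flatten paths | ok q e i].
  by elim: paths => //= l ls ->; rewrite filter_cat.
have pp : perm_eq (flatten paths) [seq i <- P | best q i].
  by apply: path2_perm => //; apply: lo_rk.
apply: perm_trans (perm_filter _ pp) _; rewrite -filter_predI.
by rewrite (@eq_filter _ _ (fun i => best q i && ok q e i)) // => i; apply: andbC.
Qed.

Definition all_blocks := flatten [seq blocks q l | l <- paths].
Definition all_rest := flatten [seq rest q l | l <- paths].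

Lemma all_blocks_rest : perm_eq (all_blocks ++ all_rest)
  [seq i <- P | best q i && ok q e i].
Proof.
apply: perm_trans paths_good; rewrite /all_blocks /all_rest.
elim: paths => //= l ls IH; rewrite perm_catACA /=.
by apply: perm_cat (blocks_rest q l) IH.
Qed.

Definition seen : seq nat := [seq col i | i <- P & ok3 rk e q i].

Lemma uniq_all : uniq (map col (all_blocks ++ all_rest)).
Proof.
have up : uniq (all_blocks ++ all_rest).
  by rewrite (perm_uniq all_blocks_rest) filter_uniq.
rewrite map_inj_in_uniq // => i j; rewrite !(perm_mem all_blocks_rest) !mem_filter.
by move=> /andP[/andP[bi _] iP] /andP[/andP[bj _] jP] /(best_inj iP jP bi bj).
Qed.

Lemma mem_all : map col (all_blocks ++ all_rest) =i seen.
Proof.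
move=> c; apply/mapP/mapP => -[i].
  rewrite (perm_mem all_blocks_rest) mem_filter => /andP[/andP[b oe] iP] ->.
  exists i => //; rewrite mem_filter iP /ok3 oe !andbT.
  exact: best_ok b.
rewrite mem_filter => /andP[/and3P[oa ob oe] iP] ->.
have [j [jP bj cj le]] := best_exists iP oa ob.
exists j => //; rewrite (perm_mem all_blocks_rest) mem_filter bj jP.
by rewrite andbT /=; apply: leq_trans oe le.
Qed.

Lemma sum_good : \sum_(l <- paths) good q l = size (all_blocks ++ all_rest).
Proof.
rewrite (perm_size all_blocks_rest) -(perm_size paths_good).
rewrite size_flatten sumnE !big_map; apply: eq_bigr => l _.
by rewrite /= size_filter.
Qed.

End SideTreeQuery.
End OneSide.
End SideTree.

(** * Tables of common colors *)

Lemma gain_flatten (T : Type) (f : T -> seq (int + nat)) (s : seq T) :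
  gain (flatten [seq f x | x <- s]) = (\sum_(x <- s) gain (f x))%R.
Proof.
elim: s => [|x s IH] /=; first by rewrite /gain !big_nil.
by rewrite gain_cat IH big_cons.
Qed.

Lemma outs_flatten (T : Type) (f : T -> seq (int + nat)) (s : seq T) :
  outs (flatten [seq f x | x <- s]) = flatten [seq outs (f x) | x <- s].
Proof. by elim: s => //= x s IH; rewrite outs_cat IH. Qed.

Lemma sum_mem_uniq (T : eqType) (ss : seq (seq T)) x : uniq (flatten ss) ->
  \sum_(s <- ss) (x \in s) = (x \in flatten ss).
Proof.
elim: ss => [|s ss IH] /=; first by rewrite big_nil.
rewrite cat_uniq => /and3P[_ /hasPn no u]; rewrite big_cons IH // mem_cat.
case xs: (x \in s) => //=; case xf: (x \in flatten ss) => //.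
by have := no _ xf; rewrite /= xs.
Qed.

Lemma sum_count_fibers (I K : eqType) (ks : seq K) (f : I -> K) (s : seq I) :
  uniq ks -> \sum_(c <- ks) count (fun i => f i == c) s <= size s.
Proof.
move=> u; elim: s => [|i s IH] /=; first by rewrite big1.
rewrite big_split /= -add1n leq_add //.
have -> : \sum_(c <- ks) (f i == c) = (f i \in ks); last by case: (_ \in _).
rewrite -(count_uniq_mem _ u) -sumn_count sumnE big_map.
by apply: eq_bigr => c _; rewrite /= eq_sym.
Qed.

Section Skeleton.
Variables (n : nat) (rk : side -> 'I_n -> nat) (col : 'I_n -> nat).
Hypothesis rk_lt : forall z i, rk z i < n.
Hypothesis rk_inj : forall z, injective (rk z).
Hypothesis rkAB : forall i j, (rk SA j < rk SA i) = (rk SB i < rk SB j).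
Variables (X H : nat).
Hypotheses (X0 : 0 < X) (nH : n < 2 ^ H).
Notation wtree := (wtree 'I_n).
Notation items := (seq 'I_n).
Notation srt := (srt rk).
Notation ok := (ok rk).

Section OneSide.
Variables (e : side) (P : items).
Notation lo := (lo rk col e P).
Notation good := (good rk e).
Notation blocks := (blocks rk X e).

(** The index [(X * b.+1).-1] is that of the last point of block [b]. In a decreasing list the block
    is inside the query as soon as its last point is, so searching these samples yields the number
    of whole good blocks with only [size s %/ X] entries. *)
Definition block_ends (s : items) : items :=
  if s is x0 :: _ then [seq nth x0 s (X * b.+1).-1 | b <- iota 0 (size s %/ X)]
  else [::].

Lemma block_ends_size s : size (block_ends s) = size s %/ X.
Proof. by case: s => [|x s] /=; rewrite ?div0n // size_map size_iota. Qed.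

Lemma ok_nth q s x0 t : pairwise (fun i j => rk e j <= rk e i) s -> t < size s ->
  ok q e (nth x0 s t) = (t < count (ok q e) s).
Proof.
elim: s t => // i s IH [|t] /= /andP[al pw] ts.
  case: (boolP (ok q e i)) => oi //=; rewrite add0n -has_count; apply/esym/negbTE/hasPn.
  by move=> j /(allP al) ji; apply: contra oi => /leq_trans; apply.
rewrite IH //; case: (boolP (ok q e i)) => oi; first by rewrite add1n ltnS.
have -> : count (ok q e) s = 0.
  apply/eqP; rewrite -leqn0 leqNgt -has_count; apply/hasPn => j /(allP al) ji.
  by apply: contra oi => /leq_trans; apply.
by [].
Qed.

Lemma block_index_lt b m : b < m %/ X -> (X * b.+1).-1 < m.
Proof.
move=> bm; have : b.+1 * X <= m by rewrite -leq_divRL.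
have : 0 < X * b.+1 by rewrite muln_gt0 X0.
by rewrite mulnC; move: (_ * _) => y; clear; lia.
Qed.

Lemma block_ends_sorted s : pairwise (fun i j => rk e j <= rk e i) s ->
  pairwise (fun i j => rk e j <= rk e i) (block_ends s).
Proof.
case: s => // x0 s0; set s := x0 :: s0 => pw; rewrite [block_ends _]/=.
apply/(pairwiseP x0) => i j; rewrite !inE !size_map !size_iota => hi hj ij.
rewrite !(nth_map 0) ?size_iota // !nth_iota // !add0n.
move/(pairwiseP x0): pw; apply; [exact: block_index_lt|exact: block_index_lt|].
have : X * i.+1 < X * j.+1 by rewrite ltn_pmul2l.
have : 0 < X * i.+1 by rewrite muln_gt0 X0.
by move: (X * i.+1) (X * j.+1) => y z; clear; lia.
Qed.

Lemma block_ends_count q s : pairwise (fun i j => rk e j <= rk e i) s ->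
  count (ok q e) (block_ends s) = count (ok q e) s %/ X.
Proof.
case: s => [|x0 s0]; first by rewrite /= div0n.
set s := x0 :: s0 => pw; rewrite [block_ends _]/= -/s; set k := count _ s.
rewrite count_map (@eq_in_count _ _ (fun b => b < k %/ X)); last first.
  move=> b; rewrite mem_iota /= add0n => bs.
  rewrite ok_nth //; last exact: block_index_lt.
  rewrite -/k leq_divRL // [b.+1 * X]mulnC.
  have : 0 < X * b.+1 by rewrite muln_gt0 X0.
  by move: (X * b.+1) => y; clear; lia.
have le : k %/ X <= size s %/ X by rewrite leq_div2r // count_size.
rewrite -{1}(subnKC le) iotaD count_cat add0n.
rewrite (@eq_in_count _ _ predT (iota 0 _)); last by move=> b; rewrite mem_iota.
rewrite (@eq_in_count _ _ pred0 (iota (k %/ X) _)) ?count_pred0 ?count_predT ?size_iota ?addn0 //.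
by move=> b; rewrite mem_iota => /andP[kb _]; rewrite /= ltnNge kb.
Qed.

Variable cnt : items -> nat.

Definition skel_list (l : items) : wtree :=
  bst H e (block_ends (srt e l)) 0
    (fun b => Add (- (cnt (take (X * b) (srt e l)))%:Z)%R).

(** One row of the table: [cnt] is fixed by a prefix of blocks of the opposite side. The count is
    entered with a minus sign, since it is to be subtracted. *)
Definition skel : wtree := seg2 rk lo H X P skel_list.

Section SkelQuery.
Variables (q : side -> nat) (S : pred nat).
Hypothesis q_le : forall z, q z <= n.
Notation events := (events (viol rk q) S).
Notation cost := (cost (viol rk q) S).
Hypothesis uP : uniq P.

Lemma skel_list_query l : subseq l P ->
  events (skel_list l) = [:: inl (- (cnt (blocks q l))%:Z)%R] /\
  cost (skel_list l) <= H.+1.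
Proof.
move=> sub; rewrite /skel_list.
have [||-> c] := bst_query (rk := rk) q S 0
  (fun b => Add (- (cnt (take (X * b) (srt e l)))%:Z)%R) (f := H) (z := e)
  (s := block_ends (srt e l)).
- rewrite block_ends_size size_srt (leq_ltn_trans (leq_div _ _)) //.
  exact: (sub_size nH uP sub).
- exact/block_ends_sorted/srt_pairwise.
rewrite add0n block_ends_count ?good_srt in c *; try exact: srt_pairwise.
by split=> //; rewrite addn1 in c.
Qed.

(** A list shorter than [X] has no whole block and [cnt] vanishes on the empty list, so the pruned
    tree gives the same sum as the full one. *)
Lemma gain_skel : cnt [::] = 0 ->
  gain (events skel) = (- (\sum_(l <- paths rk col H e P q) cnt (blocks q l))%:Z)%R.
Proof.
move=> c0; rewrite /skel events_seg2 //.
have -> : flatten [seq events (skel_list l) | l <- path2 rk lo H q X P] =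
  flatten [seq [:: inl (- (cnt (blocks q l))%:Z)%R] | l <- path2 rk lo H q X P].
  congr flatten; apply/eq_in_map => l /path2_sub sub.
  by have [-> _] := skel_list_query sub.
have -> : \sum_(l <- paths rk col H e P q) cnt (blocks q l) =
    \sum_(l <- path2 rk lo H q X P) cnt (blocks q l).
  apply/esym/path2_big => // l lX; rewrite /blocks divn_small ?muln0 ?take0 //.
  exact: leq_ltn_trans (good_le _ _ _ _) lX.
rewrite gain_flatten (eq_bigr (fun l => (- (cnt (blocks q l))%:Z)%R)).
  by rewrite sumrN -(raddf_sum Posz).
by move=> l _; rewrite /gain big_seq1.
Qed.

Lemma outs_skel : outs (events skel) = [::].
Proof.
rewrite /skel events_seg2 // outs_flatten.
have : {subset path2 rk lo H q X P <= [pred l | subseq l P]}.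
  by move=> l /path2_sub.
elim: path2 => //= l ls IH sub.
have [-> _] := skel_list_query (sub l (mem_head _ _)).
by apply: IH => l' hl'; apply: sub; rewrite inE hl' orbT.
Qed.

Lemma cost_skel : cost skel <= H.+1 ^ 2 * (H.+1 + 6).
Proof.
by apply: cost_seg2 => // l /path2_sub /skel_list_query[].
Qed.

End SkelQuery.

(** A list of length m takes at most 2m/X + 1 records. Summed over the lists this is 2N/X, plus 1 +
    4 for each of at most N/X lists with their tree nodes: hence 7. *)
Lemma buildable_skel (R : realType) (W : nat) (p : 'I_n -> R * R) E :
  7 <= W -> n <= W -> (forall s, cnt s <= n) ->
  buildable W p E (eq skel) ((7 * ((4 * H + 1) ^ 2 * size P)) %/ X).
Proof.
move=> W7 nW cn.
have [l _|l _|K KX bK] := @buildable_seg2 n rk rk_lt lo H (lo_rk rk col e P) nH R W p E X P skel_list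
  (fun l => size l %/ X + (size l %/ X).+1 * 1) 2 X X W7 X0.
- rewrite -(size_srt rk e l) -block_ends_size; apply: buildable_bst => // j _.
  by apply: buildable_add => //; rewrite abszN absz_nat.
- have := leq_divM (size l) X; rewrite mulnC muln1 mulnDr mulnS; lia.
apply: buildable_sub bK => //; rewrite leq_divRL // mulnC.
apply: leq_trans KX _; set N := _ * size P.
have := leq_divM N X; rewrite mulnC; nia.
Qed.

End OneSide.
End Skeleton.

(** * Sharing within the lists, and the color tests *)

Section Node.
Variables (n : nat) (rk : side -> 'I_n -> nat) (col : 'I_n -> nat).
Hypothesis rk_lt : forall z i, rk z i < n.
Hypothesis rk_inj : forall z, injective (rk z).
Hypothesis rkAB : forall i j, (rk SA j < rk SA i) = (rk SB i < rk SB j).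
Variables (X H : nat).
Hypotheses (X0 : 0 < X) (nH : n < 2 ^ H).
Variables (R : realType) (W : nat) (p : 'I_n -> R * R).
Hypotheses (W7 : 7 <= W) (n0 : 0 < n) (nW : n <= W).
Notation buildable := (buildable W p).
Notation wtree := (wtree 'I_n).
Notation items := (seq 'I_n).
Notation srt := (srt rk).
Notation ok := (ok rk).

Lemma buildable_or (E F : wtree -> Prop) G k1 k2 :
  buildable E F k1 -> buildable (fun t => E t \/ F t) G k2 ->
  buildable E G (k1 + k2).
Proof.
move=> b1 b2; apply: buildable_sub (buildable_trans b1 b2) => // t Gt; right.
exact: Gt.
Qed.

Lemma buildable_stop E k : buildable E (eq Stop) k.
Proof.
have b : buildable E (eq Stop) 0 by apply: buildable_avail; right.
exact: buildable_sub b.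
Qed.

Lemma buildable_chains E elem r k :
  {in r, forall i, buildable E (eq (elem i)) k} ->
  buildable E (fun t => exists j, t = chain X elem (drop j r)) (size r * k.+1).
Proof.
elim: r => [|i r IH] b.
  apply: buildable_sub (buildable_stop (E := E) 0) => // t [j ->].
  by case: j.
have br : {in r, forall i, buildable E (eq (elem i)) k}.
  by move=> j jr; apply: b; rewrite inE jr orbT.
have b1 : buildable (fun t => E t \/ exists j, t = chain X elem (drop j r))
    (eq (chain X elem (i :: r))) k.+1.
  rewrite /=; case: ifP => _.
    exact: buildable_stop.
  rewrite -(addn0 k); apply/buildable_both/buildable_two => //.
    by apply: buildable_sub (b i (mem_head _ _)) => // t; left.
  by apply: buildable_avail; left; right; exists 0; rewrite drop0.
rewrite /= mulSn addnC; apply: buildable_sub (buildable_trans (IH br) b1) => //.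
move=> t [[|j] ->]; first by right.
by left; exists j.
Qed.

Section OneSide.
Variables (e : side) (P : items).
Notation lo := (lo rk col e P).

Lemma buildable_cut E F kF kb ke elem base l :
  buildable E F kF ->
  (forall j, j <= size l ->
     buildable (fun t => E t \/ F t) (eq (base (srt e l) j)) kb) ->
  {in l, forall i, buildable E (eq (elem i)) ke} ->
  buildable E (eq (cut rk X H e elem base l))
    (kF + (size l * ke.+1 + (size l + (size l).+1 * kb.+1))).
Proof.
move=> bF bb be; apply: buildable_or bF _.
pose CH t := exists j, t = chain X elem (drop j (rev (srt e l))).
have bC : buildable (fun t => E t \/ F t) CH (size l * ke.+1).
  have -> : size l = size (rev (srt e l)) by rewrite size_rev size_srt.
  apply: buildable_chains => i; rewrite mem_rev mem_srt => il.
  by apply: buildable_sub (be i il) => // t; left.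
apply: buildable_or bC _; rewrite /cut -(size_srt rk e l).
apply: buildable_bst => // j; rewrite add0n size_srt => jl.
rewrite -(addn0 kb); apply/buildable_both/buildable_two => //.
  by apply: buildable_sub (bb j jl) => // t; left.
(* The reversed prefix of length [j] is the suffix of the reversed list starting at [size l - j], so
   its chain is among those of [CH]. *)
apply: buildable_avail; left; right; exists (size l - j).
by rewrite -(size_srt rk e l) -rev_take.
Qed.

Definition color_class (c : nat) : items :=
  sort (fun i j => rk SA i <= rk SA j) [seq j <- P | col j == c].

Definition color_test (c : nat) : wtree := ex_tree rk H e H (color_class c).

Lemma color_class_size c : size (color_class c) = count (fun i => col i == c) P.
Proof. by rewrite size_sort size_filter. Qed.

Lemma buildable_color_test E c :
  buildable E (eq (color_test c)) (11 * H * count (fun i => col i == c) P).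
Proof. by rewrite -color_class_size; apply: buildable_ex_tree => //; rewrite n0. Qed.

Hypothesis uP : uniq P.

Lemma color_test_query q S c :
  events (viol rk q) S (color_test c) =
    (if c \in seen rk col e P q then [:: inl (-1)%R] else [::]) /\
  cost (viol rk q) S (color_test c) <= 3 * H + 4.
Proof.
have sz : size (color_class c) < 2 ^ H.
  by rewrite size_sort; apply: (sub_size nH uP); apply: filter_subseq.
have pw : pairwise (fun i j => rk SA i < rk SA j) (color_class c).
  have : pairwise (fun i j => rk SA i <= rk SA j) (color_class c).
    rewrite -sorted_pairwise; last by move=> i j k; apply: leq_trans.
    by apply: sort_sorted => i j; apply: leq_total.
  have : uniq (color_class c) by rewrite sort_uniq filter_uniq.
  elim: (color_class c) => //= i s IH /andP[ni us] /andP[al pw].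
  rewrite IH // andbT; apply/allP => j js; rewrite ltn_neqAle (allP al) // andbT.
  by apply: contra ni => /eqP/rk_inj ->.
have [-> c1] := ex_tree_query rk_inj rkAB e q S sz sz pw.
split; first last.
  by apply: leq_trans c1 _; clear; lia.
congr (if _ then _ else _); rewrite /seen.
apply/hasP/mapP => [[i]|[i]].
  rewrite mem_sort mem_filter => /andP[/eqP ci iP] oi; exists i => //.
  by rewrite mem_filter oi.
rewrite mem_filter => /andP[oi iP] ->; exists i => //.
by rewrite mem_sort mem_filter eqxx.
Qed.

End OneSide.
End Node.

(** * Queries that split at a node *)

Lemma sum_count_flatten (T T' : Type) (a : pred T') (f : T -> seq T') (ls : seq T) :
  \sum_(l <- ls) count a (f l) = count a (flatten [seq f l | l <- ls]).
Proof. by rewrite count_flatten sumnE !big_map. Qed.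

Lemma opp_count (T T' : Type) (a : pred T') (f : T -> T') (s : seq T) :
  (- (count a (map f s))%:Z = \sum_(i <- s) - (a (f i) : nat)%:Z)%R.
Proof.
elim: s => [|i s IH]; first by rewrite big_nil.
by rewrite big_cons -IH /= PoszD opprD.
Qed.

Lemma flatten_map_map (T T1 T2 : Type) (g : T1 -> T2) (f : T -> seq T1) (s : seq T) :
  flatten [seq map g (f x) | x <- s] = map g (flatten [seq f x | x <- s]).
Proof. by rewrite map_flatten -map_comp. Qed.

Section Split.
Variables (n : nat) (rk : side -> 'I_n -> nat) (col : 'I_n -> nat).
Hypothesis rk_lt : forall z i, rk z i < n.
Hypothesis rk_inj : forall z, injective (rk z).
Hypothesis rkAB : forall i j, (rk SA j < rk SA i) = (rk SB i < rk SB j).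
Variables (X H : nat).
Hypotheses (X0 : 0 < X) (nH : n < 2 ^ H).
Notation wtree := (wtree 'I_n).
Notation items := (seq 'I_n).
Notation srt := (srt rk).
Notation ok := (ok rk).

Variables (U L : items).
Hypotheses (uU : uniq U) (uL : uniq L).

Definition overlap (a s : items) : nat :=
  count (fun i => col i \in map col s) a.

(** The case [b = 0] must be free: there may be many lists shorter than [X], and a row for each of
    them would exceed the space bound. With it, a list of length m pays for m/X rows only. *)
Definition table (s : items) (b : nat) : wtree :=
  if b == 0 then Stop else skel rk col X H SC L (overlap (take (X * b) s)).

Definition upper_base (s : items) (j : nat) : wtree :=
  Both (Add j%:Z) (table s (j %/ X)).

(** The address is emitted whether or not the test succeeds: a leftover upper color is settled by
    this test, and the guard in [lower_elem] must skip it in either case. *)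
Definition upper_elem (addr : nat -> nat) (i : 'I_n) : wtree :=
  Both (color_test rk col H SC L (col i)) (Out (addr (col i))).

Definition upper addr : wtree :=
  side_tree rk col X H SD U (upper_elem addr) upper_base.

Definition lower_elem (addr : nat -> nat) (i : 'I_n) : wtree :=
  Guard (addr (col i)) (color_test rk col H SD U (col i)).

Definition lower addr : wtree :=
  side_tree rk col X H SC L (lower_elem addr) (fun _ j => Add j%:Z).

Section Query.
Variables (q : side -> nat).
Hypothesis q_le : forall z, q z <= n.
Notation events := (events (viol rk q)).
Notation cost := (cost (viol rk q)).
Notation pathsU := (paths rk col H SD U q).
Notation pathsL := (paths rk col H SC L q).
Notation blU := (map col (all_blocks rk col X H SD U q)).
Notation rsU := (map col (all_rest rk col X H SD U q)).
Notation blL := (map col (all_blocks rk col X H SC L q)).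
Notation rsL := (map col (all_rest rk col X H SC L q)).
Notation seenU := (seen rk col SD U q).
Notation seenL := (seen rk col SC L q).

(** The lower lists met by a query hold distinct colors, so adding up the overlaps list by list
    counts each common color once. *)
Lemma sum_overlap a :
  \sum_(l <- pathsL) overlap a (blocks rk X SC q l) = count [in blL] (map col a).
Proof.
have u : uniq (flatten [seq map col (blocks rk X SC q l) | l <- pathsL]).
  have := @uniq_all n rk col rk_lt rk_inj rkAB X H X0 nH SC L q q_le uL.
  rewrite map_cat cat_uniq => /and3P[+ _ _].
  by rewrite /all_blocks map_flatten -map_comp.
rewrite count_map -sum1_count [RHS]big_mkcond /=.
under eq_bigr => l _ do rewrite /overlap -sum1_count big_mkcond.
rewrite exchange_big /=; apply: eq_bigr => i _.
have := sum_mem_uniq (col i) u; rewrite big_map => e.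
rewrite /all_blocks map_flatten -map_comp.
rewrite -[RHS]/(nat_of_bool (col i \in _)) -e; apply: eq_bigr => l _.
by case: (_ \in _).
Qed.

Lemma upper_base_query S l : subseq l U ->
  let es := events S (upper_base (srt SD l) (good rk SD q l)) in
  [/\ gain es = ((good rk SD q l)%:Z - (count [in blL] (map col (blocks rk X SD q l)))%:Z)%R,
      outs es = [::] &
      cost S (upper_base (srt SD l) (good rk SD q l)) <= H.+1 ^ 2 * (H.+1 + 6) + 2].
Proof.
move=> sub; rewrite /= /table.
have g1 z : gain [:: inl z] = z by rewrite /gain big_seq1.
case: eqP => [e|_].
  rewrite /= g1 /blocks e muln0 take0 /= subr0; split=> //.
  by rewrite !addnS addn0 !ltnS.
rewrite -/(blocks rk X SD q l) -cat1s gain_cat g1.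
rewrite gain_skel //; last by rewrite /overlap /= count_pred0.
rewrite sum_overlap outs_skel //; split=> //.
have := @cost_skel n rk col rk_lt rk_inj X H X0 nH SC L (overlap (blocks rk X SD q l)) q S q_le uL.
by move: (_ ^ _ * _) => m; rewrite -/(blocks _ _ _ _ _); clear; lia.
Qed.

Lemma upper_elem_query S addr i :
  let es := events S (upper_elem addr i) in
  [/\ gain es = (- (col i \in seenL)%:Z)%R, outs es = [:: addr (col i)] &
      cost S (upper_elem addr i) <= 3 * H + 6].
Proof.
rewrite /=; have [-> c] := color_test_query col rk_inj rkAB nH SC uL q S (col i).
split.
- by case: (_ \in _); rewrite /gain /= !big_cons big_nil.
- by case: (_ \in _).
- by move: c; clear; lia.
Qed.

Lemma gain_upper S addr :
  gain (events S (upper addr)) =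
  ((size (blU ++ rsU))%:Z - (count [in blL] blU)%:Z - (count [in seenL] rsU)%:Z)%R.
Proof.
rewrite /upper events_side_tree // gain_flatten.
have sub : {subset pathsU <= [pred l | subseq l U]}.
  by move=> l; apply: path2_sub.
rewrite (eq_big_seq (fun l => ((good rk SD q l)%:Z -
    (count [in blL] (map col (blocks rk X SD q l)))%:Z -
    (count [in seenL] (map col (rest rk X SD q l)))%:Z)%R)); last first.
  move=> l /sub sl; rewrite gain_cat gain_flatten.
  have [-> _ _] := upper_base_query S sl; congr (_ + _)%R.
  rewrite opp_count.
  by apply: eq_bigr => i _; have [-> _ _] := upper_elem_query S addr i.
rewrite !sumrB -!(raddf_sum Posz) (@sum_good n rk col rk_lt X H nH SD U q q_le) !sum_count_flatten.
by rewrite !flatten_map_map -map_cat size_map.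
Qed.

Lemma outs_upper S addr : outs (events S (upper addr)) =
  [seq addr (col i) | i <- all_rest rk col X H SD U q].
Proof.
rewrite /upper events_side_tree // outs_flatten /all_rest map_flatten -map_comp.
have sub : {subset pathsU <= [pred l | subseq l U]}.
  by move=> l; apply: path2_sub.
congr flatten; apply/eq_in_map => l /sub sl; rewrite outs_cat outs_flatten.
have [_ -> _] := upper_base_query S sl; rewrite /= /map.
elim: (rest _ _ _ _ l) => //= i s ->.
by have [_ -> _] := upper_elem_query S addr i.
Qed.

Lemma cost_upper S addr : cost S (upper addr) <=
  H.+1 ^ 2 * (H + (H.+1 ^ 2 * (H.+1 + 6) + 2) + X * (3 * H + 6).+1 + 8).
Proof.
apply: cost_side_tree => // [l sl|i].
  by have [] := upper_base_query S sl.
by have [] := upper_elem_query S addr i.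
Qed.

Lemma gain_lower (S : pred nat) addr :
  {in L, forall i, S (addr (col i)) = (col i \in rsU)} ->
  gain (events S (lower addr)) =
  ((size (blL ++ rsL))%:Z -
    (count (fun c => (c \notin rsU) && (c \in seenU)) rsL)%:Z)%R.
Proof.
move=> hS; rewrite /lower events_side_tree // gain_flatten.
have sub : {subset pathsL <= [pred l | subseq l L]}.
  by move=> l; apply: path2_sub.
rewrite (eq_big_seq (fun l => ((good rk SC q l)%:Z -
    (count (fun c => (c \notin rsU) && (c \in seenU)) (map col (rest rk X SC q l)))%:Z)%R)); last first.
  move=> l /sub sl; rewrite gain_cat gain_flatten; congr (_ + _)%R.
    by rewrite /gain big_seq1.
  rewrite opp_count.
  apply: eq_big_seq => i il; rewrite /lower_elem /= hS; last first.
    apply: (mem_subseq sl); rewrite -(mem_srt rk SC).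
    by move: il => /mem_take; rewrite mem_rev => /mem_take.
  have [-> _] := color_test_query col rk_inj rkAB nH SD uU q S (col i).
  by case: (_ \in rsU); rewrite /gain ?big_nil //=; case: ifP; rewrite ?big_nil ?big_seq1.
rewrite !sumrB -!(raddf_sum Posz) (@sum_good n rk col rk_lt X H nH SC L q q_le) !sum_count_flatten.
by rewrite !flatten_map_map -map_cat size_map.
Qed.

Lemma cost_lower S addr : cost S (lower addr) <=
  H.+1 ^ 2 * (H + 1 + X * (3 * H + 5).+1 + 8).
Proof.
apply: cost_side_tree => // i /=.
have [_ c] := color_test_query col rk_inj rkAB nH SD uU q S (col i).
by case: (S _) => //; move: c; clear; lia.
Qed.

(** As [addr] is injective on the colors at hand, the addresses emitted by the first walk mark
    exactly the leftover upper colors. The two gains are then the terms of [union_count]. *)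
Lemma split_query addr :
  {in map col (U ++ L) &, injective addr} ->
  let es1 := events pred0 (upper addr) in
  let S := fun a => a \in outs es1 in
  let es2 := events S (lower addr) in
  (gain es1 + gain es2)%R = (size (undup (seenU ++ seenL)))%:Z.
Proof.
move=> inj /=; rewrite gain_upper gain_lower => [|i iL]; last first.
  rewrite outs_upper; apply/mapP/mapP => -[j jr e]; exists j => //; last by rewrite e.
  apply: inj => //; first by rewrite map_f // mem_cat iL orbT.
  rewrite map_f // mem_cat; move/flattenP: jr => [s /mapP[l /path2_sub sl ->]].
  move=> /mem_take; rewrite mem_rev => /mem_take; rewrite mem_srt => jl.
  by rewrite (mem_subseq sl).
have uaU := @uniq_all n rk col rk_lt rk_inj rkAB X H X0 nH SD U q q_le uU.
have uaL := @uniq_all n rk col rk_lt rk_inj rkAB X H X0 nH SC L q q_le uL.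
have mU := @mem_all n rk col rk_lt rkAB X H nH SD U q q_le.
have mL := @mem_all n rk col rk_lt rkAB X H nH SC L q q_le.
rewrite !map_cat in uaU uaL mU mL.
have := union_count uaU uaL.
have -> : size (undup ((blU ++ rsU) ++ blL ++ rsL)) = size (undup (seenU ++ seenL)).
  apply/perm_size/uniq_perm; rewrite ?undup_uniq // => c.
  by rewrite !mem_undup [in RHS]mem_cat -mU -mL mem_cat.
have -> : count [in blL ++ rsL] rsU = count [in seenL] rsU by apply: eq_count => c; apply: mL.
have -> : count (fun x => (x \notin rsU) && (x \in blU ++ rsU)) rsL =
    count (fun c => (c \notin rsU) && (c \in seenU)) rsL.
  by apply: eq_count => c; rewrite mU.
move: (size _) (count _ blU) (count _ rsU) (count _ rsL) (size _) (size _).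
by move=> a b c d x y; clear; lia.
Qed.

End Query.
End Split.

(** * Space taken by a node of the tree over the ordinates *)

Section SplitSpace.
Variables (n : nat) (rk : side -> 'I_n -> nat) (col : 'I_n -> nat).
Hypothesis rk_lt : forall z i, rk z i < n.
Variables (X H : nat).
Hypotheses (X0 : 0 < X) (nH : n < 2 ^ H).
Variables (R : realType) (W : nat) (p : 'I_n -> R * R).
Hypotheses (W7 : 7 <= W) (n0 : 0 < n) (nW : n <= W).
Notation buildable := (buildable W p).
Notation wtree := (wtree 'I_n).
Notation items := (seq 'I_n).
Variables (U L : items).
Hypotheses (uU : uniq U) (uL : uniq L).
Variables (addr : nat -> nat) (E : wtree -> Prop).
Notation N P := ((4 * H + 1) ^ 2 * size P).

Lemma uniq_size_le (s : items) : uniq s -> size s <= n.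
Proof. by move=> us; have := max_card [in s]; rewrite card_ord (card_uniqP us). Qed.

(** A list of length m needs m/X rows of at most 7 N(L)/X records each, and 7m + 3 more records for
    its search tree, leaves and chains. The 14 is 7 + 3 + 4, the 4 being the overhead of [seg2]. *)
Lemma buildable_upper :
  {in U, forall i, E (color_test rk col H SC L (col i)) /\
     exists t, E (Guard (addr (col i)) t)} ->
  exists2 K, X ^ 2 * K <= (7 * N L + 14 * X ^ 2) * N U &
    buildable E (eq (upper rk col X H U L addr)) K.
Proof.
move=> EU; set KS := (7 * N L) %/ X.
have lists_U l : l \in lists2 rk (lo rk col SD U) H 1 U -> subseq l U.
  exact: lists2_sub.
pose k (l : items) := (size l %/ X) * KS +
  (size l * 3 + (size l + (size l).+1 * 3)).
have [||K KX bK] := @buildable_seg2 n rk rk_lt (lo rk col SD U) H (lo_rk rk col SD U)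
  nH R W p E 1 U (cut rk X H SD (upper_elem rk col H L addr) (upper_base rk col X H L))
  k (7 * N L + 7 * X ^ 2) (3 * X ^ 2) (X ^ 2) W7 isT.
- move=> l /lists_U sl.
  pose F t := exists2 b, b \in iota 1 (size l %/ X) & table rk col X H L (srt rk SD l) b = t.
  have -> : k l = \sum_(b <- iota 1 (size l %/ X)) KS +
     (size l * 2.+1 + (size l + (size l).+1 * 2.+1)).
    by rewrite big_const_seq count_predT size_iota iter_addn_0 mulnC.
  apply: (buildable_cut X H W7 nW (F := F)).
  + apply: buildable_seq => b; rewrite mem_iota /table => /andP[b0 _].
    rewrite eqn0Ngt b0 /=; apply: buildable_skel => // s.
    rewrite (leq_trans (count_size _ _)) // size_take_min (leq_trans (geq_minr _ _)) //.
    by rewrite size_srt uniq_size_le // (subseq_uniq sl).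
  + move=> j jl; rewrite /upper_base -[2]/((1 + 0).+1).
    apply/buildable_both/buildable_two => //.
      apply: buildable_add => //; rewrite absz_nat (leq_trans jl) //.
      by rewrite uniq_size_le // (subseq_uniq sl).
    apply: buildable_avail; rewrite /table; case: eqP => [|/eqP jX]; [by right|left; right].
    exists (j %/ X); last by rewrite /table (negPf jX).
    by rewrite mem_iota lt0n jX /= add1n ltnS leq_div2r.
  + move=> i /(mem_subseq sl) /EU [E1 [t E2]].
    rewrite /upper_elem -[2]/((0 + 1).+1); apply/buildable_both/buildable_two => //.
      by apply: buildable_avail; left.
    exact: buildable_out E2.
- move=> l _; rewrite /k.
  have h1 := leq_divM (7 * N L) X; rewrite -/KS in h1.
  have h2 := leq_divM (size l) X.
  have h3 : X ^ 2 * ((size l %/ X) * KS) <= size l * (7 * N L).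
    have -> : X ^ 2 * ((size l %/ X) * KS) = ((size l %/ X) * X) * (KS * X).
      by rewrite -mulnn; clear; nia.
    exact: leq_mul.
  rewrite mulnDr (leq_trans (leq_add h3 (leqnn _))) //.
  by move: (7 * N L) (X ^ 2) (size l); clear; nia.
exists K => //; apply: leq_trans KX _; rewrite divn1.
by move: (N U) (N L) (X ^ 2); clear; nia.
Qed.

Lemma buildable_lower :
  {in L, forall i, E (Guard (addr (col i)) (color_test rk col H SD U (col i)))} ->
  exists2 K, K <= 10 * N L & buildable E (eq (lower rk col X H U L addr)) K.
Proof.
move=> EL.
have lists_L l : l \in lists2 rk (lo rk col SC L) H 1 L -> subseq l L.
  exact: lists2_sub.
pose k (l : items) := 0 + (size l * 1 + (size l + (size l).+1 * 2)).
have [||K KX bK] := @buildable_seg2 n rk rk_lt (lo rk col SC L) H (lo_rk rk col SC L)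
  nH R W p E 1 L (cut rk X H SC (lower_elem rk col H U addr) (fun _ j => Add j%:Z))
  k 4 2 1 W7 isT.
- move=> l /lists_L sl.
  apply: (buildable_cut X H W7 nW (F := fun t => t = Stop)).
  + by move=> h wf aE; exists [::]; rewrite cats0; split=> // t ->; apply: avail_stop.
  + move=> j jl; apply: buildable_add => //; rewrite absz_nat (leq_trans jl) //.
    by rewrite uniq_size_le // (subseq_uniq sl).
  + by move=> i /(mem_subseq sl) /EL E1; apply: buildable_avail; left.
- by move=> l _; rewrite /k; clear; lia.
exists K => //; move: KX; rewrite divn1 mul1n.
by move: (N L); clear; lia.
Qed.

End SplitSpace.

(** * The tree over the ordinates *)

Lemma split_space_bound x a b e k1 k2 :
  e <= a + b + (k1 + k2) -> x * k1 <= (7 * b + 14 * x) * a -> k2 <= 10 * b ->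
  x * e <= 7 * (a + b) ^ 2 + 15 * (x * (a + b)).
Proof.
move=> he h1 h2; have h3 : x * k2 <= x * (10 * b) by rewrite leq_mul2l h2 orbT.
apply: (@leq_trans (x * (a + b + (k1 + k2)))); first by rewrite leq_mul2l he orbT.
have h4 : a * b <= (a + b) ^ 2 by rewrite -mulnn leq_mul // ?leq_addr ?leq_addl.
have e1 : (7 * b + 14 * x) * a = 7 * (a * b) + 14 * (x * a).
  by rewrite mulnDl -!mulnA [b * a]mulnC.
rewrite e1 in h1; rewrite (mulnCA x 10) in h3; rewrite !mulnDr.
move: h1 h3 h4; move: (x * k1) (x * k2) (x * a) (x * b) (a * b) ((a + b) ^ 2).
by clear; lia.
Qed.

(** The quadratic part is a geometric series: two halves cost at most [7 * m ^ 2] together, and the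
    node adds [7 * m ^ 2]. The linear part grows by 19 = 15 + 4 per level, the 4 being the new
    branches. *)
Lemma tree_space_bound x f a b m e1 e2 e3 e4 :
  0 < m -> 2 * a <= m -> 2 * b <= m -> a + b <= m ->
  x * e1 <= 14 * a ^ 2 + f * (19 * (x * a)) ->
  x * e2 <= 14 * b ^ 2 + f * (19 * (x * b)) ->
  x * e3 <= 7 * m ^ 2 + 15 * (x * m) -> e4 <= 4 ->
  x * (e1 + e2 + e3 + e4) <= 14 * m ^ 2 + f.+1 * (19 * (x * m)).
Proof.
move=> m0 am bm abm h1 h2 h3 h4.
have sq y : 2 * y <= m -> 4 * y ^ 2 <= m ^ 2.
  by move=> h; rewrite -[4]/(2 ^ 2) -expnMn leq_exp2r.
have h5 : f * (19 * (x * a)) + f * (19 * (x * b)) <= f * (19 * (x * m)).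
  by rewrite -!mulnDr !leq_mul2l abm !orbT.
have h6 : x * e4 <= 4 * (x * m).
  by rewrite mulnCA leq_mul2l (leq_trans h4) ?orbT // leq_pmulr.
rewrite !mulnDr mulSn.
move: h1 h2 h3 h5 h6 (sq _ am) (sq _ bm).
move: (x * e1) (x * e2) (x * e3) (x * e4) (f * (19 * (x * a))) (f * (19 * (x * b)))
  (f * (19 * (x * m))) (x * m) (a ^ 2) (b ^ 2) (m ^ 2).
by clear; lia.
Qed.

Section VerticalTree.
Variables (n : nat) (rk : side -> 'I_n -> nat) (col : 'I_n -> nat).
Hypothesis rk_lt : forall z i, rk z i < n.
Hypothesis rk_inj : forall z, injective (rk z).
Hypothesis rkAB : forall i j, (rk SA j < rk SA i) = (rk SB i < rk SB j).
Hypothesis rkCD : forall i j, (rk SC j < rk SC i) = (rk SD i < rk SD j).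
Variables (X H : nat).
Hypotheses (X0 : 0 < X) (nH : n < 2 ^ H).
Variables (R : realType) (W : nat) (p : 'I_n -> R * R).
Hypotheses (W7 : 7 <= W) (n0 : 0 < n) (nW : n <= W).
Notation buildable := (buildable W p).
Notation wf_heap := (wf_heap W p).
Notation avail := (avail p).
Notation wtree := (wtree 'I_n).
Notation items := (seq 'I_n).
Notation ok := (ok rk).
Notation G := ((4 * H + 1) ^ 2).

(** Each color has one test against [U], placed under its guard, and one against [L]; the list trees
    point to them and so are built last. The tests and guards take at most [11 * H + 1] records per
    point, which [G] absorbs. *)
Lemma split_build (U L : items) h : uniq U -> uniq L -> wf_heap h ->
  exists (addr : nat -> nat) e,
    [/\ X ^ 2 * size e <= 7 * (G * (size U + size L)) ^ 2 +
          15 * (X ^ 2 * (G * (size U + size L))),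
        wf_heap (h ++ e), {in map col (U ++ L) &, injective addr},
        avail (h ++ e) (upper rk col X H U L addr) &
        avail (h ++ e) (lower rk col X H U L addr)].
Proof.
move=> uU uL wf.
pose ks := undup (map col (U ++ L)).
have uks : uniq ks by apply: undup_uniq.
have inks i : i \in U ++ L -> col i \in ks by move=> il; rewrite mem_undup map_f.
have [c _|addr [e1 [s1 wf1 inj av1]]] := @guards R n W p W7 nW _ ks
  (color_test rk col H SD U) (fun c => 11 * H * count (fun i => col i == c) U) h uks wf.
  exact: buildable_color_test.
pose E1 t := exists2 c, c \in ks & Guard (addr c) (color_test rk col H SD U c) = t.
pose F0 t := exists2 c, c \in ks & color_test rk col H SC L c = t.
have bF : buildable E1 F0 (\sum_(c <- ks) 11 * H * count (fun i => col i == c) L).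
  by apply: buildable_seq => c _; apply: buildable_color_test.
have [|K1 K1X b1] := @buildable_upper n rk col rk_lt X H X0 nH R W p W7 nW U L uU addr
  (fun t => E1 t \/ F0 t).
  move=> i iU; have ik : col i \in ks by apply: inks; rewrite mem_cat iU.
  split; first by right; exists (col i).
  by exists (color_test rk col H SD U (col i)); left; exists (col i).
have [|K2 K2X b2] := @buildable_lower n rk col rk_lt X H nH R W p W7 nW U L uL addr
  (fun t => E1 t \/ F0 t).
  move=> i iL; left; exists (col i) => //; apply: inks.
  by rewrite mem_cat iL orbT.
have b := buildable_or bF (buildable_two b1 b2).
have [|e2 [s2 wf2 av2]] := b _ wf1; first by move=> t [c cks <-]; apply: av1.
exists addr, (e1 ++ e2); rewrite catA; split=> //.
- have S1 : \sum_(c <- ks) (11 * H * count (fun i => col i == c) U).+1 <=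
      11 * H * size U + (size U + size L).
    under eq_bigr => c _ do rewrite -addn1.
    rewrite big_split /= -big_distrr leq_add //.
      by rewrite leq_mul2l sum_count_fibers ?orbT.
    by rewrite sum1_size (leq_trans (size_undup _)) // size_map size_cat.
  have S2 : \sum_(c <- ks) 11 * H * count (fun i => col i == c) L <= 11 * H * size L.
    by rewrite -big_distrr leq_mul2l sum_count_fibers ?orbT.
  have HG : 11 * H + 1 <= G by rewrite -mulnn; clear; nia.
  rewrite size_cat.
  have se : size e1 + size e2 <= (11 * H + 1) * (size U + size L) + (K1 + K2).
    move: s1 s2 S1 S2; move: (\sum_(c <- ks) _) (\sum_(c <- ks) _) => x y.
    by clear; nia.
  rewrite [G * (size U + size L)]mulnDr.
  apply: (split_space_bound _ K1X K2X).
  apply: leq_trans se _; rewrite leq_add2r mulnDr leq_add // leq_mul2r.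
    by rewrite HG orbT.
  by rewrite HG orbT.
- by move=> c d cu du; apply: inj; rewrite mem_undup.
- by apply: av2; left.
- by apply: av2; right.
Qed.

Definition inside q (i : 'I_n) : bool :=
  [&& ok q SA i, ok q SB i, ok q SC i & ok q SD i].

Definition seen_in q (s : items) : seq nat := [seq col i | i <- s & inside q i].

Definition split_time : nat :=
  H.+1 ^ 2 * (H + (H.+1 ^ 2 * (H.+1 + 6) + 2) + X * (3 * H + 6).+1 + 8) +
  H.+1 ^ 2 * (H + 1 + X * (3 * H + 5).+1 + 8).

(** The two trees follow the same path over the ordinates, once per walk; the second walk sees the
    marks collected by the first. *)
Definition solves (t1 t2 : wtree) (s : items) (T : nat) : Prop :=
  forall q, (forall z, q z <= n) ->
  let es1 := events (viol rk q) pred0 t1 in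
  let S := fun a => a \in outs es1 in
  let es2 := events (viol rk q) S t2 in
  (gain es1 + gain es2)%R = (size (undup (seen_in q s)))%:Z /\
  cost (viol rk q) pred0 t1 + cost (viol rk q) S t2 <= T.

Lemma vertical_tree f (s : items) h : size s < 2 ^ f ->
  pairwise (fun i j => rk SC i < rk SC j) s -> wf_heap h ->
  exists e t1 t2,
    [/\ X ^ 2 * size e <= 14 * (G * size s) ^ 2 + f * (19 * (X ^ 2 * (G * size s))),
        wf_heap (h ++ e), avail (h ++ e) t1, avail (h ++ e) t2 &
        solves t1 t2 s (4 * f + 2 + split_time)].
Proof.
elim: f s h => [|f IH] s h sf pw wf.
  exists [::], Stop, Stop; rewrite cats0 /= muln0; split=> //; try exact: avail_stop.
  move: sf; rewrite expn0 ltnS leqn0 size_eq0 => /eqP -> q q_le /=.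
  by rewrite /gain big_nil; split=> //; rewrite leq_addr.
case ed: (drop (size s)./2 s) => [|x s'].
  exists [::], Stop, Stop; rewrite cats0 /= muln0; split=> //; try exact: avail_stop.
  rewrite (halve_nil ed) => q q_le /=.
  by rewrite /gain big_nil; split=> //; clear; lia.
have [es s1 s2] := halve ed; set L := take _ s in es s1.
have [f1 f2] : size s' < 2 ^ f /\ size L < 2 ^ f.
  by rewrite s1 s2; move: sf; rewrite expnS; move: (2 ^ f) (size s) => a b; clear; lia.
move: (pw); rewrite {1}es pairwise_cat => /and3P[/allrelP al pw1 /= /andP[/allP al2 pw2]].
have lt_uniq (u : items) : pairwise (fun i j => rk SC i < rk SC j) u -> uniq u.
  elim: u => //= i u IHu /andP[/allP ai /IHu ->]; rewrite andbT.
  by apply/negP => /ai; rewrite ltnn.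
have uL := lt_uniq _ pw1.
have uU : uniq (x :: s') by apply: lt_uniq; rewrite /= pw2 andbT; apply/allP.
have [e1 [a1 [a2 [sz1 wf1 ava1 ava2 sol1]]]] := IH L h f2 pw1 wf.
have [e2 [b1 [b2 [sz2 wf2 avb1 avb2 sol2]]]] := IH s' _ f1 pw2 wf1.
have [addr [e3 [sz3 wf3 inj avu avl]]] := split_build uU uL wf2.
(* If [x] is above d, its whole upper half is out; if it is below c, so are the lower half and [x]
   itself. Otherwise c is no constraint on the upper half nor d on the lower one. These two
   comparisons in each tree give the [4 * f] of the time. *)
pose t1 := Br SD x a1 (Br SC x b1 (upper rk col X H (x :: s') L addr)).
pose t2 := Br SD x a2 (Br SC x b2 (lower rk col X H (x :: s') L addr)).
have bt : buildable (fun t => [\/ a1 = t, a2 = t, b1 = t \/ b2 = t |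
    upper rk col X H (x :: s') L addr = t \/ lower rk col X H (x :: s') L addr = t])
    (fun t => t1 = t \/ t2 = t) 4.
  have av t E : E t -> buildable E (eq t) 0 by move=> Et; apply: buildable_avail; left.
  rewrite -[4]/((0 + (0 + 0).+1).+1 + (0 + (0 + 0).+1).+1).
  have br E z i u v k1 k2 : buildable E (eq u) k1 -> buildable E (eq v) k2 ->
      buildable E (eq (Br z i u v)) (k1 + k2).+1.
    by move=> bu bv; apply/buildable_br/buildable_two.
  apply: buildable_two; apply: (br); [apply: (av)|apply: (br); apply: (av)|apply: (av)|apply: (br); apply: (av)].
  - by constructor 1.
  - by constructor 3; left.
  - by constructor 4; left.
  - by constructor 2.
  - by constructor 3; right.
  - by constructor 4; right.
have [|e4 [sz4 wf4 av4]] := bt _ wf3.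
  by move=> t [<-|<-|[<-|<-]|[<-|<-]];
    [exact/avail_cat/avail_cat|exact/avail_cat/avail_cat|exact/avail_cat|
     exact/avail_cat|exact: avu|exact: avl].
exists (e1 ++ e2 ++ e3 ++ e4), t1, t2; rewrite !catA; split=> //.
- have szs : size s = size L + (size s').+1 by rewrite {1}es size_cat.
  rewrite !size_cat; apply: (tree_space_bound _ _ _ _ sz1 sz2 _ sz4).
  + by rewrite szs muln_gt0 !addnS expn_gt0.
  + rewrite mulnCA leq_mul2l s1; apply/orP; right.
    by move: (size s) => k; clear; lia.
  + rewrite mulnCA leq_mul2l s2; apply/orP; right.
    by move: (size s) => k; clear; lia.
  + by rewrite -mulnDr leq_mul2l szs leq_add2l leqnSn orbT.
  + have eU : size (x :: s') + size L = size s by rewrite szs addnC.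
    by rewrite eU in sz3.
- by apply: av4; left.
- by apply: av4; right.
move=> q q_le; rewrite /t1 /t2 /= !viol_ok.
have add2 a b : a.+1 + b.+1 = (a + b).+2 by rewrite addSn addnS.
have add4 a b : a.+2 + b.+2 = (a + b).+4 by rewrite !addSn !addnS.
have insS : seen_in q s = seen_in q L ++ seen_in q (x :: s').
  by rewrite /seen_in {1}es filter_cat map_cat.
have xU : x \in x :: s' by rewrite mem_head.
case: (boolP (ok q SD x)) => od /=; last first.
  have -> : seen_in q s = seen_in q L.
    rewrite insS /seen_in [filter _ (x :: s')](_ : _ = [::]) ?cats0 //.
    apply/eqP; rewrite -[_ == _]negbK -has_filter; apply/hasPn => i.
    rewrite inE => /predU1P[->|/al2 xi]; first by rewrite /inside (negPf od) !andbF.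
    apply: contra od => /and4P[_ _ _ od]; apply: leq_trans od _; apply: ltnW.
    by rewrite -rkCD.
  have [g c] := sol1 q q_le; split=> //.
  apply: (@leq_trans (4 * f + 2 + split_time).+2); last by move: split_time => T; clear; lia.
  by rewrite add2 !ltnS; apply: c.
case: (boolP (ok q SC x)) => oc /=; last first.
  have -> : seen_in q s = seen_in q s'.
    have ix : inside q x = false by rewrite /inside (negPf oc) !andbF.
    rewrite insS /seen_in [filter _ L](_ : _ = [::]) /= ?ix //.
    apply/eqP; rewrite -[_ == _]negbK -has_filter; apply/hasPn => i iL.
    apply: contra oc => /and4P[_ _ oc _]; apply: leq_trans oc _; apply: ltnW.
    exact: al.
  have [g c] := sol2 q q_le; split=> //.
  apply: (@leq_trans (4 * f + 2 + split_time).+4); last by move: split_time => T; clear; lia.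
  by rewrite add4 !ltnS; apply: c.
have sU : seen_in q (x :: s') = seen rk col SD (x :: s') q.
  congr map; apply: eq_in_filter => i iU; rewrite /inside /ok3.
  have -> : ok q SC i = true; last by [].
  move: iU; rewrite inE => /predU1P[->//|/al2 xi].
  by apply: leq_trans oc _; apply: ltnW.
have sL : seen_in q L = seen rk col SC L q.
  congr map; apply: eq_in_filter => i iL; rewrite /inside /ok3.
  have -> : ok q SD i = true; last by rewrite andbT.
  by apply: leq_trans od _; apply: ltnW; rewrite -rkCD; apply: al.
rewrite insS sU sL; split.
  rewrite (split_query rk_lt rk_inj rkAB X0 nH uU uL q_le inj); congr Posz.
  apply/perm_size/uniq_perm; rewrite ?undup_uniq // => c.
  by rewrite !mem_undup !mem_cat orbC.
set S := fun a => _.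
have c1 := @cost_upper n rk col rk_lt rk_inj rkAB X H X0 nH (x :: s') L uU uL q q_le pred0 addr.
have c2 := @cost_lower n rk col rk_lt rk_inj rkAB X H X0 nH (x :: s') L uU uL q q_le S addr.
apply: (@leq_trans split_time.+4); last by move: split_time => T; clear; lia.
by rewrite add4 !ltnS; apply: leq_add c1 c2.
Qed.

End VerticalTree.

(** * Points and bounds *)

Local Open Scope ring_scope.

Lemma eq_events (I : Type) (v v' : side -> I -> bool) S t : v =2 v' ->
  events v S t = events v' S t.
Proof. by move=> vv; elim: t => //= [z i u -> w ->|u -> w ->|a u ->] //; rewrite vv. Qed.

Lemma eq_cost (I : Type) (v v' : side -> I -> bool) S t : v =2 v' ->
  cost v S t = cost v' S t.
Proof. by move=> vv; elim: t => //= [z i u -> w ->|u -> w ->|a u ->] //; rewrite vv. Qed.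

Section Ranks.
Variables (R : realType) (n : nat) (p : 'I_n -> R * R).

(* Sign changes make [violates] a strict lower bound for every side. *)
Definition coord (z : side) (i : 'I_n) : R :=
  match z with SA => (p i).1 | SB => - (p i).1 | SC => (p i).2 | SD => - (p i).2 end.

Definition below (z : side) (t : R) : nat := #|[pred j | coord z j < t]|.

Definition rank (z : side) (i : 'I_n) : nat := below z (coord z i).

Lemma below_le z t : (below z t <= n)%N.
Proof. by rewrite -[leqRHS]card_ord max_card. Qed.

(** Points and query ends are ranked by the same counting function, so a comparison of coordinates
    is a comparison of ranks even when the query end is not a coordinate of a point. *)
Lemma rank_below z i t : (rank z i < below z t)%N = (coord z i < t).
Proof.
case: (ltP (coord z i) t) => h; last first.
  by rewrite ltnNge subset_leq_card //; apply/subsetP => j; rewrite !inE => /lt_le_trans; apply.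
apply/proper_card/properP; split.
  by apply/subsetP => j; rewrite !inE => /lt_trans; apply.
by exists i; rewrite !inE ?ltxx.
Qed.

Lemma rank_lt z i : (rank z i < n)%N.
Proof.
rewrite -[ltnRHS](card_ord n); apply/proper_card/properP; split.
  by apply/subsetP.
by exists i; rewrite !inE ?ltxx.
Qed.

Lemma rank_ltE z i j : (rank z i < rank z j)%N = (coord z i < coord z j).
Proof. exact: rank_below. Qed.

Lemma rank_AB i j : (rank SA j < rank SA i)%N = (rank SB i < rank SB j)%N.
Proof. by rewrite !rank_ltE /= ltrN2. Qed.

Lemma rank_CD i j : (rank SC j < rank SC i)%N = (rank SD i < rank SD j)%N.
Proof. by rewrite !rank_ltE /= ltrN2. Qed.

Lemma rank_inj z : general_position p -> injective (rank z).
Proof.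
move=> [g1 g2]; have cinj : injective (coord z).
  by case: z => i j /=; [move/g1|move/oppr_inj/g1|move/g2|move/oppr_inj/g2].
move=> i j e; apply: cinj; apply/eqP; rewrite eq_le !leNgt -!rank_ltE e.
by rewrite ltnn.
Qed.

Variables (a b c d : R).

Definition thresholds (z : side) : nat :=
  below z (match z with SA => a | SB => - b | SC => c | SD => - d end).

Lemma violatesE : violates (point_key p) a b c d =2 viol rank thresholds.
Proof. by case=> i; rewrite /viol rank_below //= ltrN2. Qed.

Lemma insideE i : inside rank thresholds i = in_rect a b c d (p i).
Proof.
rewrite /inside /ok /in_rect ![(thresholds _ <= _)%N]leqNgt !rank_below /= !ltrN2 -!leNgt.
by rewrite -!andbA.
Qed.

End Ranks.

Definition height (n : nat) : nat := (trunc_log 2 n).+1.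

(** The factor 218 is [4 * 43 + 4 * 10] from the two walks plus 6 for the descent; the terms with
    [X] only need [4 * 10 + 4 * 9]. *)
Lemma split_time_le X H : (0 < H)%N ->
  (4 * H + 2 + split_time X H <= 218 * (H ^ 5 + X * H ^ 3))%N.
Proof.
move=> H0; rewrite /split_time.
have h1 : (H.+1 ^ 2 <= 4 * H ^ 2)%N.
  by rewrite -[4%N]/(2 ^ 2)%N -expnMn leq_exp2r // mul2n -addnn -addn1 leq_add2l.
set g := (H.+1 ^ 2)%N in h1 *.
have h2 : (H <= H ^ 3)%N by rewrite -{1}[H]expn1 leq_pexp2l.
have h3 : (g * (H.+1 + 6) <= 32 * H ^ 3)%N.
  apply: (@leq_trans (4 * H ^ 2 * (8 * H))%N).
    by apply: leq_mul => //; move: H0; clear; lia.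
  by rewrite mulnACA -expnSr.
have h4 : (X * (3 * H + 6).+1 <= 10 * (X * H))%N.
  by rewrite mulnCA leq_mul2l; apply/orP; right; move: H0; clear; lia.
have h5 : (X * (3 * H + 5).+1 <= 9 * (X * H))%N.
  by rewrite mulnCA leq_mul2l; apply/orP; right; move: H0; clear; lia.
have h6 : (g * (H + (g * (H.+1 + 6) + 2) + X * (3 * H + 6).+1 + 8) <=
   4 * H ^ 2 * (43 * H ^ 3 + 10 * (X * H)))%N.
  apply: leq_mul => //; move: h2 h3 h4 H0.
  by move: (g * _)%N (H ^ 3)%N (X * H)%N (X * _)%N; clear; lia.
have h7 : (g * (H + 1 + X * (3 * H + 5).+1 + 8) <=
   4 * H ^ 2 * (10 * H ^ 3 + 9 * (X * H)))%N.
  apply: leq_mul => //; move: h2 h5 H0.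
  by move: (H ^ 3)%N (X * H)%N (X * _)%N; clear; lia.
have e1 : (H ^ 2 * H ^ 3 = H ^ 5)%N by rewrite -expnD.
have e2 : (H ^ 2 * (X * H) = X * H ^ 3)%N by rewrite mulnCA -expnSr.
have h8 : (H <= H ^ 5)%N by rewrite -{1}[H]expn1 leq_pexp2l.
have r1 : (4 * H ^ 2 * (43 * H ^ 3 + 10 * (X * H)) =
    4 * 43 * H ^ 5 + 4 * 10 * (X * H ^ 3))%N.
  by rewrite mulnDr (mulnACA 4 _ 43) (mulnACA 4 _ 10) e1 e2.
have r2 : (4 * H ^ 2 * (10 * H ^ 3 + 9 * (X * H)) =
    4 * 10 * H ^ 5 + 4 * 9 * (X * H ^ 3))%N.
  by rewrite mulnDr (mulnACA 4 _ 10) (mulnACA 4 _ 9) e1 e2.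
rewrite r1 in h6; rewrite r2 in h7.
have h9 : (4 * H + 2 <= 6 * H ^ 5)%N by move: h8 H0; move: (H ^ 5)%N; clear; lia.
apply: leq_trans (leq_add h9 (leq_add h6 h7)) _; rewrite mulnDr.
by move: (H ^ 5)%N (X * H ^ 3)%N; clear; lia.
Qed.

Section Main.
Variables (R : realType) (n : nat) (p : 'I_n -> R * R) (col : 'I_n -> nat).
Hypotheses (n2 : (2 <= n)%N) (gp : general_position p).
Notation H := (height n).
Notation W := (436 * n ^ 436)%N.

Lemma height_le : (H <= n)%N.
Proof.
by apply: leq_trans (ltn_expl _ (ltnSn 1)) (trunc_logP _ _) => //; apply: ltnW.
Qed.

(** Running totals stay below [436 * n ^ 6], where 436 is twice 218. The far larger exponent in [W]
    comes from using one number as both factor and exponent. *)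
Lemma word_bound m : (m <= 436 * n ^ 5)%N -> (n * m <= W)%N.
Proof.
move=> h; apply: (@leq_trans (436 * n ^ 6)%N).
  by rewrite expnS mulnCA leq_mul2l h orbT.
by rewrite leq_mul2l leq_pexp2l ?orbT //; apply: ltnW.
Qed.

Lemma structure_exists (X : nat) : (1 <= X <= n)%N ->
  exists D : structure R 5,
    [/\ valid_structure W p D,
        (X ^ 2 * size (records D) <= 14 * ((4 * H + 1) ^ 2 * n) ^ 2 +
           H * (19 * (X ^ 2 * ((4 * H + 1) ^ 2 * n))) + X ^ 2)%N &
        forall a b c d, answers_query W query_cmd D a b c d
          (colored_count p col a b c d)
          (70 * (218 * (H ^ 5 + X * H ^ 3)))%:R].
Proof.
move=> /andP[X0 Xn].
have n0 : (0 < n)%N by apply: ltnW.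
have nH : (n < 2 ^ H)%N by apply: trunc_log_ltn.
have nW : (n <= W)%N.
  by rewrite -[X in (X <= _)%N]muln1 word_bound // muln_gt0 expn_gt0 n0.
have W7 : (7 <= W)%N by rewrite (@leq_trans (436 * 1)%N) // leq_mul2l expn_gt0 n0.
pose s := sort (fun i j => rank p SC i <= rank p SC j)%N (enum 'I_n).
have us : uniq s by rewrite sort_uniq enum_uniq.
have ss : size s = n by rewrite size_sort size_enum_ord.
have ps : pairwise (fun i j => rank p SC i < rank p SC j)%N s.
  have : pairwise (fun i j => rank p SC i <= rank p SC j)%N s.
    rewrite -sorted_pairwise; last by move=> i j k; apply: leq_trans.
    by apply: sort_sorted => i j; apply: leq_total.
  elim: (s) us => //= i r IH /andP[ir ur] /andP[al pw].
  rewrite IH // andbT; apply/allP => j jr; rewrite ltn_neqAle (allP al) // andbT.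
  by apply: contra ir => /eqP/(rank_inj gp) ->.
have wf0 : wf_heap W p [::] by move=> a b; rewrite onth0n.
have sH : (size s < 2 ^ H)%N by rewrite ss.
have [e [t1 [t2 [se wfe av1 av2 sol]]]] :=
  @vertical_tree n (rank p) col (rank_lt p) (fun z => rank_inj gp) (rank_AB p) (rank_CD p)
    X H X0 nH R W p W7 n0 nW H s [::] sH ps wf0.
(* The root is never walked: it is a [Both] record only so that its two pointer fields hold the two
   trees. *)
have br : buildable W p (fun t => t = t1 \/ t = t2) (eq (Both t1 t2)) 1.
  rewrite -[1%N]/(0 + 0).+1; apply/buildable_both/buildable_two => //.
    by apply: buildable_avail; left; left.
  by apply: buildable_avail; left; right.
have [|e' [se' wf' /(_ _ erefl)[v rv]]] := br _ wfe; first by move=> t [->|->].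
set h := (_ ++ e') in wf' rv.
have vv D x : records D = h -> valid_value W p (Structure h Defs.Nil) x ->
    valid_value W p D x by move=> eD; case: x => //= m; rewrite eD.
exists (Structure h v); split.
- split; first by apply: vv => //; apply: rep_valid rv.
  by move=> a b /wf' [_ ok] f; apply: vv.
- rewrite /= /h size_cat mulnDr leq_add //; first by rewrite ss in se.
  by rewrite -[leqRHS]muln1 leq_mul2l se' orbT.
move=> a b c d.
have [pay [l [r [[ra [b0 [va hb [_ _ bl br0]]]] r1 r2]]]] := rv.
subst l r v.
have unm x y : onth h x = Some y -> y fm = Defs.Nil by move=> /wf' [].
have qle z : (thresholds p a b c d z <= n)%N by apply: below_le.
have [g cT] := sol _ qle.
pose v1 := violates (point_key p) a b c d.
have vE : v1 =2 viol (rank p) (thresholds p a b c d) by apply: violatesE.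
have tb := split_time_le X (ltn0Sn (trunc_log 2 n)); rewrite -/H in tb.
have c5 : (218 * (H ^ 5 + X * H ^ 3) <= 436 * n ^ 5)%N.
  have hn := height_le.
  have i1 : (H ^ 5 <= n ^ 5)%N by rewrite leq_exp2r.
  have i2 : (X * H ^ 3 <= n ^ 5)%N.
    apply: (@leq_trans (n * n ^ 3)%N); first by rewrite leq_mul // leq_exp2r.
    by rewrite -expnS leq_pexp2l.
  by move: i1 i2; move: (H ^ 5)%N (X * H ^ 3)%N (n ^ 5)%N; clear; lia.
have := @query_correct R n W (point_key p) a b c d W7 h ra b0 t1 t2 unm hb r1 r2.
rewrite /= !(eq_events _ _ vE) !(eq_cost _ _ vE) g => /(_ _)[].
  by apply: word_bound; apply: leq_trans c5; apply: leq_trans cT tb.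
move=> t [s' [ex tT [ans tk]]]; exists t, s'; split=> //.
  by rewrite ler_nat (leq_trans tT) // leq_mul2l (leq_trans cT tb) orbT.
rewrite ans; congr (Int (Posz _)); apply/perm_size/uniq_perm; rewrite ?undup_uniq // => k.
rewrite !mem_undup; apply/mapP/mapP => -[i].
  rewrite mem_filter insideE => /andP[ii _] ->; exists i => //.
  by rewrite mem_filter ii mem_enum.
rewrite mem_filter => /andP[ii _] ->; exists i => //.
by rewrite mem_filter insideE ii mem_sort mem_enum.
Qed.

End Main.

(** * From bounds in the height to bounds in lg n *)

Section Bounds.
Variables (R : realType) (n : nat).
Hypothesis n2 : (2 <= n)%N.
Notation H := (height n).
Notation N := (n%:R : R).
Notation L := (lg N).

Lemma ln2_gt0 : 0 < ln 2 :> R.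
Proof. by rewrite ln_gt0 // ltr1n. Qed.

Lemma N_gt0 : 0 < N. Proof. by rewrite ltr0n ltnW. Qed.

Lemma lg_ge1 : 1 <= L.
Proof.
by rewrite /lg ler_pdivlMr ?ln2_gt0 // mul1r ler_ln ?posrE ?N_gt0 // ler_nat.
Qed.

Lemma lg_le_height : L <= H%:R.
Proof.
rewrite /lg ler_pdivrMr ?ln2_gt0 // mulr_natl -lnXn // ler_ln ?posrE ?N_gt0 ?exprn_gt0 //.
by rewrite -natrX ler_nat ltnW // trunc_log_ltn.
Qed.

Lemma height_le_lg : H%:R <= 2 * L.
Proof.
have : (trunc_log 2 n)%:R <= L.
  rewrite /lg ler_pdivlMr ?ln2_gt0 // mulr_natl -lnXn // ler_ln ?posrE ?N_gt0 ?exprn_gt0 //.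
  by rewrite -natrX ler_nat trunc_logP // ltnW.
by rewrite /height -natr1; have := lg_ge1; lra.
Qed.

Lemma cube_le_exp m : (m.+1 ^ 3 <= 8 * 2 ^ m)%N.
Proof.
(* The bound is an equality at exponent 3, where both sides are 64; from there on the cube less than
   doubles at each step. *)
case: m => [|[|[|m]]] //; elim: m => // m IH.
apply: (@leq_trans (2 * m.+4 ^ 3)%N).
  by rewrite !expnS expn0; clear; nia.
by rewrite [(2 ^ m.+4)%N]expnS [leqRHS]mulnCA leq_mul2l.
Qed.

Lemma lg_cube : L ^+ 3 <= 8 * N.
Proof.
apply: (@le_trans _ _ (H%:R ^+ 3)).
  by rewrite lerXn2r ?nnegrE ?lg_le_height //; have := lg_ge1; lra.
rewrite -natrX -natrM ler_nat (leq_trans (cube_le_exp _)) // leq_mul2l.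
by rewrite trunc_logP // ltnW.
Qed.

Lemma lg_le_N : L <= N.
Proof. by apply: le_trans lg_le_height _; rewrite ler_nat height_le. Qed.

(* 70 = 14 * 5: at most 14 * (10 lg n)^4 (n / X)^2 + ... records of 5 words. *)
Definition bound_const : R := 70 * 10 ^+ 4.

Lemma space_bound (X m : nat) : (0 < X)%N ->
  (X ^ 2 * m <= 14 * ((4 * H + 1) ^ 2 * n) ^ 2 +
     H * (19 * (X ^ 2 * ((4 * H + 1) ^ 2 * n))) + X ^ 2)%N ->
  (5 * m).+1%:R <= bound_const * ((N / X%:R) ^+ 2 * L ^+ 4 + N * L ^+ 3).
Proof.
move=> X0; rewrite -(ler_nat R) !(natrD, natrM, natrX) => hm.
have x0 : 0 < X%:R ^+ 2 :> R by rewrite exprn_gt0 // ltr0n.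
have x1 : X%:R != 0 :> R by rewrite pnatr_eq0 -lt0n.
set h := H%:R in hm; set u := N / X%:R.
have hL : h <= 2 * L := height_le_lg.
have L1 := lg_ge1; have N0 := N_gt0.
have h1 : 1 <= h by rewrite ler1n.
have g1 : 4 * h + 1 <= 10 * L by lra.
have hm2 : m%:R <= 14 * ((4 * h + 1) ^+ 2 * u) ^+ 2 + h * (19 * ((4 * h + 1) ^+ 2 * N)) + 1.
  rewrite -(ler_pM2l x0); apply: le_trans hm _.
  by rewrite le_eqVlt; apply/orP; left; apply/eqP; rewrite /u; field.
have g2 : (4 * h + 1) ^+ 2 <= 100 * L ^+ 2.
  have -> : 100 * L ^+ 2 = (10 * L) ^+ 2 by ring.
  by rewrite lerXn2r ?nnegrE //; lra.
have g4 : ((4 * h + 1) ^+ 2 * u) ^+ 2 <= 10 ^+ 4 * (u ^+ 2 * L ^+ 4).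
  have -> : 10 ^+ 4 * (u ^+ 2 * L ^+ 4) = ((10 * L) ^+ 2 * u) ^+ 2 by ring.
  have u0 : 0 <= u by rewrite divr_ge0.
  have p1 : 0 <= (4 * h + 1) ^+ 2 * u by rewrite mulr_ge0 ?sqr_ge0.
  have p2 : 0 <= (10 * L) ^+ 2 * u by rewrite mulr_ge0 ?sqr_ge0.
  apply: lerXn2r; rewrite ?nnegrE // ler_wpM2r //.
  by rewrite lerXn2r ?nnegrE //; lra.
have g3 : h * (19 * ((4 * h + 1) ^+ 2 * N)) <= 3800 * (N * L ^+ 3).
  have -> : 3800 * (N * L ^+ 3) = 2 * L * (19 * (100 * L ^+ 2 * N)) by ring.
  rewrite ler_pM ?mulr_ge0 ?sqr_ge0 //; [lra|lra|].
  by rewrite ler_wpM2l // ler_wpM2r // ltW.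
have NL : 1 <= N * L ^+ 3.
  by rewrite mulr_ege1 ?exprn_ege1 // ler1n ltnW.
have uL : 0 <= u ^+ 2 * L ^+ 4 by rewrite mulr_ge0 ?exprn_even_ge0.
rewrite -natr1 natrM /bound_const; move: hm2 g3 g4 NL uL.
have -> : 10 ^+ 4 = 10 * (10 * (10 * 10)) :> R by ring.
move: (m%:R) (h * _) (_ ^+ 2) (N * L ^+ 3) (u ^+ 2 * L ^+ 4) => a b e f g.
lra.
Qed.

Lemma time_bound (X : nat) :
  (70 * (218 * (H ^ 5 + X * H ^ 3)))%:R <= bound_const * (L ^+ 5 + X%:R * L ^+ 3).
Proof.
rewrite !(natrD, natrM, natrX); set h := H%:R.
have hL : h <= 2 * L := height_le_lg.
have L1 := lg_ge1.
have e5 : h ^+ 5 <= 32 * L ^+ 5.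
  have -> : 32 * L ^+ 5 = (2 * L) ^+ 5 by ring.
  by rewrite lerXn2r ?nnegrE //; lra.
have e3 : X%:R * h ^+ 3 <= 8 * (X%:R * L ^+ 3).
  have -> : 8 * (X%:R * L ^+ 3) = X%:R * (2 * L) ^+ 3 by ring.
  by rewrite ler_wpM2l // lerXn2r ?nnegrE //; lra.
have p5 : 0 <= L ^+ 5 by rewrite exprn_ge0 //; lra.
have p3 : 0 <= X%:R * L ^+ 3 by rewrite mulr_ge0 // exprn_ge0 //; lra.
rewrite /bound_const; move: e5 e3 p5 p3.
have -> : 10 ^+ 4 = 10 * (10 * (10 * 10)) :> R by ring.
move: (h ^+ 5) (X%:R * h ^+ 3) (L ^+ 5) (X%:R * L ^+ 3) => a b e f.
lra.
Qed.

Notation s := (Num.sqrt (N * L)).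

(** The root lies between 1 and [n], since lg n does between 1 and [n]. Rounding a number that is at
    least 1 changes it by at most a factor 2 either way. *)
Lemma sqrt_bounds (X : nat) : rounds X s ->
  [/\ (1 <= X <= n)%N, s <= 2 * X%:R & X%:R <= 2 * s].
Proof.
have L1 := lg_ge1; have N0 := N_gt0; have LN := lg_le_N.
have N2 : 2 <= N by rewrite ler_nat.
have s1 : 1 <= s.
  have NL1 : 1 <= N * L by rewrite mulr_ege1 // ler1n ltnW.
  by rewrite -[leLHS]sqrtr1; apply: ler_wsqrtr.
have sN : s <= N.
  rewrite -[leRHS](ger0_norm (ltW N0)) -sqrtr_sqr; apply: ler_wsqrtr.
  by rewrite expr2 ler_wpM2l // ltW.
have cast (k : nat) : (k%:Z)%:~R = k%:R :> R by [].
case=> e.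
  have lo : X%:R <= s by rewrite -(cast X) e floor_le.
  have hi : s < X%:R + 1.
    by have := floorD1_gt s; rewrite intrD -e cast.
  have X1 : (1 <= X)%N.
    by rewrite -(ltr0n R); lra.
  have X1R : 1 <= X%:R :> R by rewrite ler1n.
  split; [|lra|lra].
  by rewrite X1 -(ler_nat R); lra.
have hi : s <= X%:R by rewrite -(cast X) e ceil_ge.
have lo : X%:R - 1 < s by have := ceilB1_lt s; rewrite intrB -e cast.
have X1R : 0 < X%:R :> R by lra.
split; [|lra|lra].
rewrite -(ltr0n R) X1R /= -lez_nat e ceil_le_int.
exact: sN.
Qed.

Lemma powR_lg : powR L (7%:R / 2%:R) = L ^+ 3 * Num.sqrt L.
Proof.
have L1 := lg_ge1; have L0 : 0 <= L by lra.
have -> : 7%:R / 2%:R = 3%:R + 2^-1 :> R by field.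
rewrite powRD; last by apply/implyP => _; lra.
by rewrite powR_mulrn // powR12_sqrt.
Qed.

(** The table term equals [(N * L) * (N * L ^+ 3) / X ^+ 2], and [N * L] is at most four times the
    square of [X]: 5 = 4 + 1. *)
Lemma space_bound_sqrt (X : nat) : rounds X s ->
  (N / X%:R) ^+ 2 * L ^+ 4 + N * L ^+ 3 <= 5 * (N * L ^+ 3).
Proof.
move=> /sqrt_bounds [/andP[X1 _] h _]; have L1 := lg_ge1; have N0 := N_gt0.
have x0 : 0 < X%:R :> R by rewrite ltr0n.
have NL : N * L <= 4 * X%:R ^+ 2.
  have NL0 : 0 <= N * L by rewrite mulr_ge0 ?(ltW N0) // (le_trans ler01).
  rewrite -[leLHS]sqr_sqrtr //.
  have -> : 4 * X%:R ^+ 2 = (2 * X%:R) ^+ 2 :> R by ring.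
  by rewrite lerXn2r ?nnegrE ?sqrtr_ge0 //; lra.
suff : (N / X%:R) ^+ 2 * L ^+ 4 <= 4 * (N * L ^+ 3) by lra.
have -> : (N / X%:R) ^+ 2 * L ^+ 4 = (N * L) * (N * L ^+ 3) / X%:R ^+ 2.
  by field; rewrite lt0r_neq0.
rewrite ler_pdivrMr ?exprn_gt0 //.
have -> : 4 * (N * L ^+ 3) * X%:R ^+ 2 = 4 * X%:R ^+ 2 * (N * L ^+ 3) by ring.
by rewrite ler_wpM2r // mulr_ge0 ?(ltW N0) // exprn_ge0 // (le_trans ler01).
Qed.

Lemma time_bound_sqrt (X : nat) : rounds X s ->
  L ^+ 5 + X%:R * L ^+ 3 <= 5 * (Num.sqrt N * powR L (7%:R / 2%:R)).
Proof.
move=> /sqrt_bounds [_ _ h]; have L1 := lg_ge1; have N0 := N_gt0.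
have L0 : 0 <= L by lra.
rewrite powR_lg.
have e1 : X%:R * L ^+ 3 <= 2 * (Num.sqrt N * (L ^+ 3 * Num.sqrt L)).
  have -> : 2 * (Num.sqrt N * (L ^+ 3 * Num.sqrt L)) = 2 * (Num.sqrt N * Num.sqrt L) * L ^+ 3.
    by ring.
  by rewrite ler_wpM2r ?exprn_ge0 // -sqrtrM //; exact: ltW.
(* The power 5 of lg n splits into 7/2 and 3/2, and the cubic bound [L ^+ 3 <= 8 * N] controls the
   second factor. Together with the 2 from rounding this gives 5. *)
have e2 : L * Num.sqrt L <= 3 * Num.sqrt N.
  rewrite -[3](@ger0_norm R) // -sqrtr_sqr -sqrtrM ?sqr_ge0 //.
  rewrite -{1}[L](ger0_norm L0) -sqrtr_sqr -sqrtrM ?sqr_ge0 // ler_sqrt; last first.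
    by rewrite mulr_ge0 ?sqr_ge0 // ltW.
  by rewrite -exprSr; have := lg_cube; lra.
have e3 : L ^+ 5 = L ^+ 3 * Num.sqrt L * (L * Num.sqrt L).
  have -> : L ^+ 3 * Num.sqrt L * (L * Num.sqrt L) = L ^+ 4 * Num.sqrt L ^+ 2 by ring.
  by rewrite sqr_sqrtr // -exprSr.
have p : 0 <= L ^+ 3 * Num.sqrt L by rewrite mulr_ge0 ?exprn_ge0 ?sqrtr_ge0.
have e4 : L ^+ 5 <= 3 * (Num.sqrt N * (L ^+ 3 * Num.sqrt L)).
  have -> : 3 * (Num.sqrt N * (L ^+ 3 * Num.sqrt L)) = L ^+ 3 * Num.sqrt L * (3 * Num.sqrt N).
    by ring.
  by rewrite e3 ler_wpM2l.
lra.
Qed.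

End Bounds.

Theorem corollary6 (R : realType) :
  exists (K w : nat) (q : cmd K) (c : R),
  forall (n C : nat) (p : 'I_n -> R * R) (col : 'I_n -> nat),
    (2 <= n)%N ->
    general_position p ->
    (forall i, (1 <= col i <= C)%N) ->
    exists D : nat -> structure R K,
      (forall X : nat, (1 <= X <= n)%N ->
         counts_colors (w * n ^ w) q p col (D X)
           (c * ((n%:R / X%:R) ^+ 2 * lg n%:R ^+ 4 + n%:R * lg n%:R ^+ 3))
           (c * (lg n%:R ^+ 5 + X%:R * lg n%:R ^+ 3))) /\
      (forall X : nat, rounds X (Num.sqrt (n%:R * lg n%:R) : R) ->
         (1 <= X <= n)%N /\
         counts_colors (w * n ^ w) q p col (D X)
           (c * (n%:R * lg n%:R ^+ 3))
           (c * (Num.sqrt n%:R * powR (lg n%:R) (7%:R / 2%:R)))).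
Proof.
(* The extra factor 5 is the loss in the two bounds for the balanced choice of [X]. *)
exists 5%N, 436%N, query_cmd, (bound_const R * 5) => n C p col n2 gp _.
have c0 : 0 <= bound_const R by rewrite mulr_ge0 // exprn_ge0.
have counts X : exists D : structure R 5, (1 <= X <= n)%N ->
    counts_colors (436 * n ^ 436) query_cmd p col D
      (bound_const R * ((n%:R / X%:R) ^+ 2 * lg n%:R ^+ 4 + n%:R * lg n%:R ^+ 3))
      (bound_const R * (lg n%:R ^+ 5 + X%:R * lg n%:R ^+ 3)).
  case hX: (1 <= X <= n)%N; last by exists (Structure [::] Defs.Nil).
  have [D [vD sD aD]] := structure_exists col n2 gp hX.
  exists D => _; split=> //.
    by apply: space_bound => //; case/andP: hX.
  move=> a b c d _ _; have [t [s' [ex tT r0 tk]]] := aD a b c d.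
  by exists t, s'; split=> //; apply: le_trans tT (time_bound R n2 X).
(* One family indexed by [X] serves both claims; values of [X] out of range receive the empty
   structure in [counts]. *)
have [D hD] := choice counts; exists D.
have mono X S T S' T' : S <= S' -> T <= T' ->
    counts_colors (436 * n ^ 436) query_cmd p col (D X) S T ->
    counts_colors (436 * n ^ 436) query_cmd p col (D X) S' T'.
  move=> hS hT [vD sD aD]; split=> //; first exact: le_trans sD hS.
  move=> a b c d ab cd; have [t [s' [ex tT r0 tk]]] := aD a b c d ab cd.
  by exists t, s'; split=> //; apply: le_trans tT hT.
have L0 : 0 <= lg n%:R :> R := le_trans ler01 (lg_ge1 R n2).
split=> [X hX|X hX].
  apply: mono (hD X hX); rewrite -mulrA ler_wpM2l // ler_peMl ?ler1n //.
    by rewrite addr_ge0 // mulr_ge0 // ?exprn_ge0 // divr_ge0.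
  by apply: addr_ge0; [exact: exprn_ge0|apply: mulr_ge0 => //; exact: exprn_ge0].
have [Xn _ _] := sqrt_bounds n2 hX; split=> //.
apply: mono (hD X Xn); rewrite -mulrA ler_wpM2l //.
  exact: space_bound_sqrt.
exact: time_bound_sqrt.
Qed.
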